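(* Let $\Omega\subset\mathbb{R}^N$ be a bounded convex domain and let $\mu$ be a measure on $\Omega$ with smooth positive density $f$ with respect to Lebesgue measure, $d\mu=f\,dx$. Let $H:=-\Delta+V$, where $$V:=-\frac14 f^{-2}|\nabla f|^2+\frac12 f^{-1}\Delta f=f^{-1/2}\Delta f^{1/2}.$$ Let $u$ be a function on $\Omega$ with $\int_\Omega u\,d\mu=0$. Using the notation $\tilde u=f^{1/2}u$ and $\tilde\psi=f^{1/2}\psi$, we have $$\|u\|_{\dot H^{-1}(d\mu)}=\left(\int_\Omega\tilde u(x)\,\tilde\psi(x)\,dx\right)^{1/2},$$ where $\tilde\psi$ is the solution to the elliptic boundary value problem $$H\tilde\psi=\tilde u\ \text{ in }\Omega,\qquad \tilde\psi=0\ \text{ on }\partial\Omega.$$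
   Context: For functions $u$ with $\int_\Omega u\,d\mu=0$, the weighted negative homogeneous Sobolev norm is $$\|u\|_{\dot H^{-1}(d\mu)}:=\sup\left\{\int_\Omega u\,\varphi\,d\mu:\ \|\varphi\|_{\dot H^1(d\mu)}=1\right\},\qquad \|\varphi\|_{\dot H^1(d\mu)}^2:=\int_\Omega|\nabla\varphi|^2\,d\mu.$$ The operator $H$ is called the Witten Laplacian; it can alternatively be defined by the similarity transform $H\psi=f^{1/2}L(f^{-1/2}\psi)$, where $L\psi:=-\Delta\psi-\nabla(\log f)\cdot\nabla\psi$.
   Formalization: The supremum defining the negative Sobolev norm is taken only over φ vanishing on the boundary (with φ unrestricted the identity fails, e.g. f=1, u=cos πx on (0,1)); u is taken in L²(μ) and the boundary value problem is understood weakly, with ψ̃ in H¹₀(Ω). *)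

(* Defs.v *)
From HB Require Import structures.
From mathcomp Require Import all_boot all_order all_algebra.
From mathcomp Require Import all_classical all_reals all_analysis.

Set Implicit Arguments.
Unset Strict Implicit.
Unset Printing Implicit Defensive.
Import Order.TTheory GRing.Theory Num.Theory.
Import numFieldNormedType.Exports.

Local Open Scope classical_set_scope.
Local Open Scope ring_scope.

(* The library has the Lebesgue measure on R only.  Row vectors get the product
   sigma-algebra, and the Lebesgue measure on 'rV[R]_n is the n-fold product. *)

Definition measure_rV_display : measure_display -> measure_display.
Proof. exact. Qed.

Section measurable_rV.
Context {d} {T : measurableType d} (n : nat).

Let coord : 'I_n -> 'rV[T]_n -> T := fun i x => x ord0 i.

Let rV_set0 : g_sigma_preimage coord set0.
Proof. exact: sigma_algebra0. Qed.

Let rV_setC A : g_sigma_preimage coord A -> g_sigma_preimage coord (~` A).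
Proof. exact: sigma_algebraC. Qed.

Let rV_bigcup (F : (set 'rV[T]_n)^nat) :
  (forall i, g_sigma_preimage coord (F i)) ->
  g_sigma_preimage coord (\bigcup_i (F i)).
Proof. exact: sigma_algebra_bigcup. Qed.

HB.instance Definition _ := @isMeasurable.Build (measure_rV_display d)
  'rV[T]_n (g_sigma_preimage coord) rV_set0 rV_setC rV_bigcup.

Lemma measurable_coord_rV (i : 'I_n) : measurable_fun [set: 'rV[T]_n] (coord i).
Proof.
move=> _ Y mY; rewrite setTI; apply: sub_sigma_algebra => /=.
rewrite -bigcup_seq/=; exists i => /=; first by rewrite mem_index_enum.
by exists Y => //; rewrite setTI.
Qed.

Lemma measurable_rVP d' (S : measurableType d') (f : S -> 'rV[T]_n) :
  (forall i, measurable_fun setT (fun x => f x ord0 i)) ->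
  measurable_fun setT f.
Proof.
move=> mf; suff key : g_sigma_preimage coord `<=` [set A | measurable (f @^-1` A)].
  by move=> _ A mA; rewrite setTI; exact: key.
apply: smallest_sub.
  split => /=.
  - by rewrite preimage_set0; exact: measurable0.
  - by move=> B mB; rewrite setTD preimage_setC; exact: measurableC.
  - by move=> F mF; rewrite preimage_bigcup; exact: bigcup_measurable.
elim/big_ind : _ => //; first by move=> A B sA sB; rewrite subUset.
move=> i _ A [B mB <-] /=; rewrite setTI.
by rewrite -[X in measurable X]setTI; exact: (mf i).
Qed.

End measurable_rV.

Definition cons_rV (R : realType) (n : nat) (p : R * 'rV[R]_n) : 'rV[R]_n.+1 :=
  \row_(i < n.+1) (if unlift ord0 i is Some j then p.2 ord0 j else p.1).

Fixpoint lebesgue_rV {R : realType} (n : nat) : set 'rV[R]_n -> \bar R :=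
  match n with
  | 0%N => dirac (0 : 'rV[R]_0)
  | m.+1 => pushforward (lebesgue_measure \x (@lebesgue_rV R m))%E
                        (@cons_rV R m)
  end.


Section lebesgue_rV_measure.
Context {R : realType}.

Let uncons_rV m (x : 'rV[R]_m.+1) : R * 'rV[R]_m :=
  (x ord0 ord0, \row_j x ord0 (lift ord0 j)).

Let cons_rVK m : cancel (@cons_rV R m) (@uncons_rV m).
Proof.
case=> a v; rewrite /uncons_rV; congr pair; first by rewrite mxE unlift_none.
by apply/rowP => j; rewrite !mxE liftK.
Qed.

Let measurable_cons_rV m : measurable_fun [set: R * 'rV[R]_m] (@cons_rV R m).
Proof.
apply: measurable_rVP => i; have [j ->|->] := unliftP ord0 i.
  rewrite [X in measurable_fun _ X](_ : _ = (fun x : 'rV[R]_m => x ord0 j) \o snd).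
    by apply: measurableT_comp => //; exact: measurable_coord_rV.
  by apply/funext => p; rewrite mxE liftK.
rewrite [X in measurable_fun _ X](_ : _ = fst)//.
by apply/funext => p; rewrite mxE unlift_none.
Qed.

Let measurable_uncons_rV m : measurable_fun setT (@uncons_rV m).
Proof.
apply: measurable_fun_pair; first exact: measurable_coord_rV.
apply: measurable_rVP => i.
rewrite [X in measurable_fun _ X](_ : _ = fun x : 'rV[R]_m.+1 => x ord0 (lift ord0 i)).
  exact: measurable_coord_rV.
by apply/funext => x; rewrite mxE.
Qed.

Let lebesgue_rV_subproof n :
  [/\ @lebesgue_rV R n set0 = 0%E, forall A, (0 <= @lebesgue_rV R n A)%E,
      semi_sigma_additive (@lebesgue_rV R n) &
      sigma_finite setT (@lebesgue_rV R n)].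
Proof.
elim: n => [|n [m0 mge0 msig mfin]].
  split; [exact: measure0|exact: measure_ge0|
    exact: measure_semi_sigma_additive|exact: sigma_finiteT].
pose M := isMeasure.Build _ _ _ (@lebesgue_rV R n) m0 mge0 msig.
pose m1 : {measure set _ -> \bar R} := HB.pack (@lebesgue_rV R n) M.
pose S := Measure_isSigmaFinite.Build _ _ _ m1 mfin.
pose m : {sigma_finite_measure set 'rV[R]_n -> \bar R} :=
  HB.pack (@lebesgue_rV R n) M S.
pose P : {measure set (measurableTypeR R * 'rV[R]_n)%type -> \bar R} :=
  (@lebesgue_measure R \x m)%E.
have mpre (A : set 'rV[R]_n.+1) : measurable A -> measurable (@cons_rV R n @^-1` A).
  by move=> mA; rewrite -[X in measurable X]setTI; exact: measurable_cons_rV.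
have E A : @lebesgue_rV R n.+1 A = P (@cons_rV R n @^-1` A) by [].
split.
- by rewrite E preimage_set0 measure0.
- move=> A; rewrite E; exact: measure_ge0.
- move=> F mF tF mUF; rewrite E preimage_bigcup.
  apply: measure_semi_sigma_additive.
  + by move=> k; exact: mpre.
  + apply/trivIsetP => /= i j _ _ ij; rewrite -preimage_setI.
    by move/trivIsetP : tF => /(_ _ _ _ _ ij) ->//; rewrite preimage_set0.
  + by rewrite -preimage_bigcup; exact: mpre.
- have /sigma_finiteP[F [TF ndF Foo]] := sigma_finiteT (@lebesgue_measure R).
  have /sigma_finiteP[G [TG ndG Goo]] := sigma_finiteT m.
  exists (fun k => @uncons_rV n @^-1` (F k `*` G k)).
    rewrite -preimage_bigcup (_ : \bigcup_k _ = setT) ?preimage_setT//.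
    apply/seteqP; split => // -[x y] _.
    have [i _ Fix] : (\bigcup_i F i) x by rewrite -TF.
    have [j _ Gjy] : (\bigcup_i G i) y by rewrite -TG.
    exists (maxn i j) => //; split.
      by move: x Fix; exact/subsetPset/ndF/leq_maxl.
    by move: y Gjy; exact/subsetPset/ndG/leq_maxr.
  move=> k; have [mF Fk] := Foo k; have [mG Gk] := Goo k; split.
    rewrite -[X in measurable X]setTI; apply: measurable_uncons_rV => //.
    exact: measurableX.
  rewrite E (_ : _ @^-1` _ = F k `*` G k); last first.
    by apply/seteqP; split => p; rewrite /preimage/mkset cons_rVK.
  have -> : P (F k `*` G k) = (lebesgue_measure (F k) * m (G k))%E.
    exact: product_measure1E.
  by rewrite lte_mul_pinfty// ge0_fin_numE.
Qed.

Let lebesgue_rV0 n : @lebesgue_rV R n set0 = 0%E.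
Proof. by have [] := lebesgue_rV_subproof n. Qed.

Let lebesgue_rV_ge0 n A : (0 <= @lebesgue_rV R n A)%E.
Proof. by have [] := lebesgue_rV_subproof n. Qed.

Let lebesgue_rV_semi_sigma_additive n : semi_sigma_additive (@lebesgue_rV R n).
Proof. by have [] := lebesgue_rV_subproof n. Qed.

HB.instance Definition _ n := isMeasure.Build _ _ _ (@lebesgue_rV R n)
  (lebesgue_rV0 n) (@lebesgue_rV_ge0 n) (@lebesgue_rV_semi_sigma_additive n).

Let lebesgue_rV_sigma_finite n : sigma_finite setT (@lebesgue_rV R n).
Proof. by have [] := lebesgue_rV_subproof n. Qed.

HB.instance Definition _ n := Measure_isSigmaFinite.Build _ _ _
  (@lebesgue_rV R n) (@lebesgue_rV_sigma_finite n).

Lemma lebesgue_rV_box n (A : 'I_n -> set R) : (forall i, measurable (A i)) ->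
  @lebesgue_rV R n [set x | forall i, A i (x ord0 i)] =
  (\prod_(i < n) lebesgue_measure (A i))%E.
Proof.
elim: n A => [A _|n IH A mA].
  by rewrite big_ord0 /= diracE mem_set// => -[].
rewrite big_ord_recl -IH; last by move=> i; exact: mA.
pose B := [set v : 'rV[R]_n | forall i, A (lift ord0 i) (v ord0 i)].
have mB : measurable B.
  rewrite (_ : B = \bigcap_(i in [set: 'I_n])
      ((fun x : 'rV[R]_n => x ord0 i) @^-1` A (lift ord0 i))); last first.
    by apply/seteqP; split => x h i => [_|]; exact: h.
  apply: fin_bigcap_measurable => // i _.
  by rewrite -[X in measurable X]setTI; apply: measurable_coord_rV.
have <- : (@lebesgue_measure R \x @lebesgue_rV R n)%E (A ord0 `*` B) =
    (lebesgue_measure (A ord0) * lebesgue_rV B)%E.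
  by apply: product_measure1E => //; exact: mA.
rewrite /= /pushforward; congr (_ _); apply/seteqP; split => -[a v] /= h.
  split; first by have := h ord0; rewrite mxE unlift_none.
  by move=> i; have := h (lift ord0 i); rewrite mxE liftK.
by case: h => h0 h i; rewrite mxE; case: unliftP => [j ->|->] //; exact: h.
Qed.

End lebesgue_rV_measure.

Section calculus.
Context {R : realType} {N : nat}.
Implicit Types (Omega : set 'rV[R]_N) (f g : 'rV[R]_N -> R).

(* The norm of 'rV[R]_N in the library is the sup norm: it gives the right
   topology, but lengths of gradients have to go through [dotrV]. *)
Definition dotrV (a b : 'rV[R]_N) : R := \sum_(i < N) a ord0 i * b ord0 i.

Definition partial (i : 'I_N) g : 'rV[R]_N -> R :=
  fun x => 'D_(delta_mx ord0 i) g x.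

Definition grad g (x : 'rV[R]_N) : 'rV[R]_N := \row_(i < N) partial i g x.

Definition laplacian g (x : 'rV[R]_N) : R :=
  \sum_(i < N) partial i (partial i g) x.

(* C^oo on the open set Omega: all iterated partial derivatives exist and are
   continuous at every point of Omega. *)
Definition smooth_on Omega g : Prop :=
  forall (s : seq 'I_N) x, Omega x ->
    {for x, continuous (foldr partial g s)} /\
    forall i, derivable (foldr partial g s) x (delta_mx ord0 i).

(* C_c^oo(Omega) *)
Definition test_function Omega g : Prop :=
  let supp := closure [set x | g x != 0] in
  [/\ smooth_on setT g, compact supp & supp `<=` Omega].

End calculus.

Section sobolev.
Context {R : realType} {N : nat}.
Implicit Types (Omega : set 'rV[R]_N) (m : set 'rV[R]_N -> \bar R)
  (u f phi : 'rV[R]_N -> R) (G : 'rV[R]_N -> 'rV[R]_N).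

Definition has_density Omega m f : Prop :=
  forall A, measurable A -> A `<=` Omega ->
    m A = (\int[lebesgue_rV (n := N)]_(x in A) (f x)%:E)%E.

Definition square_integrable Omega m u : Prop :=
  measurable_fun Omega u /\
  (\int[m]_(x in Omega) (u x ^+ 2)%:E < +oo)%E.

Definition weak_gradient Omega phi G : Prop :=
  forall eta, test_function Omega eta -> forall i,
    (\int[lebesgue_rV (n := N)]_(x in Omega) (phi x * partial i eta x)%:E =
     - \int[lebesgue_rV (n := N)]_(x in Omega) (G x ord0 i * eta x)%:E)%E.

(* phi belongs to the closure of C_c^oo(Omega) for the norm
   (\int phi^2 dm + \int |grad phi|^2 dm)^(1/2), and G is its gradient. *)
Definition H10 Omega m phi G : Prop :=
  [/\ square_integrable Omega m phi,
      forall i, square_integrable Omega m (fun x => G x ord0 i),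
      weak_gradient Omega phi G &
      exists eta : nat -> 'rV[R]_N -> R,
        [/\ forall k, test_function Omega (eta k),
            (\int[m]_(x in Omega) ((phi x - eta k x) ^+ 2)%:E)%E
              @[k --> \oo] --> 0%E &
            (\int[m]_(x in Omega)
               (dotrV (G x - grad (eta k) x) (G x - grad (eta k) x))%:E)%E
              @[k --> \oo] --> 0%E]].

Definition dotH1_sqnorm Omega m G : \bar R :=
  (\int[m]_(x in Omega) (dotrV (G x) (G x))%:E)%E.

(* The competitors phi vanish on the boundary, as the Dirichlet problem below
   requires: a supremum over phi with free boundary values corresponds to the
   Neumann problem instead, and is strictly larger in general. *)
Definition dotHm1_norm Omega m u : \bar R :=
  ereal_sup [set y : \bar R | exists phi G,
    [/\ H10 Omega m phi G, dotH1_sqnorm Omega m G = 1%E &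
        y = (\int[m]_(x in Omega) (u x * phi x)%:E)%E]].

End sobolev.

Section witten.
Context {R : realType} {N : nat}.
Implicit Types (Omega : set 'rV[R]_N) (f g v w : 'rV[R]_N -> R).

Definition witten_potential f (x : 'rV[R]_N) : R :=
  - 4^-1 * f x ^- 2 * dotrV (grad f x) (grad f x)
  + 2^-1 * (f x)^-1 * laplacian f x.

Definition witten f g (x : 'rV[R]_N) : R :=
  - laplacian g x + witten_potential f x * g x.

Definition tilde f g : 'rV[R]_N -> R := fun x => Num.sqrt (f x) * g x.

(* v solves H v = w in Omega, v = 0 on the boundary: v lies in H^1_0(Omega) and
   the equation holds in the sense of distributions (H is formally
   self-adjoint). *)
Definition dirichlet_solution Omega f v w : Prop :=
  (exists G, H10 Omega (lebesgue_rV (n := N)) v G) /\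
  forall eta, test_function Omega eta ->
    (\int[lebesgue_rV (n := N)]_(x in Omega) (v x * witten f eta x)%:E =
     \int[lebesgue_rV (n := N)]_(x in Omega) (w x * eta x)%:E)%E.

End witten.

(* Main.v *)
Require Import Defs.
From HB Require Import structures.
From mathcomp Require Import all_boot all_order all_algebra.
From mathcomp Require Import all_classical all_reals all_analysis.
From mathcomp Require Import measurable_realfun.
From mathcomp Require Import ring lra.
Import Order.TTheory GRing.Theory Num.Theory.
Import numFieldNormedType.Exports.
Set Implicit Arguments.
Unset Strict Implicit.
Unset Printing Implicit Defensive.
Local Open Scope classical_set_scope.
Local Open Scope ring_scope.

(** Put g = sqrt f, w = g u, v = g psi, and let V = (laplacian g) / g be the
    potential, so that H g = 0. Write E(eta) for the energy of H, the integral of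
    |grad eta|^2 + V eta^2. The substitution eta = g zeta turns weighted
    Dirichlet integrals into energies: the integral of f |grad zeta|^2 is
    E(g zeta), because the two integrands differ by the divergence of a test
    field ([intg_witten_form_root]). In particular E >= 0 on test functions, and
    the dual norm of u is, by density, the supremum of the integral of w eta over
    the test functions eta of energy 1. Let A be the integral of w v.

    If v were in the form domain of H, the equation H v = w would say that the
    integral of w eta is the form at v and eta and that E(v) = A; Cauchy-Schwarz
    would give the bound sqrt A, attained at v / sqrt A if A > 0. However V may be
    singular at the boundary, v is only known to be a limit of test functions
    in H^1, and the energies of such test functions need not converge. What is
    needed is a sequence of test functions that tends to v in L^2 with
    limsup of the energies at most A. This is [energy_approx], the heart of the
    proof; granted it, Cauchy-Schwarz along the sequence ([dual_young]) gives the
    upper bound ([dual_norm_le]) and the normalised sequence gives the lower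
    one ([dual_normE]).

    To construct the sequence, take two H^1 approximants a and b of v, the second
    one much closer to v, and multiply b by the cutoff
    c = a^2 / (a^2 + (a - b)^2 + e^2), which lives on the support of a, where V is
    bounded. Then E(c b) is the form at b and c^2 b plus the integral of
    b^2 |grad c|^2 ([cut_form]). The first term is close to A: test the equation
    with c^2 b ([energy_cut_le]). The second one is controlled by the integral of
    |grad (a - b)|^2 and by the energy of a on the set where |a| is small
    ([grad_cut_le], [gap_ratio_le]). The latter is small for all approximants a
    at once, because the gradient of an H^1 function vanishes almost everywhere
    on its zero set; the quantitative form needed here comes from truncating a by
    an arctangent ([flat_energy_le]).

    The calculus underneath rests on the vanishing of integrals of partial
    derivatives of compactly supported functions, proved by slicing
    ([integral_partial_eq0]). *)

(** * Partial derivatives and functions of class C^n *)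

Section partial_rules.
Context {R : realType} {N : nat}.
Implicit Types (U : set 'rV[R]_N) (g h : 'rV[R]_N -> R) (x : 'rV[R]_N).

Definition pderivable g x := forall i : 'I_N, derivable g x (delta_mx ord0 i).

Lemma partialD i g h x : pderivable g x -> pderivable h x ->
  partial i (fun y => g y + h y) x = partial i g x + partial i h x.
Proof. by move=> dg dh; rewrite /partial -deriveD. Qed.

Lemma partialM i g h x : pderivable g x -> pderivable h x ->
  partial i (fun y => g y * h y) x = g x * partial i h x + h x * partial i g x.
Proof. by move=> dg dh; rewrite /partial -deriveM. Qed.

Lemma partial_cst i (c : R) x : partial i (fun=> c) x = 0.
Proof. exact: derive_cst. Qed.

Lemma pderivableD g h x : pderivable g x -> pderivable h x ->
  pderivable (fun y => g y + h y) x.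
Proof. by move=> dg dh i; apply: derivableD. Qed.

Lemma pderivableM g h x : pderivable g x -> pderivable h x ->
  pderivable (fun y => g y * h y) x.
Proof. by move=> dg dh i; apply: derivableM. Qed.

Lemma pderivable_cst (c : R) x : pderivable (fun=> c) x.
Proof. by move=> i; exact: derivable_cst. Qed.

Lemma derivable_comp (F : R -> R) g x v : derivable g x v ->
  derivable F (g x) 1 -> derivable (fun y => F (g y)) x v.
Proof.
move=> dg dF; have e0 : g (0 *: v + x) = g x by rewrite scale0r add0r.
have d1 : is_derive (g (0 *: v + x)) 1 F ('D_1 F (g x)).
  by rewrite e0; exact: derivableP.
move/derivable1P: dg => /derivableP d2; apply/derivable1P.
by case: (is_derive1_comp d1 d2).
Qed.

Lemma pderivable_comp (F : R -> R) g x : pderivable g x ->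
  derivable F (g x) 1 -> pderivable (fun y => F (g y)) x.
Proof. by move=> dg dF i; exact: (derivable_comp (dg i) dF). Qed.

Lemma derive_comp (F : R -> R) g x v : derivable g x v ->
  derivable F (g x) 1 -> 'D_v (fun y => F (g y)) x = 'D_1 F (g x) * 'D_v g x.
Proof.
move=> dg dF.
have e0 : g (0 *: v + x) = g x by rewrite scale0r add0r.
(* Along the line t |-> t v + x the chain rule is the one-variable one. *)
have line (k : 'rV[R]_N -> R) : 'D_v k x = 'D_1 (fun t : R => k (t *: v + x)) 0.
  rewrite /derive; set g1 := fun t => t^-1 *: _; set g2 := fun t => t^-1 *: _.
  suff -> : g1 = g2 by [].
  by apply/funext => t; rewrite /g1 /g2 /= scale0r add0r addr0 [_%:A]mulr1.
rewrite !line.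
have d1 : is_derive (g (0 *: v + x)) 1 F ('D_1 F (g x)).
  by rewrite e0; exact: derivableP.
move/derivable1P: dg => /derivableP d2.
exact: (@derive_val _ _ _ _ _ _ _ (is_derive1_comp d1 d2)).
Qed.

Lemma pderivable_sum (I : Type) (s : seq I) (F : I -> 'rV[R]_N -> R) x :
  (forall j, pderivable (F j) x) -> pderivable (fun y => \sum_(j <- s) F j y) x.
Proof.
move=> dF; elim: s => [|j s IH].
  have -> : (fun y => \sum_(j <- [::]) F j y) = fun=> 0.
    by apply/funext => y; rewrite big_nil.
  exact: pderivable_cst.
have -> : (fun y => \sum_(l <- j :: s) F l y) = fun y => F j y + \sum_(l <- s) F l y.
  by apply/funext => y; rewrite big_cons.
exact: (pderivableD (dF j) IH).
Qed.

Lemma partial_sum (I : Type) (s : seq I) (F : I -> 'rV[R]_N -> R) i x :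
  (forall j, pderivable (F j) x) ->
  partial i (fun y => \sum_(j <- s) F j y) x = \sum_(j <- s) partial i (F j) x.
Proof.
move=> dF; elim: s => [|j s IH].
  by under eq_fun do rewrite big_nil; rewrite big_nil partial_cst.
under eq_fun do rewrite big_cons; rewrite big_cons partialD ?IH //.
exact: pderivable_sum.
Qed.

End partial_rules.

Arguments pderivableD {R N g h x} _ _ _.
Arguments pderivableM {R N g h x} _ _ _.
Arguments pderivable_cst {R N} c x _.
Arguments pderivable_sum {R N I s F x} _ _.

Section Ck.
Context {R : realType} {N : nat}.
Implicit Types (U W : set 'rV[R]_N) (g h : 'rV[R]_N -> R) (x : 'rV[R]_N).

(** The order-by-order form of smoothness: closure under products and
    composition is an induction on the order, whereas the sequence of derivatives
    in [smooth_on] grows at the wrong end for the Leibniz rule. *)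
Fixpoint Ck (n : nat) U g : Prop :=
  (forall x, U x -> {for x, continuous g}) /\
  if n is m.+1 then
    (forall x, U x -> pderivable g x) /\ (forall i, Ck m U (partial i g))
  else True.

Lemma Ck_continuous n U g x : Ck n U g -> U x -> {for x, continuous g}.
Proof. by case: n => [|n] [h _]; exact: h. Qed.

Lemma Ck_pderivable n U g x : Ck n.+1 U g -> U x -> pderivable g x.
Proof. by move=> [_ [h _]]; exact: h. Qed.

Lemma Ck_partial n U g i : Ck n.+1 U g -> Ck n U (partial i g).
Proof. by move=> [_ [_ h]]; exact: h. Qed.

Lemma CkW n U g : Ck n.+1 U g -> Ck n U g.
Proof.
elim: n g => [|n IH] g [c [d p]]; first by split.
by split=> //; split=> // i; apply: IH.
Qed.

Lemma smooth_onP U g : smooth_on U g <-> forall n, Ck n U g.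
Proof.
split=> [sg n|cg s x Ux].
  elim: n g sg => [|n IH] g sg.
    by split=> // x Ux; have [] := sg [::] x Ux.
  split; first by move=> x Ux; have [] := sg [::] x Ux.
  split; first by move=> x Ux; have [] := sg [::] x Ux.
  move=> i; apply: IH => s x Ux; have := sg (rcons s i) x Ux.
  by rewrite foldr_rcons.
elim/last_ind: s g cg => [|s i IH] g cg.
  by split; [exact: Ck_continuous (cg 0%N) Ux|exact: Ck_pderivable (cg 1%N) Ux].
by rewrite foldr_rcons; apply: IH => n; exact: Ck_partial (cg n.+1).
Qed.

Lemma Ck_eq n U g h : open U -> (forall x, U x -> g x = h x) ->
  Ck n U g -> Ck n U h.
Proof.
move=> oU; elim: n g h => [|n IH] g h gh.
  move=> [cg _]; split=> // x Ux.
  have nU : \forall y \near x, g y = h y.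
    by near=> y; apply: gh; near: y; exact: open_nbhs_nbhs.
  have := cg x Ux; rewrite /prop_for /continuous_at gh // => cgx.
  by apply: cvg_trans cgx; exact: (@near_eq_cvg _ _ (nbhs x) _ _ _ nU).
move=> [cg [dg pg]].
have nU x : U x -> \forall y \near x, g y = h y.
  by move=> Ux; near=> y; apply: gh; near: y; exact: open_nbhs_nbhs.
have gC : Ck n.+1 U g by split.
split; first by move=> x Ux; exact: Ck_continuous (IH _ _ gh (CkW gC)) Ux.
split; first by move=> x Ux i; apply: near_eq_derivable (dg x Ux i); exact: nU.
move=> i; apply: IH (pg i) => x Ux; apply: near_eq_derive; exact: nU.
Unshelve. all: by end_near. Qed.

Lemma for_continuousD g h x : {for x, continuous g} -> {for x, continuous h} ->
  {for x, continuous (fun y => g y + h y)}.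
Proof. by move=> cg ch; exact: (@cvgD _ _ _ (nbhs x) _ g h _ _ cg ch). Qed.

Lemma for_continuousM g h x : {for x, continuous g} -> {for x, continuous h} ->
  {for x, continuous (fun y => g y * h y)}.
Proof. by move=> cg ch; exact: (@cvgM _ _ (nbhs x) _ g h _ _ cg ch). Qed.

Lemma Ck_cst n U (c : R) : open U -> Ck n U (fun=> c).
Proof.
move=> oU; elim: n c => [|n IH] c.
  by split=> // x _; exact: cst_continuous.
split; first by move=> x _; exact: cst_continuous.
split; first by move=> x _; exact: pderivable_cst.
by move=> i; apply: Ck_eq (IH 0) => // x _; rewrite partial_cst.
Qed.

Lemma CkD n U g h : open U -> Ck n U g -> Ck n U h ->
  Ck n U (fun x => g x + h x).
Proof.
move=> oU; elim: n g h => [|n IH] g h gC hC.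
  split=> // x Ux; apply: for_continuousD.
    exact: (Ck_continuous gC Ux).
  exact: (Ck_continuous hC Ux).
split.
  move=> x Ux; apply: for_continuousD.
    exact: (Ck_continuous gC Ux).
  exact: (Ck_continuous hC Ux).
split.
  by move=> x Ux; apply: pderivableD; [exact: Ck_pderivable gC Ux|exact: Ck_pderivable hC Ux].
move=> i; apply: Ck_eq (IH _ _ (Ck_partial i gC) (Ck_partial i hC)) => // x Ux.
by rewrite partialD //; [exact: Ck_pderivable gC Ux|exact: Ck_pderivable hC Ux].
Qed.

Lemma CkM n U g h : open U -> Ck n U g -> Ck n U h ->
  Ck n U (fun x => g x * h x).
Proof.
move=> oU; elim: n g h => [|n IH] g h gC hC.
  split=> // x Ux; apply: for_continuousM.
    exact: (Ck_continuous gC Ux).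
  exact: (Ck_continuous hC Ux).
split.
  move=> x Ux; apply: for_continuousM.
    exact: (Ck_continuous gC Ux).
  exact: (Ck_continuous hC Ux).
split.
  by move=> x Ux; apply: pderivableM; [exact: Ck_pderivable gC Ux|exact: Ck_pderivable hC Ux].
move=> i; have H := CkD oU (IH _ _ (CkW gC) (Ck_partial i hC))
  (IH _ _ (CkW hC) (Ck_partial i gC)).
apply: Ck_eq H => // x Ux.
by rewrite partialM //; [exact: Ck_pderivable gC Ux|exact: Ck_pderivable hC Ux].
Qed.

(** Differentiating F k (g x) brings in the derivative of F k, so the
    induction on the order runs over a whole family whose derivatives are C^n
    along g as soon as the family is. A single function suffices for the inverse
    and the square root; the bump needs the sequence [flat_exp]. *)
Lemma Ck_comp_family (I : Type) (F : I -> R -> R) (D : set R) n U g (k : I) :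
  open U ->
  (forall x, U x -> D (g x)) ->
  (forall k t, D t -> derivable (F k) t 1) ->
  (forall n k, (forall k, Ck n U (fun x => F k (g x))) ->
    exists d : 'rV[R]_N -> R, Ck n U d /\ forall x, U x -> 'D_1 (F k) (g x) = d x) ->
  Ck n U g -> Ck n U (fun x => F k (g x)).
Proof.
move=> oU gD dF F'; elim: n k => [|n IH] k gC.
  split=> // x Ux.
  apply: (@continuous_comp _ _ _ g (F k)); first exact: Ck_continuous gC Ux.
  by apply: differentiable_continuous; apply/derivable1_diffP; apply: dF; exact: gD.
split.
  move=> x Ux.
  apply: (@continuous_comp _ _ _ g (F k)); first exact: Ck_continuous gC Ux.
  by apply: differentiable_continuous; apply/derivable1_diffP; apply: dF; exact: gD.
split.
  move=> x Ux i; apply: derivable_comp; first exact: Ck_pderivable gC Ux i.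
  by apply: dF; exact: gD.
move=> i.
have [d [dC dE]] := F' n k (fun k => IH k (CkW gC)).
apply: Ck_eq (CkM oU dC (Ck_partial i gC)) => // x Ux.
rewrite /partial derive_comp ?dE //; first exact: Ck_pderivable gC Ux i.
by apply: dF; exact: gD.
Qed.

Lemma CkV n U g : open U -> (forall x, U x -> g x != 0) -> Ck n U g ->
  Ck n U (fun x => (g x)^-1).
Proof.
move=> oU g0 gC.
have d1 (t : R) : t != 0 -> derivable (fun y : R => y^-1) t 1.
  by move=> t0; apply: derivableV => //; exact: derivable_id.
apply: (@Ck_comp_family unit (fun _ t => t^-1) [set t | t != 0] _ _ _ tt) => //.
move=> m _ /(_ tt) IH; exists (fun x => (-1) * ((g x)^-1 * (g x)^-1)).
split; first by apply: CkM => //; [exact: Ck_cst|exact: CkM].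
move=> x Ux; rewrite (@deriveV _ _ id) ?derive_id; [|exact: g0|exact: derivable_id].
rewrite expr2 invfM mulN1r; exact: mulr1.
Qed.

Lemma Ck_sqrt n U g : open U -> (forall x, U x -> 0 < g x) -> Ck n U g ->
  Ck n U (fun x => Num.sqrt (g x)).
Proof.
move=> oU g0.
apply: (@Ck_comp_family unit (fun _ => Num.sqrt) [set t | 0 < t] _ _ _ tt) => //.
  by move=> _ t t0; exact: (@ex_derive _ _ _ _ _ _ _ (is_derive1_sqrt t0)).
move=> m _ /(_ tt) IH; exists (fun x => (2 * Num.sqrt (g x))^-1); split.
  apply: CkV => //; last by apply: CkM => //; exact: Ck_cst.
  by move=> x Ux; rewrite mulf_neq0 // gt_eqF // sqrtr_gt0; exact: g0.
by move=> x Ux; rewrite derive_sqrt //; exact: g0.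
Qed.

Lemma is_derive_coord (i j : 'I_N) x : is_derive x (delta_mx ord0 j : 'rV[R]_N)
  (fun y : 'rV[R]_N => y ord0 i) ((j == i)%:R).
Proof.
have E (t : R) : t != 0 -> ((j == i)%:R : R) =
    t^-1 *: ((t *: delta_mx ord0 j + x : 'rV[R]_N) ord0 i - x ord0 i).
  move=> t0; rewrite !mxE eqxx /= addrK eq_sym.
  by rewrite [RHS]mulrA mulVf // mul1r.
have L : (fun t : R => t^-1 *: ((t *: delta_mx ord0 j + x : 'rV[R]_N) ord0 i
   - x ord0 i)) @ 0^' --> ((j == i)%:R : R).
  apply: cvg_trans (@cvg_cst _ (((j == i)%:R) : R) _ (0^' : set_system R) _).
  by apply: near_eq_cvg; near=> t; apply: E; near: t; exact: nbhs_dnbhs_neq.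
by split; [apply/cvg_ex; exists (j == i)%:R; exact: L|exact: cvg_lim L].
Unshelve. all: by end_near. Qed.

Lemma partial_coord i j x : partial j (fun y => y ord0 i) x = (j == i)%:R.
Proof. exact: (@derive_val _ _ _ _ _ _ _ (is_derive_coord i j x)). Qed.

Lemma Ck_coord n U (i : 'I_N) : open U -> Ck n U (fun x => x ord0 i).
Proof.
move=> oU; case: n => [|n].
  by split=> // x _; exact: coord_continuous.
split; first by move=> x _; exact: coord_continuous.
split; first by move=> x _ j; exact: (@ex_derive _ _ _ _ _ _ _ (is_derive_coord i j x)).
move=> j; apply: (@Ck_eq _ _ (fun=> (j == i)%:R)) => //; last exact: Ck_cst.
by move=> x _; rewrite partial_coord.
Qed.

End Ck.

(** * Smooth functions and test functions *)

Section smooth_on_rules.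
Context {R : realType} {N : nat}.
Implicit Types (U : set 'rV[R]_N) (g h : 'rV[R]_N -> R) (x : 'rV[R]_N).

Lemma smooth_on_sub U W g : W `<=` U -> smooth_on U g -> smooth_on W g.
Proof. by move=> WU sg s x /WU; exact: sg. Qed.

Lemma smooth_on_eq U g h : open U -> (forall x, U x -> g x = h x) ->
  smooth_on U g -> smooth_on U h.
Proof. by move=> oU gh /smooth_onP sg; apply/smooth_onP => n; exact: Ck_eq (sg n). Qed.

Lemma smooth_on_cst U (c : R) : open U -> smooth_on U (fun=> c).
Proof. by move=> oU; apply/smooth_onP => n; exact: Ck_cst. Qed.

Lemma smooth_on_coord U i : open U -> smooth_on U (fun x => x ord0 i).
Proof. by move=> oU; apply/smooth_onP => n; exact: Ck_coord. Qed.

Lemma smooth_onD U g h : open U -> smooth_on U g -> smooth_on U h ->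
  smooth_on U (fun x => g x + h x).
Proof.
by move=> oU /smooth_onP sg /smooth_onP sh; apply/smooth_onP => n; exact: CkD.
Qed.

Lemma smooth_onM U g h : open U -> smooth_on U g -> smooth_on U h ->
  smooth_on U (fun x => g x * h x).
Proof.
by move=> oU /smooth_onP sg /smooth_onP sh; apply/smooth_onP => n; exact: CkM.
Qed.

Lemma smooth_onV U g : open U -> (forall x, U x -> g x != 0) ->
  smooth_on U g -> smooth_on U (fun x => (g x)^-1).
Proof. by move=> oU g0 /smooth_onP sg; apply/smooth_onP => n; exact: CkV. Qed.

Lemma smooth_on_sqrt U g : open U -> (forall x, U x -> 0 < g x) ->
  smooth_on U g -> smooth_on U (fun x => Num.sqrt (g x)).
Proof. by move=> oU g0 /smooth_onP sg; apply/smooth_onP => n; exact: Ck_sqrt. Qed.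

Lemma smooth_on_partial U g i : smooth_on U g -> smooth_on U (partial i g).
Proof. by move=> /smooth_onP sg; apply/smooth_onP => n; exact: Ck_partial. Qed.

Lemma smooth_on_sum U (I : Type) (s : seq I) (F : I -> 'rV[R]_N -> R) : open U ->
  (forall i, smooth_on U (F i)) -> smooth_on U (fun x => \sum_(i <- s) F i x).
Proof.
move=> oU sF; elim: s => [|i s IH].
  apply: (@smooth_on_eq _ (fun=> 0)) => [//|x _|]; first by rewrite big_nil.
  exact: smooth_on_cst.
apply: (smooth_on_eq oU _ (smooth_onD oU (sF i) IH)) => x _.
by rewrite big_cons.
Qed.

Lemma smooth_on_laplacian U g : open U -> smooth_on U g -> smooth_on U (laplacian g).
Proof.
move=> oU sg; apply: smooth_on_sum => [//|i].
exact: (smooth_on_partial i (smooth_on_partial i sg)).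
Qed.

Lemma smooth_on_continuous U g x : smooth_on U g -> U x -> {for x, continuous g}.
Proof. by move=> sg Ux; have [] := sg [::] x Ux. Qed.

Lemma smooth_on_pderivable U g x : smooth_on U g -> U x -> pderivable g x.
Proof. by move=> sg Ux; have [] := sg [::] x Ux. Qed.

Lemma partial_congr U i g h x : open U -> U x -> (forall y, U y -> g y = h y) ->
  partial i g x = partial i h x.
Proof.
move=> oU Ux gh; apply: near_eq_derive; near=> y; apply: gh; near: y.
exact: open_nbhs_nbhs.
Unshelve. all: by end_near. Qed.

Lemma partial_eq0 U g i x : open U -> U x -> (forall y, U y -> g y = 0) ->
  partial i g x = 0.
Proof.
by move=> oU Ux g0; rewrite (partial_congr i oU Ux g0) partial_cst.
Qed.

End smooth_on_rules.

Section test_functions.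
Context {R : realType} {N : nat}.
Implicit Types (U : set 'rV[R]_N) (g h eta : 'rV[R]_N -> R) (x : 'rV[R]_N).

Definition supp g : set 'rV[R]_N := closure [set x | g x != 0].

Lemma notin_supp g x : ~ supp g x -> g x = 0.
Proof.
move=> nx; apply/eqP; apply: contra_notT nx => gx0.
by apply: subset_closure; exact: gx0.
Qed.

Lemma open_suppC g : open (~` supp g).
Proof. by apply: closed_openC; exact: closed_closure. Qed.

Lemma supp_sub g (K : set 'rV[R]_N) : closed K ->
  (forall x, ~ K x -> g x = 0) -> supp g `<=` K.
Proof.
move=> cK gK; rewrite /supp closureE; apply: smallest_sub => // x /= gx0.
by apply: contrapT => /gK gx; rewrite gx eqxx in gx0.
Qed.

(** Off the support of [eta], which is closed and contained in U, [g] vanishes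
    identically; hence smoothness on U makes it smooth everywhere. This is what
    lets one multiply test functions by the square root of the density or by the
    potential, about which nothing is known at the boundary. *)
Lemma test_functionS U eta g : open U -> test_function U eta ->
  smooth_on U g -> (forall x, ~ supp eta x -> g x = 0) -> test_function U g.
Proof.
move=> oU [_ cK KU] sg g0.
have sub : supp g `<=` supp eta.
  by apply: supp_sub => //; exact: closed_closure.
split.
- have sg' : smooth_on (~` supp eta) g.
    apply: (@smooth_on_eq _ _ _ (fun=> 0)); first exact: open_suppC.
      by move=> x nx; rewrite g0.
    by apply: smooth_on_cst; exact: open_suppC.
  move=> s x _; have [Kx|nKx] := pselect (supp eta x).
    by apply: sg; exact: KU.
  exact: sg'.
- by apply: (@subclosed_compact _ _ (supp eta)) => //; exact: closed_closure.
- by apply: subset_trans KU.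
Qed.

Lemma test_smooth_on U eta W : test_function U eta -> smooth_on W eta.
Proof. by move=> [sg _ _]; exact: smooth_on_sub sg. Qed.

Lemma testM U eta g : open U -> test_function U eta -> smooth_on U g ->
  test_function U (fun x => eta x * g x).
Proof.
move=> oU te sg; apply: (test_functionS oU te).
  exact: (smooth_onM oU (test_smooth_on te) sg).
by move=> x /notin_supp ->; rewrite mul0r.
Qed.

Lemma testZ U eta (c : R) : open U -> test_function U eta ->
  test_function U (fun x => c * eta x).
Proof.
move=> oU te; apply: test_functionS (te) _ _ => //.
  by apply: smooth_onM => //; [exact: smooth_on_cst|exact: test_smooth_on te].
by move=> x /notin_supp ->; rewrite mulr0.
Qed.

Lemma test0 U : test_function U (fun=> 0).
Proof.
have S0 : supp (fun=> 0 : R) = set0.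
  rewrite /supp (_ : [set x | _] = set0) ?closure0 //.
  by apply/seteqP; split => x //=; rewrite eqxx.
split; rewrite -/(supp _) ?S0 //; first by apply: smooth_on_cst; exact: openT.
exact: compact0.
Qed.

Lemma testD U g h : open U -> test_function U g -> test_function U h ->
  test_function U (fun x => g x + h x).
Proof.
move=> oU [sg cg gU] [sh ch hU].
have sub : supp (fun x => g x + h x) `<=` supp g `|` supp h.
  apply: supp_sub; first by apply: closedU; exact: closed_closure.
  by move=> x /not_orP[/notin_supp -> /notin_supp ->]; rewrite addr0.
split.
- by apply: smooth_onD => //; exact: openT.
- apply: (@subclosed_compact _ _ (supp g `|` supp h)) => //.
    exact: closed_closure.
  exact: compactU.
- by apply: subset_trans sub _; rewrite subUset.
Qed.

Lemma testB U g h : open U -> test_function U g -> test_function U h ->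
  test_function U (fun x => g x - h x).
Proof.
move=> oU tg th; have := testD oU tg (testZ (-1) oU th).
by congr test_function; apply/funext => x; rewrite mulN1r.
Qed.

Lemma test_partial U g i : open U -> test_function U g -> test_function U (partial i g).
Proof.
move=> oU tg; apply: test_functionS (tg) _ _ => //.
  by apply: smooth_on_partial; exact: test_smooth_on tg.
move=> x nx; apply: (@partial_eq0 _ _ (~` supp g)) => //; first exact: open_suppC.
by move=> y; exact: notin_supp.
Qed.

Lemma test_sum U (I : Type) (s : seq I) (F : I -> 'rV[R]_N -> R) : open U ->
  (forall i, test_function U (F i)) -> test_function U (fun x => \sum_(i <- s) F i x).
Proof.
move=> oU tF; elim: s => [|i s IH].
  have -> : (fun x => \sum_(i <- [::]) F i x) = fun=> 0.
    by apply/funext => x; rewrite big_nil.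
  exact: test0.
have -> : (fun x => \sum_(i <- i :: s) F i x) = fun x => F i x + \sum_(j <- s) F j x.
  by apply/funext => x; rewrite big_cons.
exact: testD.
Qed.

Lemma test_laplacian U g : open U -> test_function U g -> test_function U (laplacian g).
Proof.
move=> oU tg; apply: test_sum => // i.
exact: (test_partial i oU (test_partial i oU tg)).
Qed.

Lemma test_continuous U g : test_function U g -> continuous g.
Proof. by move=> [sg _ _] x; exact: (smooth_on_continuous sg). Qed.

Lemma test_pderivable U g x : test_function U g -> pderivable g x.
Proof. by move=> [sg _ _]; exact: (smooth_on_pderivable sg). Qed.

Lemma test_out U g x : test_function U g -> ~ U x -> g x = 0.
Proof. by move=> [_ _ gU] nx; apply: notin_supp => /gU. Qed.

Lemma test_bounded U g : test_function U g -> exists M, forall x, `|g x| <= M.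
Proof.
move=> tg; have [_ cg _] := tg.
have /compact_bounded[M [_ hM]] : compact (g @` supp g).
  by apply: continuous_compact => //; apply: continuous_subspaceT; exact: test_continuous tg.
exists (`|M| + 1) => x; have [/notin_supp -> | ngx] := pselect (~ supp g x).
  by rewrite normr0 addr_ge0.
apply: (hM (`|M| + 1)); last by exists x => //; exact: contrapT.
by rewrite (le_lt_trans (ler_norm M)) // ltrDl.
Qed.

End test_functions.

(** * Bump functions *)

Section bump.
Context {R : realType}.

(** The functions t^-k exp (-1/t) extended by 0; the derivative of each of them
    is a combination of the next two. *)
Definition flat_exp (k : nat) (t : R) : R :=
  if 0 < t then t^-1 ^+ k * expR (- t^-1) else 0.

(** The difference quotient of [flat_exp k] at 0 is [flat_exp k.+1], which this
    bound sends to 0. It is exp y >= y^n / n! with y = 1/t and n = k + 2. *)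
Lemma flat_exp_le k (t : R) : `|flat_exp k.+1 t| <= (k.+2)`!%:R * `|t|.
Proof.
rewrite /flat_exp; case: ifPn => t0; last by rewrite normr0 mulr_ge0.
have ti0 : 0 < t^-1 by rewrite invr_gt0.
rewrite ger0_norm; last by rewrite mulr_ge0 ?expR_ge0 // exprn_ge0 // ltW.
rewrite (gtr0_norm t0).
have := @expR_ge1Dxn _ t^-1 k.+1 (ltW ti0).
set y := t^-1 in ti0 *; have -> : t = y^-1 by rewrite invrK.
move=> h; rewrite expRN ler_pdivrMr ?expR_gt0 // mulrAC ler_pdivlMr //.
rewrite -exprSr mulrC -ler_pdivrMr ?ltr0n ?fact_gt0 //.
by apply: le_trans h; rewrite lerDr.
Qed.

Lemma is_derive_flat_exp k (t : R) :
  is_derive t 1 (flat_exp k) (- k%:R * flat_exp k.+1 t + flat_exp k.+2 t).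
Proof.
have [t0|t0|->] := ltgtP t 0.
- have e : \forall y \near t, cst 0 y = flat_exp k y.
    apply: filterS (lt_le_nbhsl t0) => y y0.
    by rewrite /flat_exp ltNge y0.
  rewrite /flat_exp ltNge ltW //= mulr0 addr0.
  split; first exact: near_eq_derivable e _.
  by rewrite -(near_eq_derive _ e) derive_cst.
- have e : \forall y \near t, y^-1 ^+ k * expR (- y^-1) = flat_exp k y.
    by apply: filterS (lt_nbhsr t0) => y y0; rewrite /flat_exp y0.
  have tn : t != 0 by rewrite gt_eqF.
  have D : is_derive t 1 (fun y : R => y^-1 ^+ k * expR (- y^-1))
     (- k%:R * flat_exp k.+1 t + flat_exp k.+2 t).
    have di : is_derive t 1 (fun y : R => y^-1) (- t ^- 2 *: 1).
      exact: (@is_deriveV _ id).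
    have dX := is_deriveX k di.
    have dN := is_deriveN di.
    have dE := @is_derive1_comp _ expR (fun y => - y^-1) t _ _ (is_derive_expR (- t^-1)) dN.
    have -> : (fun y : R => y^-1 ^+ k * expR (- y^-1)) =
        ((fun y : R => y^-1) ^+ k) * (expR \o (fun y => - y^-1)).
      by apply/funext => y; rewrite exprfctE.
    apply: (is_derive_eq (is_deriveM dX dE)).
    rewrite /flat_exp t0 /= /GRing.scale /=.
    rewrite !exprfctE !mulr1 -!exprVn.
    set y := t^-1; set E := expR _.
    case: (k) => [|m]; first by rewrite !expr0 /=; ring.
    by rewrite /= !exprS; ring.
  split; first exact: near_eq_derivable e (@ex_derive _ _ _ _ _ _ _ D).
  by rewrite -(near_eq_derive _ e); exact: (@derive_val _ _ _ _ _ _ _ D).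
- rewrite /flat_exp ltxx mulr0 addr0 -/(flat_exp k).
  have L : (fun h : R => h^-1 *: (flat_exp k (h *: 1 + 0) - flat_exp k 0)) @ 0^' --> (0 : R).
    have -> : (fun h : R => h^-1 *: (flat_exp k (h *: 1 + 0) - flat_exp k 0)) = flat_exp k.+1.
      apply/funext => h; rewrite addr0 /GRing.scale /= mulr1 /flat_exp ltxx subr0.
      by case: ifP => _; rewrite ?mulr0 // exprS mulrA.
    apply/cvgr0Pnorm_lt => e e0.
    near=> h; apply: le_lt_trans (flat_exp_le k h) _.
    rewrite mulrC -ltr_pdivlMr ?ltr0n ?fact_gt0 //.
    near: h; apply: dnbhs0_lt; rewrite divr_gt0 // ltr0n; exact: fact_gt0.
  by split; [apply/cvg_ex; exists 0; exact: L|exact: cvg_lim L].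
Unshelve. all: by end_near. Qed.

Context {N : nat}.

Lemma Ck_flat_exp k n (U : set 'rV[R]_N) (q : 'rV[R]_N -> R) : open U ->
  Ck n U q -> Ck n U (fun x => flat_exp k (q x)).
Proof.
move=> oU; apply: (@Ck_comp_family _ _ nat flat_exp setT _ _ _ k) => //.
  by move=> j t _; exact: (@ex_derive _ _ _ _ _ _ _ (is_derive_flat_exp j t)).
move=> m j IH; exists (fun x => (- j%:R) * flat_exp j.+1 (q x) + flat_exp j.+2 (q x)); split.
  by apply: CkD => //; apply: CkM => //; exact: Ck_cst.
by move=> x _; exact: (@derive_val _ _ _ _ _ _ _ (is_derive_flat_exp j (q x))).
Qed.

(** Positive exactly in the Euclidean ball of centre [c] and radius [r]. *)
Definition ball_defect (c : 'rV[R]_N) (r : R) (x : 'rV[R]_N) : R :=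
  r ^+ 2 + (-1) * \sum_(i < N) (x ord0 i - c ord0 i) * (x ord0 i - c ord0 i).

Definition bump c r (x : 'rV[R]_N) : R := flat_exp 0 (ball_defect c r x).

Lemma Ck_ball_defect c r n : Ck n setT (ball_defect c r).
Proof.
have oT := @openT 'rV[R]_N.
have smd i : smooth_on setT (fun x : 'rV[R]_N => x ord0 i - c ord0 i).
  by apply: smooth_onD => //; [exact: smooth_on_coord|exact: smooth_on_cst].
move: n; apply/smooth_onP; apply: smooth_onD => //; first exact: smooth_on_cst.
apply: (smooth_onM oT (smooth_on_cst (-1) oT)).
by apply: smooth_on_sum => [//|i]; exact: (smooth_onM oT (smd i) (smd i)).
Qed.

Lemma supp_bump c r : 0 <= r ->
  supp (bump c r) `<=` [set x | forall i, x ord0 i \in `[c ord0 i - r, c ord0 i + r]].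
Proof.
move=> r0; apply: supp_sub.
  rewrite [X in closed X](_ : _ = \bigcap_(i in [set: 'I_N])
      ((fun x : 'rV[R]_N => x ord0 i) @^-1` `[c ord0 i - r, c ord0 i + r])).
    apply: closed_bigI => i _; apply: preimage_closed; last exact: itv_closed.
    by move=> x _; exact: coord_continuous.
  by apply/seteqP; split => x /= h i => [_|]; exact: h.
move=> x /= /existsNP[i xi]; rewrite /bump /flat_exp ifF //.
apply/negbTE; rewrite -leNgt /ball_defect mulN1r subr_le0.
rewrite (bigD1 i) //= -[leLHS]addr0 lerD //; last first.
  by apply: sumr_ge0 => j _; rewrite -expr2 sqr_ge0.
rewrite -expr2 -[leRHS]real_normK ?num_real // ler_sqr ?nnegrE //.
rewrite leNgt; apply/negP => h; apply: xi; rewrite in_itv /=.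
by rewrite -ler_distlC distrC ltW.
Qed.

Lemma bump_test (U : set 'rV[R]_N) (c : 'rV[R]_N) (r : R) : 0 <= r ->
  (forall x : 'rV[R]_N, (forall i, x ord0 i \in `[c ord0 i - r, c ord0 i + r]) -> U x) ->
  test_function U (bump c r).
Proof.
move=> r0 hU; split.
- by apply/smooth_onP => n; apply: Ck_flat_exp; [exact: openT|exact: Ck_ball_defect].
- apply: (@subclosed_compact _ _
     [set x : 'rV[R]_N | forall i, x ord0 i \in `[c ord0 i - r, c ord0 i + r]]).
  + exact: closed_closure.
  + apply: (@rV_compact _ _ (fun i => `[c ord0 i - r, c ord0 i + r]%classic)) => i.
    exact: segment_compact.
  + exact: supp_bump.
- by apply: (subset_trans (@supp_bump c r r0)) => x; exact: hU.
Qed.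

(** Shows that the gradient of the bump does not vanish half-way to the
    boundary of the ball, so that the bump has positive energy. *)
Lemma partial_bump (c : 'rV[R]_N) (r : R) i :
  partial i (bump c r) (c + (r / 2) *: delta_mx ord0 i) = - r * flat_exp 2 (r ^+ 2 - (r / 2) ^+ 2).
Proof.
set x0 := c + _.
have bd j : x0 ord0 j - c ord0 j = (r / 2) * (j == i)%:R.
  by rewrite !mxE eqxx /= addrC addKr.
have dd := Ck_pderivable (Ck_ball_defect c r 1) (I : setT x0).
rewrite /partial /bump derive_comp; first last.
- exact: (@ex_derive _ _ _ _ _ _ _ (is_derive_flat_exp 0 _)).
- exact: dd.
rewrite (@derive_val _ _ _ _ _ _ _ (is_derive_flat_exp 0 _)) oppr0 mul0r add0r.
have -> : ball_defect c r x0 = r ^+ 2 - (r / 2) ^+ 2.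
  rewrite /ball_defect (bigD1 i) //= big1 => [|j ji].
    by rewrite bd eqxx mulr1 addr0 mulN1r expr2.
  by rewrite bd (negbTE ji) mulr0 mul0r.
suff -> : 'D_(delta_mx ord0 i) (ball_defect c r) x0 = - r by rewrite mulrC.
have dco j x : pderivable (fun x : 'rV[R]_N => x ord0 j) x.
  by move=> l; exact: (@ex_derive _ _ _ _ _ _ _ (is_derive_coord j l x)).
have dc j x : pderivable (fun x : 'rV[R]_N => x ord0 j - c ord0 j) x.
  exact: (pderivableD (dco j x) (pderivable_cst (- c ord0 j) x)).
have pc j x : partial i (fun x : 'rV[R]_N => x ord0 j - c ord0 j) x = (i == j)%:R.
  rewrite (partialD i (dco j x) (pderivable_cst (- c ord0 j) x)).
  by rewrite partial_cst addr0 partial_coord.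
have dS := pderivable_sum (s := index_enum 'I_N) (fun j => pderivableM (dc j x0) (dc j x0)).
have dm := pderivableM (pderivable_cst (-1) x0) dS.
rewrite -/(partial i _ x0) (partialD i (pderivable_cst (r ^+ 2) x0) dm).
rewrite partial_cst add0r (partialM i (pderivable_cst (-1) x0) dS) partial_cst mulr0 addr0.
rewrite (@partial_sum _ _ _ _ (fun j (y : 'rV[R]_N) => (y ord0 j - c ord0 j) *
  (y ord0 j - c ord0 j)) i x0 (fun j => pderivableM (dc j x0) (dc j x0))) (bigD1 i) //=.
have p2 j : partial i (fun x : 'rV[R]_N => (x ord0 j - c ord0 j) * (x ord0 j - c ord0 j)) x0 =
    2 * (x0 ord0 j - c ord0 j) * (i == j)%:R.
  by rewrite (partialM i (dc j x0) (dc j x0)) pc; ring.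
rewrite big1 => [|j ji]; rewrite p2 bd.
  by rewrite addr0 eqxx /= !mulr1; field.
by rewrite (negbTE ji) !mulr0 mul0r.
Qed.

End bump.

(** * Open sets and continuous functions are Borel *)

Section borel_rV.
Context {R : realType} {N : nat}.
Implicit Types (U : set 'rV[R]_N) (g h : 'rV[R]_N -> R).

Lemma measurable_box (A : 'I_N -> set R) : (forall i, measurable (A i)) ->
  measurable [set x : 'rV[R]_N | forall i, A i (x ord0 i)].
Proof.
move=> mA; rewrite (_ : [set x | _] =
    \bigcap_(i in [set: 'I_N]) ((fun x : 'rV[R]_N => x ord0 i) @^-1` A i)).
  apply: fin_bigcap_measurable => // i _.
  by rewrite -[X in measurable X]setTI; exact: measurable_coord_rV.
by apply/seteqP; split => x h i => [_|]; exact: h.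
Qed.

(** The sigma-algebra is generated by the coordinates, so an open set has to be
    exhausted by countably many boxes with rational centres. *)
Lemma open_rV_measurable U : open U -> measurable U.
Proof.
move=> oU.
(* Sup-norm balls with rational centres and radii 1 / (n + 1). *)
pose B (p : 'rV[rat]_N * nat) : set 'rV[R]_N :=
  [set x | forall i, ball (ratr (p.1 ord0 i) : R) p.2.+1%:R^-1 (x ord0 i)].
pose F p := if `[< B p `<=` U >] then B p else set0.
have -> : U = \bigcup_p F p.
  apply/seteqP; split => [x Ux|x [p _]]; last first.
    by rewrite /F; case: asboolP => // BU; exact: BU.
  have /nbhs_ballP[e /= e0 eU] : nbhs x U by exact: open_nbhs_nbhs.
  have [k ke] : exists k : nat, k.+1%:R^-1 < e / 2.
    have e20 : 0 < e / 2 by rewrite divr_gt0.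
    have [k _ /(_ k (leqnn k)) ke] := near_infty_natSinv_lt (PosNum e20).
    by exists k.
  have k0 : (0 : R) < k.+1%:R^-1 by rewrite invr_gt0.
  have /choice[q hq] : forall i : 'I_N, exists q : rat,
      (ratr q : R) \in `]x ord0 i - k.+1%:R^-1, x ord0 i + k.+1%:R^-1[.
    move=> i; apply: rat_in_itvoo.
    by rewrite ltrD2l (lt_trans _ k0) // oppr_lt0.
  have xB : B (\row_i q i, k) x.
    move=> i; rewrite /= mxE /ball /=; have := hq i.
    by rewrite in_itv /= -ltr_distlC distrC.
  exists (\row_i q i, k) => //; rewrite /F; case: asboolP => // -[] y yB.
  apply: eU; split=> // i j; rewrite ord1.
  have := yB j; have := xB j; rewrite /ball /= => h1 h2.
  apply: le_lt_trans (ler_distD (ratr ((\row_i q i) ord0 j)) _ _) _.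
  rewrite [ltRHS]splitr ltrD // (lt_trans _ ke) //.
  by rewrite distrC.
apply: countable_bigcupT_measurable => // p; rewrite /F; case: asboolP => // _.
apply: (@measurable_box (fun i => ball (ratr (p.1 ord0 i) : R) p.2.+1%:R^-1)) => i.
by apply: open_measurable; exact: ball_open.
Qed.

Lemma continuous_rV_measurable U g : open U ->
  (forall x, U x -> {for x, continuous g}) -> measurable_fun U g.
Proof.
move=> oU cg; apply: (measurability _ (RGenOInfty.measurableE R)).
move=> _ [_ [a ->] <-]; apply: open_rV_measurable.
rewrite openE => x [Ux ax]; apply: filterI; first exact: open_nbhs_nbhs.
by apply: (cg x Ux); apply: open_nbhs_nbhs; split.
Qed.

Lemma bounded_rV_lty U : measurable U -> bounded_set U ->
  (lebesgue_rV (n := N) U < +oo)%E.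
Proof.
move=> mU [M0 [_ hM0]].
have hM x : U x -> `|x| <= M0 + 1 by apply: hM0; rewrite ltrDl.
move: (M0 + 1) hM => M {hM0} hM.
apply: (@le_lt_trans _ _ (lebesgue_rV (n := N) [set x | forall i, `[- M, M]%classic (x ord0 i)])).
  apply: le_measure; rewrite ?inE //.
    by apply: (@measurable_box (fun=> `[- M, M]%classic)) => i; exact: measurable_itv.
  move=> x Ux i; rewrite /= in_itv /= -ler_norml.
  apply: le_trans (hM _ Ux); rewrite [leRHS]mx_normrE.
  exact: (le_bigmax _ (fun j : 'I_1 * 'I_N => `|x j.1 j.2|) (ord0, i)).
rewrite (@lebesgue_rV_box _ _ (fun=> `[- M, M]%classic)) => [|i]; last exact: measurable_itv.
under eq_bigr do rewrite lebesgue_measure_itv /=.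
suff /andP[] : (0 <= \prod_(i < N) (if (- M < M)%R then M%:E - (- M)%:E else 0) < +oo)%E.
  by [].
apply: (@big_ind _ (fun x => (0 <= x < +oo)%E)) => //.
- by rewrite lee01 ltry.
- move=> x y /andP[x0 xy] /andP[y0 yy]; rewrite mule_ge0 //=.
  by rewrite lte_mul_pinfty // ge0_fin_numE.
- move=> i _; case: ifPn => h; last by rewrite lexx ltry.
  by rewrite -EFinB lee_fin ltry andbT subr_ge0 ltW.
Qed.

End borel_rV.

(** * Integrals of partial derivatives vanish *)

Section slices.
Context {R : realType}.

Lemma measurable_cons_rV m : measurable_fun [set: R * 'rV[R]_m] (@cons_rV R m).
Proof.
apply: measurable_rVP => i; have [j ->|->] := unliftP ord0 i.
  rewrite [X in measurable_fun _ X](_ : _ = (fun x : 'rV[R]_m => x ord0 j) \o snd).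
    by apply: measurableT_comp => //; exact: measurable_coord_rV.
  by apply/funext => p; rewrite mxE liftK.
rewrite [X in measurable_fun _ X](_ : _ = fst)//.
by apply/funext => p; rewrite mxE unlift_none.
Qed.

Lemma cons_rV0 m (p : R * 'rV[R]_m) : cons_rV p ord0 ord0 = p.1.
Proof. by rewrite mxE unlift_none. Qed.

Lemma cons_rVS m (p : R * 'rV[R]_m) j : cons_rV p ord0 (lift ord0 j) = p.2 ord0 j.
Proof. by rewrite mxE liftK. Qed.

Lemma cons_rV_head m (s t : R) (y : 'rV[R]_m) :
  cons_rV (s + t, y) = s *: delta_mx ord0 ord0 + cons_rV (t, y).
Proof.
apply/rowP => i; have [j ->|->] := unliftP ord0 i.
  by rewrite !mxE liftK /= mulr0 add0r.
by rewrite !mxE unlift_none /= mulr1.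
Qed.

Lemma cons_rV_tail m (s t : R) (y : 'rV[R]_m) j :
  cons_rV (t, s *: delta_mx ord0 j + y) =
  s *: delta_mx ord0 (lift ord0 j) + cons_rV (t, y).
Proof.
apply/rowP => i; have [k ->|->] := unliftP ord0 i.
  by rewrite !mxE liftK /= !mxE eqxx (inj_eq lift_inj).
by rewrite !mxE unlift_none /= mulr0 add0r.
Qed.

Lemma continuous_cons_rVl m (y : 'rV[R]_m) : continuous (fun t : R => cons_rV (t, y)).
Proof.
move=> t; apply/cvg_ballP => e e0; apply: filterS (nbhsx_ballx t e e0) => s ts.
split=> // i j; rewrite ord1 {i}.
have [k ->|->] := unliftP ord0 j; rewrite ?cons_rVS ?cons_rV0 //=.
exact: ballxx.
Qed.

Lemma continuous_cons_rVr m (t : R) : continuous (fun y : 'rV[R]_m => cons_rV (t, y)).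
Proof.
move=> y A /nbhs_ballP[e /= e0 eA]; apply/nbhs_ballP; exists e => //= z [_ yz].
apply: eA; split=> // i j; rewrite ord1 {i}.
have [k ->|->] := unliftP ord0 j; rewrite ?cons_rVS ?cons_rV0 //=.
exact: ballxx.
Qed.

Lemma slice_headP m (g : 'rV[R]_m.+1 -> R) (t : R) (y : 'rV[R]_m) :
  derivable g (cons_rV (t, y)) (delta_mx ord0 ord0) ->
  is_derive t 1 (fun s : R => g (cons_rV (s, y))) (partial ord0 g (cons_rV (t, y))).
Proof.
rewrite /partial /derive /derivable => dg.
have E : (fun h : R => h^-1 *: ((fun s : R => g (cons_rV (s, y))) (h *: 1 + t)
     - g (cons_rV (t, y)))) =
   (fun h : R => h^-1 *: (g (h *: delta_mx ord0 ord0 + cons_rV (t, y))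
     - g (cons_rV (t, y)))).
  by apply/funext => h; rewrite cons_rV_head [h *: 1]mulr1.
by split; rewrite /derive /derivable /= E.
Qed.

Lemma slice_tailP m (g : 'rV[R]_m.+1 -> R) (t : R) (y : 'rV[R]_m) j :
  derivable g (cons_rV (t, y)) (delta_mx ord0 (lift ord0 j)) ->
  is_derive y (delta_mx ord0 j) (fun z : 'rV[R]_m => g (cons_rV (t, z)))
    (partial (lift ord0 j) g (cons_rV (t, y))).
Proof.
rewrite /partial /derive /derivable => dg.
have E : (fun h : R => h^-1 *: ((fun z => g (cons_rV (t, z))) (h *: delta_mx ord0 j + y)
     - g (cons_rV (t, y)))) =
   (fun h : R => h^-1 *: (g (h *: delta_mx ord0 (lift ord0 j) + cons_rV (t, y))
     - g (cons_rV (t, y)))).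
  by apply/funext => h; rewrite cons_rV_tail.
by split; rewrite /derive /derivable /= E.
Qed.

End slices.

Section divergence.
Context {R : realType}.

Lemma integral_derive_eq0 (G G' : R -> R) (M : R) :
  (forall t : R, is_derive t 1 G (G' t)) -> continuous G' ->
  (forall t, M < `|t| -> G t = 0) -> (\int[lebesgue_measure]_t (G' t)%:E = 0)%E.
Proof.
move=> dG cG' G0; pose K : R := `|M| + 1.
have K0 : 0 < K by rewrite ltr_wpDl.
have MK : M < K by rewrite (le_lt_trans (ler_norm M)) // ltrDl.
have G'0 t : M < `|t| -> G' t = 0.
  move=> Mt; have [_ <-] := dG t; rewrite -(derive_cst (0 : R) t 1).
  apply: near_eq_derive; near=> s; apply: G0; near: s.
  have : {for t, continuous (fun s : R => `|s|)} by exact: norm_continuous.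
  by move/cvgr_gt; apply.
have -> : (\int[lebesgue_measure]_t (G' t)%:E =
    \int[lebesgue_measure]_(t in `[(- K)%R, K]) (G' t)%:E)%E.
  rewrite [RHS]integral_mkcond; apply: eq_integral => t _.
  rewrite patchE; case: ifPn => //; rewrite notin_setE /= in_itv /= -ler_norml.
  by move/negP; rewrite -ltNge => Kt; rewrite G'0 // (lt_trans MK).
rewrite (@continuous_FTC2 _ G' G).
- by rewrite !G0 ?normrN ?(gtr0_norm K0) // subee.
- by rewrite -subr_gt0 opprK addr_gt0.
- by apply: continuous_subspaceT.
- have cG t : {for t, continuous G}.
    apply: differentiable_continuous; apply/derivable1_diffP.
    by case: (dG t).
  split; first by move=> t _; case: (dG t).
    by apply: cvg_at_right_filter; exact: cG.
  by apply: cvg_at_left_filter; exact: cG.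
- by move=> t _; rewrite derive1E; case: (dG t).
Unshelve. all: by end_near. Qed.

Definition box_null n (M : R) (g : 'rV[R]_n -> R) :=
  forall x : 'rV[R]_n, (exists j, M < `|x ord0 j|) -> g x = 0.

Lemma box_null_partial n M i (g : 'rV[R]_n -> R) : box_null M g ->
  box_null M (partial i g).
Proof.
move=> g0 x [j Mj].
apply: (@partial_eq0 _ _ ((fun y : 'rV[R]_n => `|y ord0 j|) @^-1` [set t | M < t])) => //.
  apply: open_comp; last exact: open_gt.
  move=> y _; apply: continuous_comp; first exact: coord_continuous.
  exact: norm_continuous.
by move=> y My; apply: g0; exists j.
Qed.

Lemma box_null_integrable n M (g : 'rV[R]_n -> R) : continuous g -> box_null M g ->
  (lebesgue_rV (n := n)).-integrable setT (EFin \o g).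
Proof.
move=> cg g0.
pose A : set 'rV[R]_n := [set x | forall i, `[- M, M]%classic (x ord0 i)].
have mA : measurable A.
  by apply: (@measurable_box _ _ (fun=> `[- M, M]%classic)) => i; exact: measurable_itv.
have cA : compact A.
  by apply: (@rV_compact _ _ (fun=> `[- M, M]%classic)) => i; exact: segment_compact.
have -> : EFin \o g = (EFin \o g) \_ A.
  apply/funext => x; rewrite patchE; case: ifPn => //; rewrite notin_setE.
  move=> /existsNP[i]; rewrite /= in_itv /= -ler_norml => /negP; rewrite -ltNge => h.
  by rewrite g0 //; exists i.
apply/(integrable_mkcond _ mA). apply: measurable_bounded_integrable => //.
- by apply: bounded_rV_lty => //; exact: compact_bounded.
- apply: measurable_funTS; apply: continuous_rV_measurable; first exact: openT.
  by move=> x _; exact: cg.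
- have /compact_bounded[B [Br hB]] : compact (g @` A).
    by apply: continuous_compact => //; exact: continuous_subspaceT.
  by exists B; split=> // B' /hB h x Ax; apply: h; exists x.
Qed.

(** Fubini on the first coordinate against the others. If [i] is the first
    coordinate, its slices are integrated first and vanish by the fundamental
    theorem of calculus; otherwise the slices in the remaining coordinates vanish
    by induction on the dimension. *)
Lemma integral_partial_eq0 n M i (g : 'rV[R]_n -> R) :
  (forall x : 'rV[R]_n, derivable g x (delta_mx ord0 i)) -> continuous (partial i g) ->
  box_null M g -> (\int[lebesgue_rV (n := n)]_x (partial i g x)%:E = 0)%E.
Proof.
elim: n i g => [[]//|n IH] i g dg cg g0.
have gi := box_null_integrable cg (box_null_partial i g0).
pose P := (@lebesgue_measure R \x @lebesgue_rV R n)%E.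
have mh : measurable_fun setT (partial i g).
  by apply: continuous_rV_measurable; [exact: openT|move=> x _; exact: cg].
have mcons := @measurable_cons_rV R n.
have ih : P.-integrable setT ((EFin \o partial i g) \o @cons_rV R n).
  apply/integrableP; split.
    by apply: measurableT_comp => //; exact/measurable_EFinP.
  have /integrableP[_] := gi; apply: le_lt_trans.
  rewrite [leRHS](_ : _ = \int[pushforward P (@cons_rV R n)]_x `|(EFin \o partial i g) x|)%E //.
  rewrite ge0_integral_pushforward //.
  by apply: measurableT_comp => //; exact/measurable_EFinP.
rewrite [LHS](_ : _ = \int[pushforward P (@cons_rV R n)]_x (EFin \o partial i g) x)%E //.
rewrite integral_pushforward //; last exact/measurable_EFinP.
rewrite preimage_setT.
have [j ij|i0] := unliftP ord0 i.
  have dS t y : is_derive y (delta_mx ord0 j : 'rV[R]_n)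
      (fun z : 'rV[R]_n => g (cons_rV (t, z))) (partial i g (cons_rV (t, y))).
    by rewrite ij; apply: slice_tailP; rewrite -ij.
  have pS t y : partial j (fun z : 'rV[R]_n => g (cons_rV (t, z))) y =
      partial i g (cons_rV (t, y)).
    by have [_] := dS t y.
  rewrite -integral12_prod_meas1 //.
  rewrite (eq_integral (cst 0%E)) ?integral0 // => t _.
  rewrite -[RHS](IH j (fun y => g (cons_rV (t, y)))).
  - by apply: eq_integral => y _ /=; rewrite pS.
  - by move=> y; have [] := dS t y.
  - rewrite (_ : partial j _ = fun y => partial i g (cons_rV (t, y))).
      move=> y; apply: continuous_comp; [exact: continuous_cons_rVr|exact: cg].
    by apply/funext => y; rewrite pS.
  - by move=> y [k Mk]; apply: g0; exists (lift ord0 k); rewrite cons_rVS.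
rewrite -integral21_prod_meas1 //.
rewrite (eq_integral (cst 0%E)) ?integral0 // => y _.
apply: (@integral_derive_eq0 (fun t => g (cons_rV (t, y)))
   (fun t => partial i g (cons_rV (t, y))) M).
- by move=> t; rewrite i0; apply: slice_headP; rewrite -i0.
- by move=> t; apply: continuous_comp; [exact: continuous_cons_rVl|exact: cg].
- by move=> t Mt; apply: g0; exists ord0; rewrite cons_rV0.
Qed.

End divergence.

(** * Change of measure by a density *)

Section density.
Context d (T : measurableType d) (R : realType).
Context (m1 m2 : {measure set T -> \bar R}) (E : set T) (f : T -> R).
Context (mE : measurable E) (mf : measurable_fun E f)
  (f0 : forall x, E x -> 0 <= f x)
  (m12 : forall A, measurable A -> A `<=` E -> m1 A = (\int[m2]_(x in A) (f x)%:E)%E).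
Import HBNNSimple.
Local Open Scope ereal_scope.

(** Monotone convergence along simple functions reduces the claim to
    indicators, where it is the hypothesis on sets. *)
Lemma ge0_integral_density (h : T -> \bar R) : (forall x, E x -> 0 <= h x) ->
  measurable_fun E h -> \int[m1]_(x in E) h x = \int[m2]_(x in E) (h x * (f x)%:E).
Proof.
move=> h0 mh; pose s := nnsfun_approx mE mh.
have mEf : measurable_fun E (EFin \o f) by exact/measurable_EFinP.
have cs x : E x -> (EFin \o s n) x @[n --> \oo] --> h x.
  by move=> Ex; apply: cvg_nnsfun_approx.
have -> : \int[m1]_(x in E) h x =
    lim (\int[m1]_(x in E) (EFin \o s n) x @[n --> \oo]).
  have hE x : E x -> h x = lim ((EFin \o s n) x @[n --> \oo]).
    by move=> Ex; apply/esym/cvg_lim => //; exact: cs.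
  under eq_integral => x /[!inE] /hE -> //.
  apply: monotone_convergence => //.
  - by move=> n; apply/measurable_EFinP/measurable_funTS.
  - by move=> n x Ex /=; rewrite lee_fin.
  - by move=> x Ex a b ab; rewrite lee_fin; exact/lefP/nd_nnsfun_approx.
have -> : \int[m2]_(x in E) (h x * (f x)%:E) =
    lim (\int[m2]_(x in E) ((EFin \o s n) x * (f x)%:E) @[n --> \oo]).
  have hE x : E x -> h x * (f x)%:E = lim ((EFin \o s n) x * (f x)%:E @[n --> \oo]).
    by move=> Ex; apply/esym/cvg_lim => //; apply: cvgeZr => //; exact: cs.
  under eq_integral => x /[!inE] /hE -> //.
  apply: monotone_convergence => //.
  - move=> n; apply: emeasurable_funM => //.
    exact/measurable_EFinP/measurable_funTS.
  - by move=> n x Ex; rewrite mule_ge0 // lee_fin // f0.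
  - move=> x Ex a b ab; rewrite lee_wpmul2r ?lee_fin ?f0 //.
    exact/lefP/nd_nnsfun_approx.
suff suf n : \int[m2]_(x in E) ((EFin \o s n) x * (f x)%:E) =
    \int[m1]_(x in E) (EFin \o s n) x.
  by under [in RHS]eq_fun do rewrite suf.
have indich r : measurable_fun E (fun x => (r * \1_(s n @^-1` [set r]) x)%:E).
  by apply: (measurable_comp measurableT) => //; exact: measurable_funM.
transitivity (\int[m1]_(x in E)
   (\sum_(y \in range (s n)) (y * \1_(s n @^-1` [set y]) x)%:E)); last first.
  by apply: eq_integral => t tE; rewrite /= fimfunE -fsumEFin.
rewrite ge0_integral_fsum//; last by move=> m y Ey; exact: nnfun_muleindic_ge0.
transitivity (\int[m2]_(x in E) (\sum_(y \in range (s n))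
    (y * \1_(s n @^-1` [set y]) x)%:E * (f x)%:E)).
  apply: eq_integral => x xE.
  rewrite -ge0_mule_fsuml => [|y]; last exact: nnfun_muleindic_ge0.
  by rewrite fsumEFin // -(fimfunE _ x).
rewrite ge0_integral_fsum//; last 2 first.
  - by move=> y; apply: emeasurable_funM.
  - move=> m y Ey; rewrite mule_ge0 //; first exact: nnfun_muleindic_ge0.
    by rewrite lee_fin f0.
apply: eq_fsbigr => r rhn.
have r0 : (0 <= r)%R by move: rhn; rewrite inE => -[t _ <-].
under [RHS]eq_integral do rewrite EFinM.
rewrite integralZl_indic_nnsfun //.
under eq_integral do rewrite EFinM -muleA.
rewrite ge0_integralZl//.
- under eq_integral do rewrite muleC.
  rewrite (eq_integral ((EFin \o f) \_ (s n @^-1` [set r]))); last first.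
    by move=> x xE; rewrite epatch_indic.
  rewrite -integral_mkcondr integral_indic// [in RHS]setIC -m12 //.
- by apply: emeasurable_funM => //; exact/measurable_EFinP.
- by move=> t Et; rewrite mule_ge0 ?lee_fin // f0.
Qed.

Lemma integral_density (h : T -> \bar R) : measurable_fun E h ->
  \int[m1]_(x in E) h x = \int[m2]_(x in E) (h x * (f x)%:E).
Proof.
move=> mh; rewrite integralE [RHS]integralE.
rewrite !ge0_integral_density //; last 2 first.
  exact: measurable_funeneg.
  exact: measurable_funepos.
congr (_ - _); apply: eq_integral => x; rewrite inE => /f0 fx0.
  by rewrite !funeposE maxe_pMl ?lee_fin // mul0e.
by rewrite !funenegE -mulNe maxe_pMl ?lee_fin // mul0e.
Qed.

End density.

(** * Integrable and square integrable functions on a domain *)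

Section L2.
Context {R : realType} {N : nat} (U : set 'rV[R]_N).
Context (mU : measurable U).
Implicit Types g h : 'rV[R]_N -> R.

Local Notation leb := (lebesgue_rV (n := N)).
Definition integrable_on g := leb.-integrable U (EFin \o g).
Definition intg g : R := \int[leb]_(x in U) g x.

Lemma intgE g : integrable_on g -> (\int[leb]_(x in U) (g x)%:E = (intg g)%:E)%E.
Proof. by move=> ig; rewrite /intg /Rintegral fineK //; exact: integrable_fin_num. Qed.

Lemma integrable_on_eq g h : (forall x, U x -> g x = h x) ->
  integrable_on g -> integrable_on h.
Proof.
by move=> gh; apply: eq_integrable => // x; rewrite inE => /gh /= ->.
Qed.

Lemma intg_eq g h : (forall x, U x -> g x = h x) -> intg g = intg h.
Proof. by move=> gh; apply: eq_Rintegral => x; rewrite inE; exact: gh. Qed.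

Lemma integrable_onD g h : integrable_on g -> integrable_on h ->
  integrable_on (fun x => g x + h x).
Proof. by move=> ig ih; apply: (integrableD mU ig ih). Qed.

Lemma integrable_onZ (c : R) g : integrable_on g -> integrable_on (fun x => c * g x).
Proof. by move=> ig; apply: (integrableZl mU c ig). Qed.

Lemma integrable_onB g h : integrable_on g -> integrable_on h ->
  integrable_on (fun x => g x - h x).
Proof. by move=> ig ih; apply: (integrableB mU ig ih). Qed.

Lemma intgD g h : integrable_on g -> integrable_on h ->
  intg (fun x => g x + h x) = intg g + intg h.
Proof. exact: RintegralD. Qed.

Lemma intgB g h : integrable_on g -> integrable_on h ->
  intg (fun x => g x - h x) = intg g - intg h.
Proof. exact: RintegralB. Qed.

Lemma intgZ (c : R) g : integrable_on g -> intg (fun x => c * g x) = c * intg g.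
Proof. by move=> ig; exact: RintegralZl. Qed.

Lemma integrable_on_sum (I : Type) (s : seq I) (F : I -> 'rV[R]_N -> R) :
  (forall i, integrable_on (F i)) -> integrable_on (fun x => \sum_(i <- s) F i x).
Proof.
move=> iF; elim: s => [|i s IH].
  apply: (@integrable_on_eq (fun=> 0)); last exact: integrable0.
  by move=> x _; rewrite big_nil.
apply: (@integrable_on_eq (fun x => F i x + \sum_(j <- s) F j x)).
  by move=> x _; rewrite big_cons.
exact: integrable_onD.
Qed.

Lemma intg_sum (I : Type) (s : seq I) (F : I -> 'rV[R]_N -> R) :
  (forall i, integrable_on (F i)) ->
  intg (fun x => \sum_(i <- s) F i x) = \sum_(i <- s) intg (F i).
Proof.
move=> iF; elim: s => [|i s IH].
  rewrite big_nil (@intg_eq _ (fun=> 0)); last by move=> x _; rewrite big_nil.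
  by rewrite /intg Rintegral_cst // mul0r.
rewrite big_cons -IH -intgD //; last exact: integrable_on_sum.
by apply: intg_eq => x _; rewrite big_cons.
Qed.

Lemma intg_le g h : integrable_on g -> integrable_on h ->
  (forall x, U x -> g x <= h x) -> intg g <= intg h.
Proof. exact: le_Rintegral. Qed.

Lemma intg_ge0 g : (forall x, U x -> 0 <= g x) -> 0 <= intg g.
Proof. exact: Rintegral_ge0. Qed.

Lemma integrable_on_le g h : measurable_fun U g -> integrable_on h ->
  (forall x, U x -> `|g x| <= h x) -> integrable_on g.
Proof.
move=> mg ih gh; apply: (le_integrable mU _ _ ih); first exact/measurable_EFinP.
by move=> x Ux /=; rewrite lee_fin (le_trans (gh _ Ux)) // ler_norm.
Qed.

Lemma integrable_on_measurable g : integrable_on g -> measurable_fun U g.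
Proof. by move=> /integrableP[/measurable_EFinP]. Qed.

Local Notation sqint := (square_integrable U leb).

Lemma sqint_integrable g : sqint g -> integrable_on (fun x => g x ^+ 2).
Proof.
move=> [mg gf]; apply/integrableP; split.
  by apply/measurable_EFinP; exact: measurable_funX.
apply: le_lt_trans gf; rewrite le_eqVlt; apply/orP; left; apply/eqP.
by apply: eq_integral => x _ /=; rewrite ger0_norm ?sqr_ge0.
Qed.

Lemma integrable_sqint g : measurable_fun U g ->
  integrable_on (fun x => g x ^+ 2) -> sqint g.
Proof. by move=> mg ig; split => //; rewrite intgE // ltry. Qed.

Lemma sqintM_integrable g h : sqint g -> sqint h -> integrable_on (fun x => g x * h x).
Proof.
move=> sg sh; have ig := sqint_integrable sg; have ih := sqint_integrable sh.
apply: (integrable_on_le _ (integrable_onD ig ih)).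
  by apply: measurable_funM; [case: sg|case: sh].
move=> x _; rewrite normrM -(real_normK (num_real (g x))) -(real_normK (num_real (h x))).
by have := sqr_ge0 (`|g x| - `|h x|); nra.
Qed.

Lemma sqintD g h : sqint g -> sqint h -> sqint (fun x => g x + h x).
Proof.
move=> sg sh; apply: integrable_sqint.
  by apply: measurable_funD; [case: sg|case: sh].
apply: (@integrable_on_eq (fun x => g x ^+ 2 + (2 * (g x * h x) + h x ^+ 2))).
  by move=> x _; ring.
apply: integrable_onD; first exact: sqint_integrable.
apply: integrable_onD; last exact: sqint_integrable.
by apply: integrable_onZ; exact: sqintM_integrable.
Qed.

Lemma sqintZ (c : R) g : sqint g -> sqint (fun x => c * g x).
Proof.
move=> sg; apply: integrable_sqint.
  by apply: measurable_funM => //; case: sg.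
apply: (@integrable_on_eq (fun x => c ^+ 2 * g x ^+ 2)).
  by move=> x _; ring.
by apply: integrable_onZ; exact: sqint_integrable.
Qed.

Lemma sqintB g h : sqint g -> sqint h -> sqint (fun x => g x - h x).
Proof.
move=> sg sh; have := sqintD sg (sqintZ (-1) sh).
by congr square_integrable; apply/funext => x; rewrite mulN1r.
Qed.

End L2.

(** * Bounded measurable functions *)

Section bounded_functions.
Context {R : realType} {N : nat} (U : set 'rV[R]_N) (oU : open U) (bU : bounded_set U).
Implicit Types g h : 'rV[R]_N -> R.
Local Notation leb := (lebesgue_rV (n := N)).

Definition bounded_mfun g := measurable_fun U g /\ exists M, forall x, U x -> `|g x| <= M.

Let mU : measurable U := open_rV_measurable oU.

Lemma bounded_mfunD g h : bounded_mfun g -> bounded_mfun h -> bounded_mfun (fun x => g x + h x).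
Proof.
move=> [mg [M gM]] [mh [K hK]]; split; first exact: measurable_funD.
exists (M + K) => x Ux; apply: le_trans (ler_normD _ _) _.
by rewrite lerD ?gM ?hK.
Qed.

Lemma bounded_mfunM g h : bounded_mfun g -> bounded_mfun h -> bounded_mfun (fun x => g x * h x).
Proof.
move=> [mg [M gM]] [mh [K hK]]; split; first exact: measurable_funM.
by exists (M * K) => x Ux; rewrite normrM ler_pM ?gM ?hK.
Qed.

Lemma bounded_mfun_cst (c : R) : bounded_mfun (fun=> c).
Proof. by split=> //; exists `|c|. Qed.

Lemma bounded_mfunB g h : bounded_mfun g -> bounded_mfun h -> bounded_mfun (fun x => g x - h x).
Proof.
move=> bg bh; have := bounded_mfunD bg (bounded_mfunM (bounded_mfun_cst (-1)) bh).
by congr bounded_mfun; apply/funext => x; rewrite mulN1r.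
Qed.

Lemma bounded_mfun_norm g : bounded_mfun g -> bounded_mfun (fun x => `|g x|).
Proof.
move=> [mg [M gM]]; split; first exact: measurableT_comp.
by exists M => x Ux; rewrite normr_id gM.
Qed.

Lemma test_bounded_mfun g : test_function U g -> bounded_mfun g.
Proof.
move=> tg; split; last by have [M gM] := test_bounded tg; exists M.
apply: continuous_rV_measurable => // x _; exact: test_continuous tg x.
Qed.

Lemma bounded_mfun_integrable g : bounded_mfun g -> integrable_on U g.
Proof.
move=> [mg [M gM]]; apply: measurable_bounded_integrable => //.
  exact: bounded_rV_lty.
exists M; split; first exact: num_real.
by move=> B MB x Ux; exact: (le_trans (gM _ Ux) (ltW MB)).
Qed.

Lemma bounded_mfun_sqint g : bounded_mfun g -> square_integrable U leb g.
Proof.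
move=> bg; apply: (integrable_sqint mU); first by case: bg.
by apply: bounded_mfun_integrable; exact: bounded_mfunM.
Qed.

(** One continuous derivative suffices, so that the arctangent of a test
    function may occur in [g]; [p] supplies the compact support. *)
Lemma intg_partial_eq0 p g i : test_function U p ->
  (forall x, ~ supp p x -> g x = 0) -> (forall x, pderivable g x) ->
  continuous (partial i g) -> intg U (partial i g) = 0.
Proof.
move=> [_ cp pU] g0 dg cg.
have /compact_bounded[M0 [_ hM0]] := cp.
have hM x : supp p x -> `|x| <= M0 + 1 by apply: hM0; rewrite ltrDl.
have bg : box_null (M0 + 1) g.
  move=> x [j Mj]; apply: g0 => /hM; apply/negP; rewrite -ltNge (lt_le_trans Mj) //.
  rewrite [leRHS]mx_normrE.
  exact: (le_bigmax _ (fun k : 'I_1 * 'I_N => `|x k.1 k.2|) (ord0, j)).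
rewrite /intg /Rintegral.
suff -> : (\int[leb]_(x in U) (partial i g x)%:E = 0)%E by [].
rewrite -[RHS](integral_partial_eq0 (fun x => dg x i) cg bg) integral_mkcond.
apply: eq_integral => x _; rewrite patchE; case: ifPn => //; rewrite notin_setE => nUx.
rewrite (@partial_eq0 _ _ (~` supp p)) //; first exact: open_suppC.
by move=> /pU.
Qed.

Lemma intg_partial_test g i : test_function U g -> intg U (partial i g) = 0.
Proof.
move=> tg; apply: (@intg_partial_eq0 g) => //.
- by move=> x; exact: notin_supp.
- by move=> x; exact: test_pderivable tg.
- by apply: test_continuous; exact: test_partial tg.
Qed.

End bounded_functions.

(** * The dot product and gradients *)

Section dot.
Context {R : realType} {N : nat}.
Implicit Types (a b c : 'rV[R]_N).

Lemma dotrVC a b : dotrV a b = dotrV b a.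
Proof. by apply: eq_bigr => i _; rewrite mulrC. Qed.

Lemma dotrVDl a b c : dotrV (a + b) c = dotrV a c + dotrV b c.
Proof. by rewrite -big_split; apply: eq_bigr => i _; rewrite mxE mulrDl. Qed.

Lemma dotrVZl (k : R) a b : dotrV (k *: a) b = k * dotrV a b.
Proof. by rewrite mulr_sumr; apply: eq_bigr => i _; rewrite mxE mulrA. Qed.

Lemma dotrVDr a b c : dotrV a (b + c) = dotrV a b + dotrV a c.
Proof. by rewrite dotrVC dotrVDl !(dotrVC a). Qed.

Lemma dotrVZr (k : R) a b : dotrV a (k *: b) = k * dotrV a b.
Proof. by rewrite dotrVC dotrVZl dotrVC. Qed.

Lemma dotrVNl a b : dotrV (- a) b = - dotrV a b.
Proof. by rewrite -scaleN1r dotrVZl mulN1r. Qed.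

Lemma dotrVNr a b : dotrV a (- b) = - dotrV a b.
Proof. by rewrite dotrVC dotrVNl dotrVC. Qed.

Definition dotrVE := (dotrVDl, dotrVDr, dotrVNl, dotrVNr, dotrVZl, dotrVZr).

Lemma dotrV_ge0 a : 0 <= dotrV a a.
Proof. by apply: sumr_ge0 => i _; rewrite -expr2 sqr_ge0. Qed.

Lemma dotrV_young (k : R) a b : 0 < k ->
  dotrV a b <= (2 * k)^-1 * dotrV a a + k / 2 * dotrV b b.
Proof.
move=> k0; have := dotrV_ge0 (a - k *: b); rewrite !dotrVE (dotrVC b a) => h.
rewrite -(ler_pM2l (_ : 0 < 2 * k)) ?mulr_gt0 //.
rewrite mulrDr !mulrA divff ?mul1r; last by rewrite gt_eqF // mulr_gt0.
by move: h; set x := dotrV a a; set y := dotrV a b; set z := dotrV b b; lra.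
Qed.

Lemma dotrV_sqD a b : dotrV (a + b) (a + b) <= 2 * dotrV a a + 2 * dotrV b b.
Proof.
have := dotrV_ge0 (a - b); rewrite !dotrVE (dotrVC b a).
by set x := dotrV a a; set y := dotrV a b; set z := dotrV b b; lra.
Qed.

Lemma dotrV_sqB a b : dotrV (a - b) (a - b) <= 2 * dotrV a a + 2 * dotrV b b.
Proof.
have := dotrV_ge0 (a + b); rewrite !dotrVE (dotrVC b a).
by set x := dotrV a a; set y := dotrV a b; set z := dotrV b b; lra.
Qed.

End dot.

Section grad_rules.
Context {R : realType} {N : nat}.
Implicit Types (g h : 'rV[R]_N -> R) (x : 'rV[R]_N).

Lemma gradD g h x : pderivable g x -> pderivable h x ->
  grad (fun y => g y + h y) x = grad g x + grad h x.
Proof. by move=> dg dh; apply/rowP => i; rewrite !mxE partialD. Qed.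

Lemma gradM g h x : pderivable g x -> pderivable h x ->
  grad (fun y => g y * h y) x = g x *: grad h x + h x *: grad g x.
Proof. by move=> dg dh; apply/rowP => i; rewrite !mxE partialM. Qed.

Lemma gradB g h x : pderivable g x -> pderivable h x ->
  grad (fun y => g y - h y) x = grad g x - grad h x.
Proof. by move=> dg dh; apply/rowP => i; rewrite !mxE /partial -deriveB. Qed.

Lemma gradV g x : g x != 0 -> pderivable g x ->
  grad (fun y => (g y)^-1) x = (- (g x) ^- 2) *: grad g x.
Proof.
by move=> g0 dg; apply/rowP => i; rewrite !mxE /partial deriveV.
Qed.

Lemma pderivableV g x : g x != 0 -> pderivable g x -> pderivable (fun y => (g y)^-1) x.
Proof. by move=> g0 dg i; exact: derivableV. Qed.

Lemma test_dot_grad (U : set 'rV[R]_N) g h : open U -> test_function U g ->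
  smooth_on U h -> test_function U (fun x => dotrV (grad g x) (grad h x)).
Proof.
move=> oU tg sh.
have -> : (fun x => dotrV (grad g x) (grad h x)) =
    fun x => \sum_(i < N) partial i g x * partial i h x.
  by apply/funext => x; apply: eq_bigr => i _; rewrite !mxE.
apply: (test_sum _ oU) => i.
exact: (testM oU (test_partial i oU tg) (smooth_on_partial i sh)).
Qed.

End grad_rules.

Lemma pderivableB {R : realType} {N : nat} (g h : 'rV[R]_N -> R) x :
  pderivable g x -> pderivable h x -> pderivable (fun y => g y - h y) x.
Proof.
move=> dg dh.
have -> : (fun y => g y - h y) = (fun y => g y + (-1) * h y).
  by apply/funext => y; rewrite mulN1r.
apply: (@pderivableD _ _ g (fun y => (-1) * h y)); first exact: dg.
exact: (@pderivableM _ _ (fun=> -1) h x (pderivable_cst (-1) x) dh).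
Qed.

Arguments pderivableB {R N g h x} _ _ _.

(** * Pointwise estimates on the cutoff *)

Section cutoff.
Context {R : realType} {N : nat}.
Implicit Types (a b p : 'rV[R]_N -> R) (x : 'rV[R]_N).

Definition gap a b (e : R) x : R := (a x - b x) * (a x - b x) + e * e.
Definition cut_den a b (e : R) x : R := a x * a x + gap a b e x.

(** The cutoff a^2 / (a^2 + (a - b)^2 + e^2). It is a test function supported
    where [a] is, and it is close to 1 where |a - b| and [e] are small compared
    with |a|. Writing a * (a * _) makes it visibly a test function times a smooth
    one. *)
Definition cut a b (e : R) x : R := a x * (a x * (cut_den a b e x)^-1).

Section pointwise.
Context (a b : 'rV[R]_N -> R) (e : R) (e0 : 0 < e).
Local Notation s := (gap a b e).
Local Notation D := (cut_den a b e).
Local Notation c := (cut a b e).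

Lemma gap_gt0 x : 0 < s x.
Proof. by rewrite /gap ltr_wpDl ?mulr_gt0 // -expr2 sqr_ge0. Qed.

Lemma cut_den_gt0 x : 0 < D x.
Proof. by rewrite /cut_den ltr_wpDl ?gap_gt0 // -expr2 sqr_ge0. Qed.

(** All the bounds on the cutoff and its gradient are products of these
    ratios. The constant 2 comes from b^2 <= 2 a^2 + 2 (a - b)^2. *)
Lemma cut_den_ratios x : let i := (D x)^-1 in
  [/\ 0 <= a x ^+ 2 * i <= 1, 0 <= b x ^+ 2 * i <= 2,
      0 <= (a x - b x) ^+ 2 * i <= 1, 0 <= s x * i <= 1 &
      1 - c x = s x * i].
Proof.
have D0 := cut_den_gt0 x; have s0 := gap_gt0 x.
have i0 : 0 <= (D x)^-1 by rewrite invr_ge0 ltW.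
have ab2 := sqr_ge0 (a x - b x); have a2 := sqr_ge0 (a x); have e2 := sqr_ge0 e.
have ab2' := sqr_ge0 (a x - (b x - a x)).
have E : D x = a x ^+ 2 + (a x - b x) ^+ 2 + e ^+ 2 by rewrite /cut_den /gap; ring.
have Es : s x = (a x - b x) ^+ 2 + e ^+ 2 by rewrite /gap; ring.
have s0' := ltW s0.
split.
- by rewrite mulr_ge0 //= ler_pdivrMr // mul1r E; nra.
- by rewrite mulr_ge0 ?sqr_ge0 //= ler_pdivrMr // E; nra.
- by rewrite mulr_ge0 //= ler_pdivrMr // mul1r E; nra.
- by rewrite mulr_ge0 //= ler_pdivrMr // mul1r E Es; nra.
have -> : s x = D x - a x * a x by rewrite /cut_den; ring.
by rewrite /cut; field; rewrite gt_eqF.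
Qed.

Lemma cut_ge0_le1 x : 0 <= c x <= 1.
Proof.
by have [_ _ _ /andP[h1 h2] h] := cut_den_ratios x; apply/andP; split; lra.
Qed.

Lemma cut_close x : (b x - c x * b x) ^+ 2 <= 2 * s x.
Proof.
have s0 := gap_gt0 x.
have [_ /andP[h1 h2] _ /andP[h3 h4] h] := cut_den_ratios x.
have -> : b x - c x * b x = b x * (1 - c x) by ring.
rewrite h.
have -> : (b x * (s x * (D x)^-1)) ^+ 2 =
  (b x ^+ 2 * (D x)^-1) * (s x * (D x)^-1) * s x by ring.
apply: ler_wpM2r; first exact: ltW.
by move: (b x ^+ 2 * _) (s x * _) h1 h2 h3 h4 => y z; nra.
Qed.

Lemma cut2_close x : (b x - c x * (c x * b x)) ^+ 2 <= 8 * s x.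
Proof.
have /andP[c0 c1] := cut_ge0_le1 x; have h := cut_close x.
have -> : (b x - c x * (c x * b x)) ^+ 2 = (b x - c x * b x) ^+ 2 * (1 + c x) ^+ 2 by ring.
have : (1 + c x) ^+ 2 <= 4 by nra.
have := sqr_ge0 (b x - c x * b x); have := sqr_ge0 (1 + c x).
move: ((1 + c x) ^+ 2) ((b x - c x * b x) ^+ 2) h => y z; nra.
Qed.

Context (da : forall x, pderivable a x) (db : forall x, pderivable b x).

Lemma pderivable_gap x : pderivable s x.
Proof.
have dd : pderivable (fun y => a y - b y) x by exact: pderivableB.
apply: (@pderivableD _ _ (fun y => (a y - b y) * (a y - b y)) (fun=> e * e)).
  exact: pderivableM.
exact: pderivable_cst.
Qed.

Lemma pderivable_cut_den x : pderivable D x.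
Proof.
apply: (@pderivableD _ _ (fun y => a y * a y) s); first exact: pderivableM.
exact: pderivable_gap.
Qed.

Lemma pderivable_cut x : pderivable c x.
Proof.
apply: (@pderivableM _ _ a (fun y => a y * (D y)^-1)); first exact: da.
apply: (@pderivableM _ _ a (fun y => (D y)^-1)); first exact: da.
apply: pderivableV; first by rewrite gt_eqF // cut_den_gt0.
exact: pderivable_cut_den.
Qed.

Lemma grad_cut_den x : grad D x = (2 * a x) *: grad a x +
  (2 * (a x - b x)) *: (grad a x - grad b x).
Proof.
have dd : pderivable (fun y => a y - b y) x by exact: pderivableB.
have da2 : pderivable (fun y => a y * a y) x := pderivableM (@da x) (@da x).
have dd2 : pderivable (fun y => (a y - b y) * (a y - b y)) x := pderivableM dd dd.
rewrite (gradD da2 (@pderivable_gap x)) (gradM (@da x) (@da x)).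
rewrite (gradD dd2 (pderivable_cst (e * e) x)) (gradM dd dd) (gradB (@da x) (@db x)).
have -> : grad (fun=> e * e) x = 0 by apply/rowP => i; rewrite !mxE partial_cst.
by apply/rowP => i; rewrite !mxE; ring.
Qed.

(** Up to sign, both coefficients are products of the ratios of
    [cut_den_ratios] and their square roots: multiplying by b is what makes
    them bounded independently of e. The first one has a factor s / D, which is
    small where the cutoff is close to 1. *)
Lemma grad_cut x : b x *: grad c x =
  (2 * a x * b x * s x * (D x)^-1 ^+ 2) *: grad a x -
  (2 * a x ^+ 2 * b x * (a x - b x) * (D x)^-1 ^+ 2) *: (grad a x - grad b x).
Proof.
have D0 : D x != 0 by rewrite gt_eqF // cut_den_gt0.
have dV : pderivable (fun y => (D y)^-1) x by apply: pderivableV => //; exact: pderivable_cut_den.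
rewrite (gradM (@da x) (pderivableM (@da x) dV)) (gradM (@da x) dV).
rewrite (gradV D0 (@pderivable_cut_den x)).
rewrite grad_cut_den; apply/rowP => i; rewrite !mxE.
have -> : s x = D x - a x * a x by rewrite /cut_den; ring.
by field.
Qed.

Lemma grad_cut_le x : b x ^+ 2 * dotrV (grad c x) (grad c x) <=
  16 * (s x * (D x)^-1 * dotrV (grad a x) (grad a x)) +
  16 * dotrV (grad a x - grad b x) (grad a x - grad b x).
Proof.
have -> : b x ^+ 2 * dotrV (grad c x) (grad c x) =
  dotrV (b x *: grad c x) (b x *: grad c x) by rewrite !dotrVE mulrA.
rewrite grad_cut; apply: le_trans (dotrV_sqB _ _) _; rewrite !(dotrVZl, dotrVZr).
have [/andP[a0 a1] /andP[b0 b1] /andP[d0 d1] /andP[s0 s1] _] := cut_den_ratios x.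
have X0 := dotrV_ge0 (grad a x); have Y0 := dotrV_ge0 (grad a x - grad b x).
move: (dotrV _ _) (dotrV (grad a x - _) _) X0 Y0 => X Y X0 Y0.
set i := (D x)^-1 in a0 a1 b0 b1 d0 d1 s0 s1 *.
set al := 2 * a x * b x * s x * i ^+ 2.
set be := 2 * a x ^+ 2 * b x * (a x - b x) * i ^+ 2.
have hal : al * al <= 8 * (s x * i).
  have -> : al * al =
    4 * ((a x ^+ 2 * i) * (b x ^+ 2 * i)) * (s x * i) ^+ 2 by rewrite /al; ring.
  have h1 : (a x ^+ 2 * i) * (b x ^+ 2 * i) <= 2.
    by move: (a x ^+ 2 * i) (b x ^+ 2 * i) a0 a1 b0 b1 => *; nra.
  have h3 : 0 <= (a x ^+ 2 * i) * (b x ^+ 2 * i) by exact: mulr_ge0.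
  have h2 : (s x * i) ^+ 2 <= s x * i by move: (s x * i) s0 s1 => *; nra.
  have h4 := sqr_ge0 (s x * i).
  move: (a x ^+ 2 * i * (b x ^+ 2 * i)) ((s x * i) ^+ 2) (s x * i) h1 h2 h3 h4 s0 s1.
  by move=> y z t *; nra.
have hbe : be * be <= 8.
  have -> : be * be =
    4 * ((a x ^+ 2 * i) ^+ 2 * ((b x ^+ 2 * i) * ((a x - b x) ^+ 2 * i))) by rewrite /be; ring.
  move: (a x ^+ 2 * i) (b x ^+ 2 * i) ((a x - b x) ^+ 2 * i) a0 a1 b0 b1 d0 d1.
  move=> y z t y0 y1 z0 z1 t0 t1.
  have h1 : y ^+ 2 <= 1 by nra.
  have h2 : z * t <= 2 by nra.
  have h3 : 0 <= z * t by exact: mulr_ge0.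
  have h4 := sqr_ge0 y.
  by move: (y ^+ 2) (z * t) h1 h2 h3 h4 => *; nra.
apply: lerD.
  have -> : 2 * (al * (al * X)) = 2 * ((al * al) * X) by ring.
  have -> : 16 * (s x * i * X) = 2 * (8 * (s x * i) * X) by ring.
  by rewrite ler_pM2l // ler_wpM2r.
have -> : 2 * (be * (be * Y)) = 2 * ((be * be) * Y) by ring.
have -> : 16 * Y = 2 * (8 * Y) by ring.
by rewrite ler_pM2l // ler_wpM2r.
Qed.

(** Where s <= d^2, the ratio s / D is at most d^2 / (a^2 + d^2). Where
    s > d^2, it is at most 1 <= s / d^2, and grad a is replaced by the bounded
    vector P so that the integral of s, which tends to 0, appears. *)
Lemma gap_ratio_le (d C : R) (P : 'rV[R]_N) x : 0 < d -> dotrV P P <= C ->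
  s x * (D x)^-1 * dotrV (grad a x) (grad a x) <=
  d ^+ 2 * (a x ^+ 2 + d ^+ 2)^-1 * dotrV (grad a x) (grad a x) +
  (2 * dotrV (grad a x - P) (grad a x - P) + 2 * C / d ^+ 2 * s x).
Proof.
move=> d0 PC; have s0 := gap_gt0 x; have D0 := cut_den_gt0 x.
have d20 : 0 < d ^+ 2 by rewrite exprn_gt0.
have A0 := dotrV_ge0 (grad a x); have B0 := dotrV_ge0 (grad a x - P).
have P0 := dotrV_ge0 P.
have C0 : 0 <= C by exact: le_trans PC.
have [sd|ds] := lerP (s x) (d ^+ 2).
  rewrite -[leLHS]addr0 lerD //; last first.
    by rewrite addr_ge0 ?mulr_ge0 ?invr_ge0 // ltW.
  rewrite ler_wpM2r // ler_pdivlMr; last by rewrite ltr_wpDl ?sqr_ge0.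
  rewrite mulrAC ler_pdivrMr // /cut_den -!/(gap _ _ _ x).
  by have := sqr_ge0 (a x); rewrite expr2; move: (s x) sd s0 => z; nra.
have [_ _ _ /andP[_ r1] _] := cut_den_ratios x.
apply: (@le_trans _ _ (dotrV (grad a x) (grad a x))); first by rewrite ler_piMl.
have : dotrV (grad a x) (grad a x) <= 2 * dotrV (grad a x - P) (grad a x - P) + 2 * C.
  rewrite -{1 2}(subrK P (grad a x)); apply: le_trans (dotrV_sqD _ _) _.
  by rewrite lerD2l ler_pM2l.
have : 2 * C <= 2 * C / d ^+ 2 * s x.
  by rewrite mulrAC ler_pdivlMr // ler_wpM2l ?mulr_ge0 // ltW.
have : 0 <= d ^+ 2 * (a x ^+ 2 + d ^+ 2)^-1 * dotrV (grad a x) (grad a x).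
  by rewrite !mulr_ge0 ?invr_ge0 ?addr_ge0 ?sqr_ge0 // ltW.
lra.
Qed.

(** The energy density of c b is the form at b and c^2 b, up to a zeroth order
    term: this is what allows one to bound an energy by testing an equation. *)
Lemma cut_form (V : R) x :
  dotrV (grad (fun y => c y * b y) x) (grad (fun y => c y * b y) x)
    + V * (c x * b x) ^+ 2 =
  dotrV (grad b x) (grad (fun y => c y * (c y * b y)) x)
    + V * b x * (c x * (c x * b x)) + b x ^+ 2 * dotrV (grad c x) (grad c x).
Proof.
have dc := @pderivable_cut x.
rewrite (gradM dc (pderivableM dc (@db x))) (gradM dc (@db x)).
by rewrite !dotrVE (dotrVC (grad c x) (grad b x)); ring.
Qed.

Lemma grad_cut2_le x :
  dotrV (grad (fun y => c y * (c y * b y)) x) (grad (fun y => c y * (c y * b y)) x) <=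
  2 * dotrV (grad b x) (grad b x) + 8 * (b x ^+ 2 * dotrV (grad c x) (grad c x)).
Proof.
have dc := @pderivable_cut x; have /andP[c0 c1] := cut_ge0_le1 x.
have -> : grad (fun y => c y * (c y * b y)) x =
    (c x ^+ 2) *: grad b x + (2 * c x * b x) *: grad c x.
  rewrite (gradM dc (pderivableM dc (@db x))) (gradM dc (@db x)).
  by apply/rowP => i; rewrite !mxE; ring.
apply: le_trans (dotrV_sqD _ _) _; rewrite !(dotrVZl, dotrVZr).
have A0 := dotrV_ge0 (grad b x); have C0 := dotrV_ge0 (grad c x).
have c2 : 0 <= c x ^+ 2 <= 1 by apply/andP; split; [exact: sqr_ge0|nra].
have c4 : c x ^+ 2 * c x ^+ 2 <= 1 by case/andP: c2 => *; nra.
have -> : 2 * (2 * c x * b x * (2 * c x * b x * dotrV (grad c x) (grad c x))) =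
  8 * (c x ^+ 2 * (b x ^+ 2 * dotrV (grad c x) (grad c x))) by ring.
apply: lerD; first by rewrite ler_pM2l // mulrA ler_piMl.
have P0 : 0 <= b x ^+ 2 * dotrV (grad c x) (grad c x) by rewrite mulr_ge0 ?sqr_ge0.
by case/andP: c2 => _ c21; rewrite ler_pM2l // ler_piMl.
Qed.

End pointwise.
End cutoff.

(** * Energy where a function is small, and energy of the cutoff *)

(** Makes the integrals of a goal variables, because linear arithmetic would
    compare its atoms by unfolding them. *)
Ltac generalize_integrals :=
  repeat match goal with |- context [intg ?U ?g] => generalize (intg U g) end;
  intros.

Section atan_profile.
Context {R : realType}.

(** A truncation of t at height of order d, with derivative
    d^2 / (t^2 + d^2). *)
Definition atan_cap (d t : R) : R := d * atan (t / d).

Lemma atan_cap_le (d t : R) : 0 < d -> `|atan_cap d t| <= 2 * d.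
Proof.
move=> d0; rewrite /atan_cap normrM (gtr0_norm d0) mulrC ler_pM2r //.
have p2 := pihalf_lt2 R.
rewrite ler_norml; apply/andP; split; last exact: ltW (lt_trans (atan_ltpi2 _) p2).
by apply: ltW; apply: lt_trans (atan_gtNpi2 _); rewrite ltrN2.
Qed.

Lemma is_derive_atan_cap (d t : R) : 0 < d ->
  is_derive t 1 (atan_cap d) (d ^+ 2 * (t ^+ 2 + d ^+ 2)^-1).
Proof.
move=> d0.
have dl : is_derive t 1 (fun y : R => y * d^-1) (d^-1).
  apply: (is_derive_eq (is_deriveM (is_derive_id t 1) (is_derive_cst d^-1 t 1))).
  by rewrite /GRing.scale /= mulr0 add0r mulr1.
have da := @is_derive1_comp _ (@atan R) (fun y : R => y * d^-1) t _ _ (is_derive1_atan (t / d)) dl.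
have dm := is_deriveM (is_derive_cst d t 1) da.
apply: (is_derive_eq dm); rewrite /GRing.scale /= mulr0 addr0.
field; apply/andP; split; rewrite gt_eqF //.
by rewrite ltr_wpDl ?exprn_gt0 ?sqr_ge0.
Qed.

End atan_profile.

Section energy.
Context {R : realType} {N : nat} (U : set 'rV[R]_N) (oU : open U) (bU : bounded_set U).
Implicit Types a b p : 'rV[R]_N -> R.
Local Notation I := (intg U).
Local Notation leb := (lebesgue_rV (n := N)).
Local Notation sq G := (dotrV G G).

Let mU : measurable U := open_rV_measurable oU.

(** The energy density of [a], weighted so as to count only the set where |a|
    is at most of order d. *)
Definition flat_energy (d : R) a (x : 'rV[R]_N) : R :=
  d ^+ 2 * (a x ^+ 2 + d ^+ 2)^-1 * sq (grad a x).

Lemma test_flat_energy d a : 0 < d -> test_function U a -> test_function U (flat_energy d a).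
Proof.
move=> d0 ta.
have -> : flat_energy d a = fun x => sq (grad a x) * (d ^+ 2 * (a x * a x + d ^+ 2)^-1).
  by apply/funext => x; rewrite /flat_energy mulrC -expr2.
have sa := test_smooth_on (W := U) ta.
have sq_sa := smooth_onD oU (smooth_onM oU sa sa) (smooth_on_cst (d ^+ 2) oU).
apply: (testM oU (test_dot_grad oU ta sa) (smooth_onM oU (smooth_on_cst (d ^+ 2) oU) _)).
apply: (smooth_onV oU _ sq_sa) => x _.
by rewrite gt_eqF // ltr_wpDl ?exprn_gt0 // -expr2 sqr_ge0.
Qed.

Lemma test_sq_gradB a b : test_function U a -> test_function U b ->
  test_function U (fun x => sq (grad a x - grad b x)).
Proof.
move=> ta tb; have tab := testB oU ta tb.
have -> : (fun x => sq (grad a x - grad b x)) =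
    (fun x => sq (grad (fun y => a y - b y) x)).
  apply/funext => x; rewrite (gradB (g := a) (h := b)) //.
    exact: test_pderivable ta.
  exact: test_pderivable tb.
by apply: test_dot_grad => //; exact: test_smooth_on tab.
Qed.

Lemma bounded_mfun_gap a b e : test_function U a -> test_function U b -> bounded_mfun U (gap a b e).
Proof.
move=> ta tb; apply: (@bounded_mfunD _ _ _ (fun x => (a x - b x) * (a x - b x)) (fun=> e * e)).
  by apply: bounded_mfunM; apply: bounded_mfunB; exact: test_bounded_mfun.
exact: bounded_mfun_cst.
Qed.

Lemma smooth_on_cut_denV a b (e : R) : 0 < e -> test_function U a -> test_function U b ->
  smooth_on U (fun x => (cut_den a b e x)^-1).
Proof.
move=> e0 ta tb; apply: (smooth_onV oU) => [x _|].
  by rewrite gt_eqF // cut_den_gt0.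
have sa := test_smooth_on (W := U) ta.
have sab := test_smooth_on (W := U) (testB oU ta tb).
exact: (smooth_onD oU (smooth_onM oU sa sa)
  (smooth_onD oU (smooth_onM oU sab sab) (smooth_on_cst (e * e) oU))).
Qed.

Lemma test_cut a b (e : R) : 0 < e -> test_function U a -> test_function U b ->
  test_function U (cut a b e).
Proof.
move=> e0 ta tb.
exact: (testM oU ta (smooth_onM oU (test_smooth_on ta) (smooth_on_cut_denV e0 ta tb))).
Qed.

(** A quantitative form of the fact that the gradient of an H^1 function
    vanishes almost everywhere on its zero set. Let T = d atan (a / d), whose
    gradient is tau grad a with tau = d^2 / (a^2 + d^2). The integral of
    grad p . grad T is minus that of T laplacian p, hence of order d for fixed p;
    and tau |grad a|^2 is at most |grad (a - p)|^2 + 2 grad p . grad T. *)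
Lemma flat_energy_le d a p : 0 < d -> test_function U a -> test_function U p ->
  I (flat_energy d a) <= I (fun x => sq (grad a x - grad p x)) +
    4 * d * I (fun x => `|laplacian p x|).
Proof.
move=> d0 ta tp.
have da x : pderivable a x by exact: test_pderivable ta.
have dp i x : pderivable (partial i p) x by exact: test_pderivable (test_partial i oU tp).
pose tau x := d ^+ 2 * (a x ^+ 2 + d ^+ 2)^-1.
pose T x := atan_cap d (a x).
have dsat t : derivable (atan_cap d) t 1.
  by exact: (@ex_derive _ _ _ _ _ _ _ (is_derive_atan_cap t d0)).
have dT x : pderivable T x.
  exact: (pderivable_comp (da x) (dsat (a x))).
have pT i x : partial i T x = tau x * partial i a x.
  rewrite /partial /T derive_comp //; last exact: da.
  by rewrite (@derive_val _ _ _ _ _ _ _ (is_derive_atan_cap (a x) d0)).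
have ca : continuous a by exact: test_continuous ta.
have cT : continuous T.
  move=> x; apply: (@continuous_comp _ _ _ a (atan_cap d)); first exact: ca.
  by apply: differentiable_continuous; apply/derivable1_diffP.
have bT : bounded_mfun U T.
  split; first by apply: continuous_rV_measurable => // x _; exact: cT.
  by exists (2 * d) => x _; exact: atan_cap_le.
have stau : smooth_on U tau.
  apply: (smooth_onM oU (smooth_on_cst (d ^+ 2) oU)).
  have sa := test_smooth_on (W := U) ta.
  apply: (smooth_onV oU) => [x _|].
    by rewrite gt_eqF // ltr_wpDl ?exprn_gt0 ?sqr_ge0.
  exact: (smooth_onD oU (smooth_onM oU sa sa) (smooth_on_cst (d ^+ 2) oU)).
have tpa : test_function U (fun x => dotrV (grad p x) (grad a x)).
  exact: (test_dot_grad oU tp (test_smooth_on ta)).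
have tX : test_function U (fun x => tau x * dotrV (grad p x) (grad a x)).
  have := testM oU tpa stau.
  by rewrite (_ : (fun x => dotrV _ _ * tau x) = (fun x => tau x * dotrV (grad p x) (grad a x))) //;
    apply/funext => x; rewrite mulrC.
have bl : bounded_mfun U (laplacian p) by apply: test_bounded_mfun => //; exact: test_laplacian.
(* The integrand is the divergence of T grad p. *)
have key : I (fun x => tau x * dotrV (grad p x) (grad a x) + T x * laplacian p x) = 0.
  have pE i x : partial i (fun y => partial i p y * T y) x =
      tau x * (partial i p x * partial i a x) + T x * partial i (partial i p) x.
    by rewrite (partialM i (dp i x) (dT x)) pT; ring.
  have b1 i : bounded_mfun U (partial i p) by apply: test_bounded_mfun => //; exact: test_partial.
  have b2 i : bounded_mfun U (partial i (partial i p)).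
    by apply: test_bounded_mfun => //; apply: (test_partial _ oU); exact: test_partial.
  have b3 i : bounded_mfun U (fun x => tau x * (partial i p x * partial i a x)).
    apply: test_bounded_mfun => //.
    have -> : (fun x => tau x * (partial i p x * partial i a x)) =
      (fun x => partial i p x * (partial i a x * tau x)).
      by apply/funext => x; ring.
    apply: (testM oU (test_partial i oU tp)).
    exact: (smooth_onM oU (smooth_on_partial i (test_smooth_on ta)) stau).
  rewrite (@intg_eq _ _ _ _ (fun x => \sum_(i < N) partial i (fun y => partial i p y * T y) x)).
    rewrite intg_sum // => [|i].
      apply: big1 => i _; apply: (intg_partial_eq0 tp).
      - move=> x nx; rewrite (@partial_eq0 _ _ (~` supp p)) ?mul0r //.
          exact: open_suppC.
        by move=> y; exact: notin_supp.
      - by move=> x; exact: (pderivableM (dp i x) (dT x)).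
      - move=> x; rewrite (_ : partial i _ = fun x =>
            tau x * (partial i p x * partial i a x) + T x * partial i (partial i p) x); last first.
          by apply/funext => y; exact: pE.
        apply: for_continuousD; last first.
          apply: for_continuousM; first exact: cT.
          exact: (test_continuous (test_partial i oU (test_partial i oU tp))).
        apply: for_continuousM.
          apply: for_continuousM; first exact: cst_continuous.
          apply: (@continuousV _ _ (fun x => a x ^+ 2 + d ^+ 2)).
            by rewrite gt_eqF // ltr_wpDl ?exprn_gt0 ?sqr_ge0.
          apply: for_continuousD; last exact: cst_continuous.
          by apply: (@for_continuousM _ _ a a); exact: ca.
        by apply: for_continuousM; [exact: (test_continuous (test_partial i oU tp))
          |exact: (test_continuous (test_partial i oU ta))].
    apply: bounded_mfun_integrable => //.
    have -> : partial i (fun y => partial i p y * T y) = fun x =>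
       tau x * (partial i p x * partial i a x) + T x * partial i (partial i p) x.
      by apply/funext => x; exact: pE.
    by apply: bounded_mfunD => //; exact: bounded_mfunM.
  move=> x _; rewrite /laplacian /dotrV !mulr_sumr -big_split /=.
  by apply: eq_bigr => i _; rewrite pE !mxE.
have pw x : U x -> flat_energy d a x <= sq (grad a x - grad p x) +
   (2 * (tau x * dotrV (grad p x) (grad a x) + T x * laplacian p x) +
    (4 * d) * `|laplacian p x|).
  move=> _; have tau01 : 0 <= tau x <= 1.
    rewrite /tau divr_ge0 ?addr_ge0 ?sqr_ge0 //= ler_pdivrMr ?mul1r ?lerDr ?sqr_ge0 //.
    by rewrite ltr_wpDl ?exprn_gt0 ?sqr_ge0.
  rewrite /flat_energy -/(tau x).
  have := dotrV_ge0 (grad a x - grad p x - tau x *: grad a x).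
  have A0 := dotrV_ge0 (grad a x).
  rewrite !dotrVE !(dotrVC (grad p x) (grad a x)).
  have : tau x * tau x * sq (grad a x) <= tau x * sq (grad a x).
    by rewrite ler_wpM2r //; case/andP: tau01 => *; nra.
  have : - (T x * laplacian p x) <= 2 * d * `|laplacian p x|.
    apply: le_trans (ler_norm _) _; rewrite normrN normrM ler_wpM2r //.
    exact: atan_cap_le.
  rewrite mulrA; lra.
have i1 : integrable_on U (fun x => sq (grad a x - grad p x)).
  exact: (bounded_mfun_integrable oU bU (test_bounded_mfun oU (test_sq_gradB ta tp))).
have i2 : integrable_on U (fun x => `|laplacian p x|).
  by apply: bounded_mfun_integrable => //; exact: bounded_mfun_norm.
have i3 : integrable_on U
    (fun x => tau x * dotrV (grad p x) (grad a x) + T x * laplacian p x).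
  apply: (bounded_mfun_integrable oU bU).
  exact: (bounded_mfunD (test_bounded_mfun oU tX) (bounded_mfunM bT bl)).
apply: le_trans (intg_le mU _ _ pw) _.
- exact: (bounded_mfun_integrable oU bU (test_bounded_mfun oU (test_flat_energy d0 ta))).
- apply: (integrable_onD mU i1); apply: (integrable_onD mU (integrable_onZ mU _ i3)).
  exact: (integrable_onZ mU).
rewrite (intgD mU i1); last first.
  apply: (integrable_onD mU (integrable_onZ mU _ i3)); exact: (integrable_onZ mU).
rewrite (intgD mU (integrable_onZ mU _ i3) (integrable_onZ mU _ i2)).
by rewrite (intgZ mU _ i3) (intgZ mU _ i2) key mulr0 add0r.
Qed.

(** The terms can be made small one after the other, by choosing first p, then
    d, then a and e, and finally b. *)
Lemma cutoff_energy_le a b p (e d C : R) : 0 < e -> 0 < d ->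
  test_function U a -> test_function U b -> test_function U p ->
  (forall x, sq (grad p x) <= C) ->
  I (fun x => b x ^+ 2 * sq (grad (cut a b e) x)) <=
    48 * I (fun x => sq (grad a x - grad p x)) +
    64 * d * I (fun x => `|laplacian p x|) +
    32 * C / d ^+ 2 * I (gap a b e) +
    16 * I (fun x => sq (grad a x - grad b x)).
Proof.
move=> e0 d0 ta tb tp pC.
have da x : pderivable a x by exact: test_pderivable ta.
have db x : pderivable b x by exact: test_pderivable tb.
have i1 : integrable_on U (flat_energy d a).
  exact: (bounded_mfun_integrable oU bU (test_bounded_mfun oU (test_flat_energy d0 ta))).
have i2 : integrable_on U (fun x => sq (grad a x - grad p x)).
  exact: (bounded_mfun_integrable oU bU (test_bounded_mfun oU (test_sq_gradB ta tp))).
have i3 : integrable_on U (gap a b e).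
  by apply: bounded_mfun_integrable => //; exact: bounded_mfun_gap.
have i4 : integrable_on U (fun x => sq (grad a x - grad b x)).
  exact: (bounded_mfun_integrable oU bU (test_bounded_mfun oU (test_sq_gradB ta tb))).
have iL : integrable_on U (fun x => b x ^+ 2 * sq (grad (cut a b e) x)).
  apply: bounded_mfun_integrable => //; apply: test_bounded_mfun => //.
  have -> : (fun x => b x ^+ 2 * sq (grad (cut a b e) x)) =
     (fun x => sq (grad (cut a b e) x) * (b x * b x)).
    by apply/funext => x; rewrite mulrC expr2.
  have tc : test_function U (cut a b e) by exact: test_cut.
  have sb := test_smooth_on (W := U) tb.
  exact: (testM oU (test_dot_grad oU tc (test_smooth_on tc)) (smooth_onM oU sb sb)).
have j1 := integrable_onZ mU 16 i1; have j2 := integrable_onZ mU 32 i2.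
have j3 := integrable_onZ mU (32 * C / d ^+ 2) i3; have j4 := integrable_onZ mU 16 i4.
have j34 := integrable_onD mU j3 j4; have j234 := integrable_onD mU j2 j34.
apply: (@le_trans _ _ (16 * I (flat_energy d a) + (32 * I (fun x => sq (grad a x - grad p x)) +
   (32 * C / d ^+ 2 * I (gap a b e) + 16 * I (fun x => sq (grad a x - grad b x)))))).
  rewrite -(intgZ mU 16 i1) -(intgZ mU 32 i2) -(intgZ mU _ i3) -(intgZ mU 16 i4).
  rewrite -(intgD mU j3 j4) -(intgD mU j2 j34) -(intgD mU j1 j234).
  apply: (intg_le mU iL (integrable_onD mU j1 j234)) => x _.
  apply: le_trans (grad_cut_le e0 da db x) _.
  have := @gap_ratio_le _ _ a b e e0 d C (grad p x) x d0 (pC x).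
  rewrite -/(flat_energy d a x); set u := gap a b e x * _ * _; set g0 := gap a b e x => h.
  have -> : 32 * C / d ^+ 2 * g0 = 16 * (2 * C / d ^+ 2 * g0) by ring.
  set z := 2 * C / d ^+ 2 * g0 in h *.
  by lra.
have := flat_energy_le d0 ta tp; clear i1 i2 i3 i4 iL j1 j2 j3 j4 j34 j234.
move: (32 * C / d ^+ 2 * I (gap a b e)) => z.
by generalize_integrals; lra.
Qed.

End energy.

(** * The energy of a cut approximant *)

Section core.
Context {R : realType} {N : nat} (U : set 'rV[R]_N) (oU : open U) (bU : bounded_set U).
Implicit Types a b p eta : 'rV[R]_N -> R.
Implicit Types F G : 'rV[R]_N -> 'rV[R]_N.
Local Notation I := (intg U).
Local Notation leb := (lebesgue_rV (n := N)).
Local Notation sq G := (dotrV G G).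
Local Notation sqint := (square_integrable U leb).

Let mU : measurable U := open_rV_measurable oU.

Definition sqintV F := forall i, sqint (fun x => F x ord0 i).

Lemma sqintV_grad eta : test_function U eta -> sqintV (grad eta).
Proof.
move=> te i; under eq_fun do rewrite mxE.
by apply: bounded_mfun_sqint => //; apply: test_bounded_mfun => //; exact: test_partial.
Qed.

Lemma sqintVB F G : sqintV F -> sqintV G -> sqintV (fun x => F x - G x).
Proof.
by move=> sF sG i; under eq_fun do rewrite !mxE; exact: sqintB.
Qed.

Lemma integrable_dot F G : sqintV F -> sqintV G ->
  integrable_on U (fun x => dotrV (F x) (G x)).
Proof. by move=> sF sG; apply: integrable_on_sum => // i; exact: sqintM_integrable. Qed.

Lemma sqint_test eta : test_function U eta -> sqint eta.
Proof. by move=> te; apply: bounded_mfun_sqint => //; exact: test_bounded_mfun. Qed.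

Lemma intg_sqB_le F1 F2 G : sqintV F1 -> sqintV F2 -> sqintV G ->
  I (fun x => sq (F1 x - F2 x)) <=
  2 * I (fun x => sq (G x - F1 x)) + 2 * I (fun x => sq (G x - F2 x)).
Proof.
move=> s1 s2 sG; have i1 := integrable_dot (sqintVB sG s1) (sqintVB sG s1).
have i2 := integrable_dot (sqintVB sG s2) (sqintVB sG s2).
rewrite -(intgZ mU 2 i1) -(intgZ mU 2 i2).
have j1 := integrable_onZ mU 2 i1; have j2 := integrable_onZ mU 2 i2.
rewrite -(intgD mU j1 j2); apply: (intg_le mU) => [||x _].
- by apply: integrable_dot; exact: sqintVB.
- exact: integrable_onD.
have -> : F1 x - F2 x = (G x - F2 x) - (G x - F1 x).
  by apply/rowP => i; rewrite !mxE; ring.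
by rewrite [leRHS]addrC; exact: dotrV_sqB.
Qed.

Lemma intg_sq_le F G : sqintV F -> sqintV G ->
  I (fun x => sq (F x)) <= 2 * I (fun x => sq (G x)) + 2 * I (fun x => sq (G x - F x)).
Proof.
move=> s1 sG; have i1 := integrable_dot sG sG.
have i2 := integrable_dot (sqintVB sG s1) (sqintVB sG s1).
rewrite -(intgZ mU 2 i1) -(intgZ mU 2 i2).
have j1 := integrable_onZ mU 2 i1; have j2 := integrable_onZ mU 2 i2.
rewrite -(intgD mU j1 j2); apply: (intg_le mU) => [||x _].
- exact: integrable_dot.
- exact: integrable_onD.
have := dotrV_sqB (G x) (G x - F x).
by have -> : G x - (G x - F x) = F x by apply/rowP => i; rewrite !mxE; ring.
Qed.

Lemma intg_sqrB_le g1 g2 h : sqint g1 -> sqint g2 -> sqint h ->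
  I (fun x => (g1 x - g2 x) ^+ 2) <=
  2 * I (fun x => (h x - g1 x) ^+ 2) + 2 * I (fun x => (h x - g2 x) ^+ 2).
Proof.
move=> s1 s2 sh; have i1 := sqint_integrable (sqintB mU sh s1).
have i2 := sqint_integrable (sqintB mU sh s2).
rewrite -(intgZ mU 2 i1) -(intgZ mU 2 i2).
have j1 := integrable_onZ mU 2 i1; have j2 := integrable_onZ mU 2 i2.
rewrite -(intgD mU j1 j2); apply: (intg_le mU) => [||x _].
- by apply: sqint_integrable => //; exact: sqintB.
- exact: integrable_onD.
by have := sqr_ge0 ((h x - g1 x) + (h x - g2 x)); lra.
Qed.

Lemma intg_sqr_le g h : sqint g -> sqint h ->
  I (fun x => g x ^+ 2) <= 2 * I (fun x => h x ^+ 2) + 2 * I (fun x => (h x - g x) ^+ 2).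
Proof.
move=> s1 sh; have i1 := sqint_integrable sh.
have i2 := sqint_integrable (sqintB mU sh s1).
rewrite -(intgZ mU 2 i1) -(intgZ mU 2 i2).
have j1 := integrable_onZ mU 2 i1; have j2 := integrable_onZ mU 2 i2.
rewrite -(intgD mU j1 j2); apply: (intg_le mU) => [||x _].
- exact: sqint_integrable.
- exact: integrable_onD.
by have := sqr_ge0 (h x + (h x - g x)); lra.
Qed.

Context (V v w : 'rV[R]_N -> R) (G : 'rV[R]_N -> 'rV[R]_N).
Context (sV : smooth_on U V) (sv : sqint v) (sw : sqint w) (sG : sqintV G).
Context (eqn : forall eta, test_function U eta ->
  I (fun x => dotrV (G x) (grad eta x) + V x * v x * eta x) = I (fun x => w x * eta x)).

Definition energy eta := I (fun x => sq (grad eta x) + V x * eta x ^+ 2).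

(** The equation is tested with th = c^2 b and compared with [cut_form].
    Replacing v by b costs |grad th| |G - grad b| in the first order term and
    |V th| |v - b| in the potential term. There V may be unbounded near the
    boundary, but th carries the factor a^2 / D <= a^2 / e^2, so |V th| <= K |b|
    for a constant K that does not depend on b. *)
Lemma energy_cut_le a b (e sg K : R) : 0 < e -> 0 < sg -> 0 <= K ->
  test_function U a -> test_function U b ->
  (forall x, U x -> `|V x * (a x * a x)| <= K * (e * e)) ->
  energy (fun x => cut a b e x * b x) <= I (fun x => w x * v x) +
    (sg / 2 * I (fun x => w x ^+ 2) + (8 / sg * I (gap a b e) +
    ((sg^-1 + K ^+ 2 / (4 * sg ^+ 2)) * I (fun x => (v x - b x) ^+ 2) +
    ((2 * sg)^-1 * I (fun x => sq (G x - grad b x)) +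
    (sg * I (fun x => sq (grad b x)) +
    ((4 * sg + 1) * I (fun x => b x ^+ 2 * sq (grad (cut a b e) x)) +
     sg ^+ 2 * I (fun x => b x ^+ 2))))))).
Proof.
move=> e0 sg0 K0 ta tb VK.
have da x : pderivable a x by exact: test_pderivable ta.
have db x : pderivable b x by exact: test_pderivable tb.
have tc : test_function U (cut a b e) by exact: test_cut.
have sb := test_smooth_on (W := U) tb; have sc := test_smooth_on (W := U) tc.
pose eta x := cut a b e x * b x.
pose th x := cut a b e x * (cut a b e x * b x).
have te : test_function U eta by exact: (testM oU tc sb).
have tth : test_function U th.
  exact: (testM oU tc (test_smooth_on te)).
have sqb := sqint_test tb; have sqt := sqint_test tth.
have sgb := sqintV_grad tb; have sgt := sqintV_grad tth.
have bVt : bounded_mfun U (fun x => V x * th x).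
  apply: test_bounded_mfun => //; have := testM oU tth sV.
  by rewrite (_ : (fun x => th x * V x) = (fun x => V x * th x)) //;
    apply/funext => x; rewrite mulrC.
have i1 := sqintM_integrable mU sw sv.
have i2 := sqint_integrable sw.
have i3 : integrable_on U (gap a b e).
  by apply: bounded_mfun_integrable => //; exact: bounded_mfun_gap.
have i4 := sqint_integrable (sqintB mU sv sqb).
have i5 := integrable_dot (sqintVB sG sgb) (sqintVB sG sgb).
have i6 := integrable_dot sgb sgb.
have i7 : integrable_on U (fun x => b x ^+ 2 * sq (grad (cut a b e) x)).
  apply: bounded_mfun_integrable => //; apply: test_bounded_mfun => //.
  have -> : (fun x => b x ^+ 2 * sq (grad (cut a b e) x)) =
     (fun x => sq (grad (cut a b e) x) * (b x * b x)).
    by apply/funext => x; rewrite mulrC expr2.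
  exact: (testM oU (test_dot_grad oU tc sc) (smooth_onM oU sb sb)).
have i8 := sqint_integrable sqb.
have iwt := sqintM_integrable mU sw sqt.
have iq : integrable_on U (fun x => sq (grad eta x) + V x * eta x ^+ 2).
  have se := test_smooth_on (W := U) te.
  apply: (bounded_mfun_integrable oU bU); apply: (test_bounded_mfun oU).
  apply: (testD oU (test_dot_grad oU te se)).
  have -> : (fun x => V x * eta x ^+ 2) = (fun x => eta x * (eta x * V x)).
    by apply/funext => x; ring.
  exact: (testM oU te (smooth_onM oU se sV)).
have ie : integrable_on U (fun x => dotrV (G x) (grad th x) + V x * v x * th x).
  apply: (integrable_onD mU (integrable_dot sG sgt)).
  apply: (@integrable_on_eq _ _ U mU (fun x => v x * (V x * th x)) (fun x => V x * v x * th x)).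
    by move=> x _; ring.
  by apply: sqintM_integrable => //; exact: bounded_mfun_sqint.
have j2 := integrable_onZ mU (sg / 2) i2.
have j3 := integrable_onZ mU (8 / sg) i3.
have j4 := integrable_onZ mU (sg^-1 + K ^+ 2 / (4 * sg ^+ 2)) i4.
have j5 := integrable_onZ mU (2 * sg)^-1 i5.
have j6 := integrable_onZ mU sg i6.
have j7 := integrable_onZ mU (4 * sg + 1) i7.
have j8 := integrable_onZ mU (sg ^+ 2) i8.
have k7 := integrable_onD mU j7 j8.
have k6 := integrable_onD mU j6 k7.
have k5 := integrable_onD mU j5 k6.
have k4 := integrable_onD mU j4 k5.
have k3 := integrable_onD mU j3 k4.
have k2 := integrable_onD mU j2 k3.
have k1 := integrable_onD mU i1 k2.
rewrite -(intgZ mU _ i2) -(intgZ mU _ i3) -(intgZ mU _ i4) -(intgZ mU _ i5).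
rewrite -(intgZ mU _ i6) -(intgZ mU _ i7) -(intgZ mU _ i8).
rewrite -(intgD mU j7 j8) -(intgD mU j6 k7) -(intgD mU j5 k6) -(intgD mU j4 k5).
rewrite -(intgD mU j3 k4) -(intgD mU j2 k3) -(intgD mU i1 k2).
(* The weak equation with th enters as a zero contribution. *)
have -> : energy eta = I (fun x => (sq (grad eta x) + V x * eta x ^+ 2) -
   (dotrV (G x) (grad th x) + V x * v x * th x) + w x * th x).
  rewrite (intgD mU (integrable_onB mU iq ie) iwt) (intgB mU iq ie) (eqn tth).
  by rewrite subrK.
apply: (intg_le mU _ k1) => [|x Ux].
  exact: (integrable_onD mU (integrable_onB mU iq ie) iwt).
rewrite /eta (cut_form e0 da db (V x) x) -/(th x) -/th.
have hG : dotrV (grad b x) (grad th x) - dotrV (G x) (grad th x) <=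
    (2 * sg)^-1 * sq (G x - grad b x) + sg / 2 * sq (grad th x).
  have := dotrV_young (grad b x - G x) (grad th x) sg0.
  have -> : sq (grad b x - G x) = sq (G x - grad b x) by rewrite !dotrVE; ring.
  by rewrite dotrVDl dotrVNl.
have hth := grad_cut2_le e0 da db x; rewrite -/th in hth.
have {}hth : sg / 2 * sq (grad th x) <= sg * sq (grad b x) +
    4 * sg * (b x ^+ 2 * sq (grad (cut a b e) x)).
  have -> : sg * sq (grad b x) + 4 * sg * (b x ^+ 2 * sq (grad (cut a b e) x)) =
    sg / 2 * (2 * sq (grad b x) + 8 * (b x ^+ 2 * sq (grad (cut a b e) x))) by field.
  by rewrite ler_wpM2l // divr_ge0 // ltW.
have Vth : `|V x * th x| <= K * `|b x|.
  have [/andP[r0 r1] _ _ _ _] := cut_den_ratios a b e0 x.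
  have D0 := cut_den_gt0 a b e0 x.
  have -> : V x * th x =
    (V x * (a x * a x)) * ((a x ^+ 2 * (cut_den a b e x)^-1) * (cut_den a b e x)^-1 * b x).
    by rewrite /th /cut; ring.
  rewrite normrM; apply: le_trans (ler_wpM2r (normr_ge0 _) (VK x Ux)) _.
  rewrite -[leLHS]mulrA ler_wpM2l // normrM mulrA -[leRHS]mul1r ler_wpM2r //.
  rewrite normrM (ger0_norm r0) gtr0_norm ?invr_gt0 // mulrA ler_pdivrMr // mul1r.
  apply: (@le_trans _ _ (e * e)).
    by rewrite -[leRHS]mulr1 ler_wpM2l // mulr_ge0 // ltW.
  rewrite /cut_den /gap; have := sqr_ge0 (a x); have := sqr_ge0 (a x - b x); lra.
have hV : V x * b x * th x - V x * v x * th x <=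
    K ^+ 2 / (4 * sg ^+ 2) * (v x - b x) ^+ 2 + sg ^+ 2 * b x ^+ 2.
  have -> : V x * b x * th x - V x * v x * th x = (V x * th x) * (b x - v x) by ring.
  apply: le_trans (ler_norm _) _; rewrite normrM.
  apply: le_trans (ler_wpM2r (normr_ge0 _) Vth) _.
  rewrite -(real_normK (num_real (b x))) -(real_normK (num_real (v x - b x))).
  rewrite (distrC (v x)).
  move: `|b x| `|b x - v x| => y z.
  have := sqr_ge0 (K / (2 * sg) * z - sg * y).
  have -> : (K / (2 * sg) * z - sg * y) ^+ 2 =
    K ^+ 2 / (4 * sg ^+ 2) * z ^+ 2 + sg ^+ 2 * y ^+ 2 - K * y * z.
    by field; rewrite gt_eqF.
  by rewrite subr_ge0.
have hw : w x * th x <= w x * v x + sg / 2 * w x ^+ 2 +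
    (8 / sg * gap a b e x + sg^-1 * (v x - b x) ^+ 2).
  have h1 : w x * (th x - v x) <= sg / 2 * w x ^+ 2 + (2 * sg)^-1 * (th x - v x) ^+ 2.
    have := mulr_ge0 (ltW (divr_gt0 sg0 (ltr0n _ 2))) (sqr_ge0 (w x - sg^-1 * (th x - v x))).
    have -> : sg / 2 * (w x - sg^-1 * (th x - v x)) ^+ 2 =
      sg / 2 * w x ^+ 2 + (2 * sg)^-1 * (th x - v x) ^+ 2 - w x * (th x - v x).
      by field; rewrite gt_eqF.
    by rewrite subr_ge0.
  have h2 : (th x - v x) ^+ 2 <= 16 * gap a b e x + 2 * (v x - b x) ^+ 2.
    have := cut2_close a b e0 x; rewrite -/(th x).
    have := sqr_ge0 ((b x - th x) - (v x - b x)).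
    by lra.
  have {}h2 : (2 * sg)^-1 * (th x - v x) ^+ 2 <=
      8 / sg * gap a b e x + sg^-1 * (v x - b x) ^+ 2.
    have -> : 8 / sg * gap a b e x + sg^-1 * (v x - b x) ^+ 2 =
      (2 * sg)^-1 * (16 * gap a b e x + 2 * (v x - b x) ^+ 2).
      by field; rewrite gt_eqF.
    by rewrite ler_wpM2l // invr_ge0 mulr_ge0 // ltW.
  by rewrite mulrBr in h1; lra.
rewrite (mulrDl sg^-1).
move: (K ^+ 2 / _ * _) (sg^-1 * _) (8 / sg * _) hV hw => y1 y2 y3 hV hw.
rewrite (mulrDl (4 * sg) 1); lra.
Qed.

End core.

(** * Test functions that reach the energy of the solution *)

Ltac ilra :=
  clear;
  repeat match goal with x := _ |- _ => clearbody x end;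
  generalize_integrals; lra.

Section approx.
Context {R : realType} {N : nat} (U : set 'rV[R]_N) (oU : open U) (bU : bounded_set U).
Implicit Types a b p eta : 'rV[R]_N -> R.
Local Notation I := (intg U).
Local Notation leb := (lebesgue_rV (n := N)).
Local Notation sq G := (dotrV G G).
Local Notation sqint := (square_integrable U leb).

Let mU : measurable U := open_rV_measurable oU.

Context (V v w : 'rV[R]_N -> R) (G : 'rV[R]_N -> 'rV[R]_N).
Context (sV : smooth_on U V) (sv : sqint v) (sw : sqint w) (sG : sqintV U G).
Context (eqn : forall eta, test_function U eta ->
  I (fun x => dotrV (G x) (grad eta x) + V x * v x * eta x) = I (fun x => w x * eta x)).

(** The test functions [xi k] converge to v in H^1, which says nothing on the
    integrals of V (xi k)^2. Cutting b = xi k by a = xi j repairs this: the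
    parameters p, d, a, e, b of [cutoff_energy_le] and [energy_cut_le] are chosen
    in this order, so that each constant depends on earlier choices only. *)
Lemma energy_approx (xi : nat -> 'rV[R]_N -> R) :
  (forall k, test_function U (xi k)) ->
  (forall e, 0 < e -> exists K, forall k, (K <= k)%N ->
    I (fun x => (v x - xi k x) ^+ 2) <= e) ->
  (forall e, 0 < e -> exists K, forall k, (K <= k)%N ->
    I (fun x => sq (G x - grad (xi k) x)) <= e) ->
  forall ep, 0 < ep -> exists eta, [/\ test_function U eta,
    I (fun x => (v x - eta x) ^+ 2) <= ep &
    energy U V eta <= I (fun x => w x * v x) + ep].
Proof.
move=> txi cv cG ep ep0.
have sxi k := sqint_test oU bU (txi k); have sgxi k := sqintV_grad oU bU (txi k).
set W := I (fun x => w x ^+ 2); have W0 : 0 <= W by apply: intg_ge0 => x _; exact: sqr_ge0.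
set Bv := I (fun x => v x ^+ 2); have Bv0 : 0 <= Bv by apply: intg_ge0 => x _; exact: sqr_ge0.
set BG := I (fun x => sq (G x)); have BG0 : 0 <= BG by apply: intg_ge0 => x _; exact: dotrV_ge0.
(* The sum of the constants in the bounds t1 to t6 at the end; the L^2 bound
   needs it to be at least 6. *)
pose Cst := W / 2 + 2 * BG + 2 * Bv + 1535.
have Cst6 : 6 <= Cst by rewrite /Cst; lra.
have Cst0 : 0 < Cst by apply: lt_le_trans Cst6.
pose sg := Num.min 1 (ep / Cst).
have sg0 : 0 < sg by rewrite lt_min ltr01 divr_gt0.
have sg1 : sg <= 1 by rewrite ge_min lexx.
have sg41 : 0 <= 4 * sg + 1 by lra.
have sg45 : 4 * sg + 1 <= 5 by lra.
have sgC : sg * Cst <= ep by rewrite -ler_pdivlMr // ge_min lexx orbT.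
pose rho := sg ^+ 2; have rho0 : 0 < rho by rewrite exprn_gt0.
have rho1 : rho <= sg by rewrite /rho expr2 ger_pMr.
have [K0 hK0] := cG _ rho0.
pose p := xi K0.
have [C [C0 pC]] : exists C, 0 <= C /\ forall x, sq (grad p x) <= C.
  have [M hM] := test_bounded (test_dot_grad oU (txi K0) (test_smooth_on (W := U) (txi K0))).
  exists M; split; first exact: le_trans (hM 0).
  by move=> x; exact: le_trans (ler_norm _) (hM x).
set L := I (fun x => `|laplacian p x|).
have L0 : 0 <= L by apply: intg_ge0.
pose d := rho / (4 * (L + 1)).
have d0 : 0 < d by rewrite divr_gt0 // mulr_gt0 // ltr_wpDl.
have dL : 4 * d * L <= rho.
  have -> : 4 * d * L = rho * (L / (L + 1)) by rewrite /d; field; rewrite gt_eqF // ltr_wpDl.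
  by rewrite ger_pMr // ler_pdivrMr ?mul1r ?ltr_wpDl // lerDl.
pose Cd := C / d ^+ 2.
have Cd0 : 0 <= Cd by rewrite divr_ge0 // exprn_ge0 // ltW.
(* Bounds the integral of the gap: both it and its multiple by C / d^2 have to
   be at most rho. *)
pose r1 := rho / (1 + Cd).
have r10 : 0 < r1 by rewrite divr_gt0 // ltr_pwDl.
have r1E : r1 + Cd * r1 = rho.
  by rewrite /r1; field; rewrite gt_eqF // ltr_pwDl.
have Cdr1 : 0 <= Cd * r1 by rewrite mulr_ge0 // ltW.
have [K1 hK1] : exists K, forall k, (K <= k)%N -> I (fun x => (v x - xi k x) ^+ 2) <= r1 / 8.
  by apply: cv; rewrite divr_gt0.
have [j jK0 jK1] : exists2 j, (K0 <= j)%N & (K1 <= j)%N.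
  by exists (maxn K0 K1); [exact: leq_maxl|exact: leq_maxr].
pose a := xi j.
have ta : test_function U a by exact: txi.
pose mass := I (fun=> 1); have mass0 : 0 <= mass by apply: intg_ge0.
pose e := Num.min 1 (r1 / (2 * (mass + 1))).
have m10 : 0 < 2 * (mass + 1) by rewrite mulr_gt0 // ltr_wpDl.
have e0 : 0 < e by rewrite lt_min ltr01 divr_gt0.
have e1 : e <= 1 by rewrite ge_min lexx.
have em : e * e * mass <= r1 / 2.
  have : e * (2 * (mass + 1)) <= r1 by rewrite -ler_pdivlMr // ge_min lexx orbT.
  have : e * e * mass <= e * mass by rewrite ler_wpM2r // ger_pMr.
  by move: e0; ilra.
have [M hM] : exists M, forall x, `|a x * (a x * V x)| <= M.
  apply: (@test_bounded _ _ U); apply: (testM oU ta (smooth_onM oU _ sV)).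
  exact: test_smooth_on ta.
have M0 : 0 <= M by exact: le_trans (hM 0).
(* The potential is bounded by M / a^2 on the support of a. *)
pose K := M / (e * e); have ee0 : 0 < e * e by exact: mulr_gt0.
have K00 : 0 <= K by rewrite divr_ge0 // ltW.
have VK x : U x -> `|V x * (a x * a x)| <= K * (e * e).
  move=> _; rewrite /K divfK ?gt_eqF //; have := hM x.
  by have -> : a x * (a x * V x) = V x * (a x * a x) by ring.
have K20 : 0 < K ^+ 2 + 1 by rewrite ltr_wpDl ?sqr_ge0.
have [K2 hK2] : exists K', forall k, (K' <= k)%N ->
    I (fun x => (v x - xi k x) ^+ 2) <= 4 * sg ^+ 4 / (K ^+ 2 + 1).
  by apply: cv; rewrite divr_gt0 // mulr_gt0 // exprn_gt0.
have [k kj kK2] : exists2 k, (j <= k)%N & (K2 <= k)%N.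
  by exists (maxn j K2); [exact: leq_maxl|exact: leq_maxr].
pose b := xi k.
have tb : test_function U b by exact: txi.
have kK0 := leq_trans jK0 kj; have kK1 := leq_trans jK1 kj.
have r18 : r1 / 8 <= rho by rewrite -r1E; move: Cdr1 r10; ilra.
pose nu := I (fun x => (v x - b x) ^+ 2).
have nu0 : 0 <= nu by apply: intg_ge0 => x _; exact: sqr_ge0.
have nu1 : nu <= r1 / 8 by exact: hK1.
have nuK : K ^+ 2 / (4 * sg ^+ 2) * nu <= sg ^+ 2.
  have h : (K ^+ 2 + 1) * nu <= 4 * sg ^+ 4 by rewrite mulrC -ler_pdivlMr //; exact: hK2.
  rewrite mulrAC ler_pdivrMr ?mulr_gt0 ?exprn_gt0 //.
  have -> : sg ^+ 2 * (4 * sg ^+ 2) = 4 * sg ^+ 4 by ring.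
  by apply: le_trans h; rewrite mulrDl lerDl mul1r.
pose S := I (gap a b e).
have S0 : 0 <= S by apply: intg_ge0 => x _; apply: ltW; exact: gap_gt0.
have Sr1 : S <= r1.
  have i1 : integrable_on U (fun x => (a x - b x) ^+ 2).
    by apply: sqint_integrable; exact: (sqintB mU (sxi j) (sxi k)).
  have i2 : integrable_on U (fun=> 1 : R).
    by apply: bounded_mfun_integrable => //; exact: bounded_mfun_cst.
  have -> : S = I (fun x => (a x - b x) ^+ 2 + e * e * 1).
    by apply: intg_eq => x _; rewrite /gap mulr1 expr2.
  rewrite (intgD mU i1 (integrable_onZ mU _ i2)) (intgZ mU _ i2) -/mass.
  have := intg_sqrB_le oU (sxi j) (sxi k) sv; rewrite -/a -/b -/nu.
  by have := hK1 j jK1; rewrite -/a; move: em nu1; ilra.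
have gaG : I (fun x => sq (G x - grad a x)) <= rho by exact: hK0.
have gbG : I (fun x => sq (G x - grad b x)) <= rho by exact: hK0.
have gpG : I (fun x => sq (G x - grad p x)) <= rho by exact: hK0.
have gap1 : I (fun x => sq (grad a x - grad p x)) <= 4 * rho.
  by have := intg_sqB_le oU (sgxi j) (sgxi K0) sG; rewrite -/a -/p; move: gaG gpG; ilra.
have gab1 : I (fun x => sq (grad a x - grad b x)) <= 4 * rho.
  by have := intg_sqB_le oU (sgxi j) (sgxi k) sG; rewrite -/a -/b; move: gaG gbG; ilra.
have gb1 : I (fun x => sq (grad b x)) <= 2 * BG + 2.
  by have := intg_sq_le oU (sgxi k) sG; rewrite -/b -/BG; move: gbG rho1 sg1; ilra.
have b1 : I (fun x => b x ^+ 2) <= 2 * Bv + 2.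
  by have := intg_sqr_le oU (sxi k) sv; rewrite -/b -/Bv -/nu; move: nu1 r18 rho1 sg1; ilra.
pose P := I (fun x => b x ^+ 2 * sq (grad (cut a b e) x)).
have P1 : P <= 304 * rho.
  have := cutoff_energy_le oU bU e0 d0 ta tb (txi K0) pC; rewrite -/p -/P -/S -/L.
  have -> : 32 * C / d ^+ 2 * S = 32 * (Cd * S) by rewrite /Cd; ring.
  have : Cd * S <= Cd * r1 by rewrite ler_wpM2l.
  have -> : 64 * d * L = 16 * (4 * d * L) by ring.
  by move: gap1 gab1 dL r1E r10; ilra.
have teta : test_function U (fun x => cut a b e x * b x).
  exact: (testM oU (test_cut oU e0 ta tb) (test_smooth_on tb)).
exists (fun x => cut a b e x * b x); split => //.
  have seta := sqint_test oU bU teta.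
  apply: le_trans (intg_sqrB_le oU sv seta (sxi k)) _; rewrite -/b.
  have -> : I (fun x => (b x - v x) ^+ 2) = nu by apply: intg_eq => x _; ring.
  have h : I (fun x => (b x - cut a b e x * b x) ^+ 2) <= 2 * S.
    have i3 : integrable_on U (gap a b e).
      by apply: bounded_mfun_integrable => //; exact: bounded_mfun_gap.
    rewrite -(intgZ mU 2 i3); apply: (intg_le mU) => [||x _].
    - by apply: sqint_integrable; apply: sqintB => //; exact: sxi.
    - exact: integrable_onZ.
    - exact: cut_close.
  have : 6 * sg <= sg * Cst.
    by rewrite mulrC ler_pM2l.
  have : S <= rho by rewrite -r1E; move: Sr1 Cdr1; ilra.
  by move: h nu1 r18 rho1 sgC; ilra.
have := energy_cut_le oU bU sV sv sw sG eqn e0 sg0 K00 ta tb VK.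
rewrite -/W -/S -/nu -/P => /le_trans; apply; rewrite lerD2l.
apply: le_trans sgC.
have t1 : 8 / sg * S <= 8 * sg.
  rewrite mulrAC ler_pdivrMr //; have -> : 8 * sg * sg = 8 * rho by rewrite /rho; ring.
  by move: Sr1 r1E Cdr1; ilra.
have t2 : (sg^-1 + K ^+ 2 / (4 * sg ^+ 2)) * nu <= sg + sg.
  rewrite mulrDl; apply: lerD; last exact: le_trans nuK rho1.
  by rewrite mulrC ler_pdivrMr // -expr2 -/rho; move: nu1 r18; ilra.
have t3 : (2 * sg)^-1 * I (fun x => sq (G x - grad b x)) <= sg / 2.
  rewrite mulrC ler_pdivrMr ?mulr_gt0 //.
  have -> : sg / 2 * (2 * sg) = rho by rewrite /rho; field.
  exact: gbG.
have t4 : sg * I (fun x => sq (grad b x)) <= sg * (2 * BG + 2) by rewrite ler_pM2l.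
have t5 : (4 * sg + 1) * P <= 1520 * sg.
  apply: (@le_trans _ _ (5 * (304 * rho))); last by move: rho1; ilra.
  apply: ler_pM; rewrite ?sg41 ?sg45 //.
  by apply: intg_ge0 => x _; rewrite mulr_ge0 ?sqr_ge0 ?dotrV_ge0.
have t6 : sg ^+ 2 * I (fun x => b x ^+ 2) <= sg * (2 * Bv + 2).
  apply: ler_pM => //; first exact: ltW.
  by apply: intg_ge0 => x _; exact: sqr_ge0.
rewrite /Cst.
have -> : sg * (W / 2 + 2 * BG + 2 * Bv + 1535) =
  sg / 2 * W + sg * (2 * BG + 2) + sg * (2 * Bv + 2) + 1531 * sg by field.
move: t1 t2 t3 t4 t5 t6 sg0; ilra.
Qed.

End approx.

(** * The ground-state representation *)

Section ground_state.
Context {R : realType} {N : nat} (U : set 'rV[R]_N) (oU : open U) (bU : bounded_set U).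
Context (f : 'rV[R]_N -> R) (sf : smooth_on U f) (f0 : forall x, U x -> 0 < f x).
Implicit Types (eta zeta th : 'rV[R]_N -> R).
Local Notation I := (intg U).
Local Notation leb := (lebesgue_rV (n := N)).
Local Notation sq G := (dotrV G G).

Let mU : measurable U := open_rV_measurable oU.

Definition root x := Num.sqrt (f x).

Lemma root_gt0 x : U x -> 0 < root x.
Proof. by move=> Ux; rewrite sqrtr_gt0 f0. Qed.

Lemma root_sq x : U x -> root x * root x = f x.
Proof. by move=> Ux; rewrite -expr2 sqr_sqrtr // ltW // f0. Qed.

Lemma smooth_root : smooth_on U root.
Proof. exact: smooth_on_sqrt. Qed.

Lemma smooth_rootV : smooth_on U (fun x => (root x)^-1).
Proof.
apply: (smooth_onV oU) smooth_root => x Ux.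
by rewrite gt_eqF // root_gt0.
Qed.

Let droot x : U x -> pderivable root x.
Proof. exact: smooth_on_pderivable smooth_root. Qed.

Let ddroot i x : U x -> pderivable (partial i root) x.
Proof. by move=> Ux; exact: (smooth_on_pderivable (smooth_on_partial i smooth_root) Ux). Qed.

Lemma witten_potentialE x : U x ->
  witten_potential f x = (root x)^-1 * laplacian root x.
Proof.
move=> Ux; have r0 := root_gt0 Ux.
have p1 i y : U y -> partial i f y = 2 * (root y * partial i root y).
  move=> Uy; rewrite -(@partial_congr _ _ U i (fun z => root z * root z)) //; last first.
    by move=> z; exact: root_sq.
  by rewrite (partialM i (@droot _ Uy) (@droot _ Uy)); ring.
have p2 i : partial i (partial i f) x =
    2 * (partial i root x * partial i root x + root x * partial i (partial i root) x).
  rewrite (@partial_congr _ _ U i _ (fun y => 2 * (root y * partial i root y))) //; last first.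
    by move=> y; exact: p1.
  rewrite (partialM i (pderivable_cst 2 x) (pderivableM (@droot _ Ux) (@ddroot i _ Ux))).
  rewrite partial_cst mulr0 addr0 (partialM i (@droot _ Ux) (@ddroot i _ Ux)); ring.
have gE : dotrV (grad f x) (grad f x) = 4 * root x ^+ 2 * sq (grad root x).
  by rewrite /dotrV mulr_sumr; apply: eq_bigr => i _; rewrite !mxE p1 //; ring.
have lE : laplacian f x = 2 * sq (grad root x) + 2 * root x * laplacian root x.
  rewrite /laplacian /dotrV !mulr_sumr -big_split /=.
  by apply: eq_bigr => i _; rewrite p2 !mxE; ring.
rewrite /witten_potential gE lE -(root_sq Ux).
by field; rewrite gt_eqF.
Qed.

Lemma smooth_potential : smooth_on U (witten_potential f).
Proof.
have sL := smooth_onM oU smooth_rootV (smooth_on_laplacian oU smooth_root).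
by apply: (smooth_on_eq oU _ sL) => x Ux; rewrite witten_potentialE.
Qed.

Lemma test_root zeta : test_function U zeta -> test_function U (fun x => root x * zeta x).
Proof.
move=> tz; have := testM oU tz smooth_root.
by rewrite (_ : (fun x => zeta x * root x) = (fun x => root x * zeta x)) //;
  apply/funext => x; rewrite mulrC.
Qed.

Lemma intg_divergence (F : 'I_N -> 'rV[R]_N -> R) : (forall i, test_function U (F i)) ->
  I (fun x => \sum_(i < N) partial i (F i) x) = 0.
Proof.
move=> tF; rewrite intg_sum // => [|i].
  by apply: big1 => i _; exact: intg_partial_test.
by apply: bounded_mfun_integrable => //; apply: test_bounded_mfun => //; exact: test_partial.
Qed.

Definition witten_form eta th x : R :=
  dotrV (grad eta x) (grad th x) + witten_potential f x * eta x * th x.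

Lemma test_witten_form eta th : test_function U eta -> test_function U th ->
  test_function U (witten_form eta th).
Proof.
move=> te tt; apply: (testD oU (test_dot_grad oU te (test_smooth_on tt))).
have -> : (fun x => witten_potential f x * eta x * th x) =
    (fun x => eta x * (th x * witten_potential f x)) by apply/funext => x; ring.
exact: (testM oU te (smooth_onM oU (test_smooth_on tt) smooth_potential)).
Qed.

Lemma integrable_witten_form eta th : test_function U eta -> test_function U th ->
  integrable_on U (witten_form eta th).
Proof.
move=> te tt; apply: bounded_mfun_integrable => //.
by apply: test_bounded_mfun => //; exact: test_witten_form.
Qed.

Lemma test_witten eta : test_function U eta -> test_function U (witten f eta).
Proof.
move=> te; have tl := testZ (-1) oU (test_laplacian oU te).
have := testD oU tl (testM oU te smooth_potential).
by rewrite (_ : (fun x => -1 * laplacian eta x + eta x * witten_potential f x) =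
  witten f eta) //; apply/funext => x; rewrite /witten mulN1r (mulrC (eta x)).
Qed.

Lemma intg_witten_form eta th : test_function U eta -> test_function U th ->
  I (witten_form eta th) = I (fun x => eta x * witten f th x).
Proof.
move=> te tt; apply/eqP; rewrite -subr_eq0; apply/eqP.
have i1 := integrable_witten_form te tt.
have i2 : integrable_on U (fun x => eta x * witten f th x).
  apply: (bounded_mfun_integrable oU bU); apply: (test_bounded_mfun oU).
  exact: (testM oU te (test_smooth_on (test_witten tt))).
rewrite -(intgB mU i1 i2).
rewrite (@intg_eq _ _ _ _ (fun x => \sum_(i < N) partial i (fun y => eta y * partial i th y) x)).
  by apply: intg_divergence => i; exact: (testM oU te (smooth_on_partial i (test_smooth_on tt))).
move=> x _; rewrite /witten_form /witten mulrDr mulrN -mulrA (mulrCA (eta x)) opprD opprK.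
rewrite addrACA subrr addr0 /dotrV /laplacian mulr_sumr -big_split /=.
apply: eq_bigr => i _; rewrite !mxE.
have dtt := test_pderivable (test_partial i oU tt) (x := x).
rewrite (partialM i (test_pderivable te (x := x)) dtt).
by rewrite addrC [partial i th x * _]mulrC.
Qed.

(** The ground-state identity. Since V g = laplacian g for g = [root], the
    difference of the two integrands is the divergence of g zeta th grad g. *)
Lemma intg_witten_form_root zeta th : test_function U zeta -> test_function U th ->
  I (fun x => f x * dotrV (grad zeta x) (grad th x)) =
  I (witten_form (fun x => root x * zeta x) (fun x => root x * th x)).
Proof.
move=> tz tt; apply/esym/eqP; rewrite -subr_eq0; apply/eqP.
have i1 := integrable_witten_form (test_root tz) (test_root tt).
have i2 : integrable_on U (fun x => f x * dotrV (grad zeta x) (grad th x)).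
  apply: bounded_mfun_integrable => //; apply: test_bounded_mfun => //.
  have := testM oU (test_dot_grad oU tz (test_smooth_on (W := U) tt)) sf.
  by rewrite (_ : (fun x => dotrV _ _ * f x) = (fun x => f x * dotrV (grad zeta x) (grad th x))) //;
    apply/funext => x; rewrite mulrC.
rewrite -(intgB mU i1 i2).
pose F i x := zeta x * (th x * (root x * partial i root x)).
have tF i : test_function U (F i).
  apply: (testM oU tz); apply: (smooth_onM oU (test_smooth_on tt)).
  exact: (smooth_onM oU smooth_root (smooth_on_partial i smooth_root)).
(* The divergence of F contains the term zeta th g laplacian g, which is
   V (g zeta) (g th). *)
rewrite (@intg_eq _ _ _ _ (fun x => \sum_(i < N) partial i (F i) x)); first exact: intg_divergence.
move=> x Ux; have dz := test_pderivable tz (x := x); have dt := test_pderivable tt (x := x).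
have dr := @droot _ Ux; have r0 := root_gt0 Ux.
rewrite /witten_form witten_potentialE // (gradM dr dz) (gradM dr dt).
have -> : (root x)^-1 * laplacian root x * (root x * zeta x) * (root x * th x) =
  root x * zeta x * th x * laplacian root x by field; rewrite gt_eqF.
rewrite -(root_sq Ux) /laplacian /dotrV !mulr_sumr -big_split -sumrB /=.
apply: eq_bigr => i _; rewrite !mxE.
rewrite (partialM i dz (pderivableM dt (pderivableM dr (@ddroot i _ Ux)))).
rewrite (partialM i dt (pderivableM dr (@ddroot i _ Ux))) (partialM i dr (@ddroot i _ Ux)).
by ring.
Qed.

Lemma energyE eta : test_function U eta ->
  energy U (witten_potential f) eta = I (witten_form eta eta).
Proof. by move=> te; apply: intg_eq => x _; rewrite /witten_form expr2 mulrA. Qed.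

Lemma energy_root zeta : test_function U zeta ->
  energy U (witten_potential f) (fun x => root x * zeta x) =
  I (fun x => f x * sq (grad zeta x)).
Proof. by move=> tz; rewrite energyE ?intg_witten_form_root //; exact: test_root. Qed.

(** The inverse of multiplication by [root] on test functions. *)
Definition unroot eta x : R := eta x * (root x)^-1.

Lemma test_unroot eta : test_function U eta -> test_function U (unroot eta).
Proof. by move=> te; exact: (testM oU te smooth_rootV). Qed.

Lemma unrootK eta : test_function U eta -> (fun x => root x * unroot eta x) = eta.
Proof.
move=> te; apply/funext => x; have [Ux|nUx] := pselect (U x).
  by rewrite /unroot mulrCA divff ?mulr1 // gt_eqF // root_gt0.
by rewrite /unroot (test_out te) // mul0r mulr0.
Qed.

(** Through the ground-state identity the energy of eta is the weighted
    Dirichlet integral of eta / [root], although V may be negative. *)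
Lemma energy_ge0 eta : test_function U eta -> 0 <= energy U (witten_potential f) eta.
Proof.
move=> te; rewrite -(unrootK te) energy_root; last exact: test_unroot.
by apply: intg_ge0 => x Ux; rewrite mulr_ge0 ?dotrV_ge0 // ltW // f0.
Qed.

End ground_state.

(** * Cauchy-Schwarz against the solution *)

Section duality.
Context {R : realType} {N : nat} (U : set 'rV[R]_N) (oU : open U) (bU : bounded_set U).
Context (f : 'rV[R]_N -> R) (sf : smooth_on U f) (f0 : forall x, U x -> 0 < f x).
Implicit Types (eta zeta th : 'rV[R]_N -> R).
Local Notation I := (intg U).
Local Notation leb := (lebesgue_rV (n := N)).
Local Notation sq G := (dotrV G G).
Local Notation sqint := (square_integrable U leb).
Local Notation E := (energy U (witten_potential f)).
Local Notation g := (root f).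

Let mU : measurable U := open_rV_measurable oU.

Lemma intg_young (h k : 'rV[R]_N -> R) (s : R) : 0 < s -> sqint h -> sqint k ->
  I (fun x => h x * k x) <=
  s / 2 * I (fun x => k x ^+ 2) + (2 * s)^-1 * I (fun x => h x ^+ 2).
Proof.
move=> s0 sh sk; have i1 := sqint_integrable sh; have i2 := sqint_integrable sk.
have j1 := integrable_onZ mU (2 * s)^-1 i1; have j2 := integrable_onZ mU (s / 2) i2.
rewrite -(intgZ mU _ i1) -(intgZ mU _ i2) -(intgD mU j2 j1).
apply: (intg_le mU (sqintM_integrable mU sh sk) (integrable_onD mU j2 j1)) => x _.
have := mulr_ge0 (ltW (divr_gt0 s0 (ltr0n _ 2))) (sqr_ge0 (k x - s^-1 * h x)).
have -> : s / 2 * (k x - s^-1 * h x) ^+ 2 =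
  s / 2 * k x ^+ 2 + (2 * s)^-1 * h x ^+ 2 - h x * k x by field; rewrite gt_eqF.
by rewrite subr_ge0.
Qed.

(** Cauchy-Schwarz for a nonnegative form, from the energy of t eta - th. The
    weighted form with a free parameter t passes to limits and covers vanishing
    energies. *)
Lemma witten_form_young eta th (t : R) : 0 < t -> test_function U eta -> test_function U th ->
  I (witten_form f eta th) <= t / 2 * E eta + (2 * t)^-1 * E th.
Proof.
move=> t0 te tt.
have tte := testZ t oU te; have tc := testB oU tte tt.
have := energy_ge0 oU bU sf f0 tc.
have iee := integrable_witten_form oU bU sf f0 te te.
have iet := integrable_witten_form oU bU sf f0 te tt.
have itt := integrable_witten_form oU bU sf f0 tt tt.
have -> : E (fun x => t * eta x - th x) =
    I (fun x => t ^+ 2 * witten_form f eta eta x +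
      (- (2 * t)) * witten_form f eta th x + witten_form f th th x).
  apply: intg_eq => x _; rewrite /witten_form.
  have -> : grad (fun y => t * eta y - th y) x = t *: grad eta x - grad th x.
    have dte := test_pderivable te (x := x).
    rewrite (gradB (g := fun y => t * eta y) (h := th)).
    - rewrite (gradM (pderivable_cst t x) dte).
      have -> : grad (fun=> t) x = 0 by apply/rowP => i; rewrite !mxE partial_cst.
      by rewrite scaler0 addr0.
    - exact: test_pderivable tte.
    - exact: test_pderivable tt.
  by rewrite !dotrVE (dotrVC (grad th x) (grad eta x)); ring.
have j1 := integrable_onZ mU (t ^+ 2) iee; have j2 := integrable_onZ mU (- (2 * t)) iet.
rewrite (intgD mU (integrable_onD mU j1 j2) itt) (intgD mU j1 j2).
rewrite (intgZ mU _ iee) (intgZ mU _ iet) -(energyE f te) -(energyE f tt).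
move: (E eta) (E th) (I _) => x y z h.
rewrite -(ler_pM2l (_ : 0 < 2 * t)) ?mulr_gt0 //.
have -> : 2 * t * (t / 2 * x + (2 * t)^-1 * y) = t ^+ 2 * x + y.
  by field; rewrite gt_eqF.
by move: h; lra.
Qed.

Context (v w : 'rV[R]_N -> R) (sv : sqint v) (sw : sqint w).
Context (weq : forall eta, test_function U eta ->
  I (fun x => v x * witten f eta x) = I (fun x => w x * eta x)).
Local Notation A := (I (fun x => w x * v x)).
Context (approx : forall ep, 0 < ep -> exists eta, [/\ test_function U eta,
    I (fun x => (v x - eta x) ^+ 2) <= ep & E eta <= A + ep]).

Lemma pairing_ge0 : 0 <= A.
Proof.
apply/ler_addgt0Pr => e /approx[eta [te _ h]].
exact: le_trans (energy_ge0 oU bU sf f0 te) h.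
Qed.

Lemma small_scale (C e : R) : 0 <= C -> 0 < e -> exists s, [/\ 0 < s, s <= 1 & s * C <= e].
Proof.
move=> C0 e0; have C10 : 0 < C + 1 by rewrite ltr_wpDl.
exists (Num.min 1 (e / (C + 1))).
have s0 : 0 < Num.min 1 (e / (C + 1)) by rewrite lt_min ltr01 divr_gt0.
split=> //; first by rewrite ge_min lexx.
apply: (@le_trans _ _ (Num.min 1 (e / (C + 1)) * (C + 1))).
  by rewrite ler_pM2l // lerDl.
by rewrite -ler_pdivlMr // ge_min lexx orbT.
Qed.

(** Cauchy-Schwarz between v and eta, with A in place of the energy of v. The
    integral of w eta is that of v H eta, hence the limit of the forms at th and
    eta as th runs through the approximants of v, whose energies are
    asymptotically at most A. *)
Lemma dual_young eta (t : R) : 0 < t -> test_function U eta ->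
  I (fun x => w x * eta x) <= t / 2 * A + (2 * t)^-1 * E eta.
Proof.
move=> t0 te; apply/ler_addgt0Pr => e e0.
have tH := test_witten oU sf f0 te; have sH := sqint_test oU bU tH.
set HH := I (fun x => witten f eta x ^+ 2).
have HH0 : 0 <= HH by apply: intg_ge0 => x _; exact: sqr_ge0.
have C0 : 0 <= t / 2 + HH / 2 + 1 / 2 by rewrite !addr_ge0 ?divr_ge0 // ltW.
have [s [s0 s1 sC]] := small_scale C0 e0.
have s20 : 0 < s ^+ 2 by rewrite exprn_gt0.
have [th [tt vt Et]] := approx s20.
have st := sqint_test oU bU tt.
rewrite -(weq te).
have i1 := sqintM_integrable mU (sqintB mU sv st) sH.
have i2 := sqintM_integrable mU st sH.
rewrite (@intg_eq _ _ _ _ (fun x => (v x - th x) * witten f eta x + th x * witten f eta x));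
  last by move=> x _; ring.
rewrite (intgD mU i1 i2) -(intg_witten_form oU bU sf f0 tt te).
have h1 := intg_young s0 (sqintB mU sv st) sH; rewrite -/HH in h1.
have h2 := witten_form_young t0 tt te.
have h3 : (2 * s)^-1 * I (fun x => (v x - th x) ^+ 2) <= s / 2.
  rewrite mulrC ler_pdivrMr ?mulr_gt0 //.
  by have -> : s / 2 * (2 * s) = s ^+ 2 by field.
have h4 : t / 2 * E th <= t / 2 * (A + s ^+ 2) by rewrite ler_pM2l // divr_gt0.
have h5 : t / 2 * s ^+ 2 <= t / 2 * s.
  by rewrite ler_pM2l ?divr_gt0 // expr2 ger_pMr.
have {sC} : t / 2 * s + s / 2 * HH + s / 2 <= e.
  by have -> : t / 2 * s + s / 2 * HH + s / 2 = s * (t / 2 + HH / 2 + 1 / 2) by ring.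
move: h1 h2 h3 h4 h5; rewrite (mulrDr (t / 2)); clear vt Et HH0 C0.
move: (s / 2 * HH) (t / 2 * A) ((2 * s)^-1 * _) (t / 2 * E th) ((2 * t)^-1 * _).
move: (intg U _) (intg U _) => *; lra.
Qed.

Lemma young_sqrt (x a : R) : 0 <= a -> (forall t, 0 < t -> x <= t / 2 * a + (2 * t)^-1) ->
  x <= Num.sqrt a.
Proof.
move=> a0 h; apply/ler_addgt0Pr => e e0.
have r0 := sqrtr_ge0 a; have re0 : 0 < Num.sqrt a + e by rewrite ltr_wpDl.
(* The optimal t is 1 / sqrt a; e covers the case a = 0. *)
apply: le_trans (h (Num.sqrt a + e)^-1 _) _; first by rewrite invr_gt0.
have -> : (2 * (Num.sqrt a + e)^-1)^-1 = (Num.sqrt a + e) / 2.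
  by field; rewrite gt_eqF.
have : (Num.sqrt a + e)^-1 / 2 * a <= Num.sqrt a / 2.
  rewrite mulrAC ler_pM2r ?invr_gt0 // mulrC ler_pdivrMr // mulrDr -expr2 sqr_sqrtr //.
  by rewrite lerDl mulr_ge0 // ltW.
lra.
Qed.

(** A competitor is a limit of test functions in the weighted norm, so the
    bound of [dual_young] extends to it with energy 1. *)
Lemma competitor_le (phi : 'rV[R]_N -> R) (F : 'rV[R]_N -> 'rV[R]_N) :
  sqint phi -> sqintV U F -> I (fun x => sq (F x)) = 1 ->
  (forall e, 0 < e -> exists zeta, [/\ test_function U zeta,
     I (fun x => (phi x - g x * zeta x) ^+ 2) <= e &
     I (fun x => sq (F x - g x *: grad zeta x)) <= e]) ->
  I (fun x => w x * phi x) <= Num.sqrt A.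
Proof.
move=> sp sF F1 ap; apply: young_sqrt; first exact: pairing_ge0.
move=> t t0; apply/ler_addgt0Pr => e e0.
set W := I (fun x => w x ^+ 2); have W0 : 0 <= W by apply: intg_ge0 => x _; exact: sqr_ge0.
have ti0 : 0 <= (2 * t)^-1 by rewrite invr_ge0 mulr_ge0 // ltW.
have C0 : 0 <= (2 * t)^-1 * 3 + W / 2 + 1 / 2 by rewrite !addr_ge0 ?mulr_ge0 ?divr_ge0.
have [s [s0 s1 sC]] := small_scale C0 e0.
have s20 : 0 < s ^+ 2 by rewrite exprn_gt0.
have [zeta [tz pz Fz]] := ap _ s20.
have tg := test_root oU sf f0 tz; have sg := sqint_test oU bU tg.
have spz := sqintB mU sp sg.
have i1 := sqintM_integrable mU sw sg; have i2 := sqintM_integrable mU spz sw.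
rewrite (@intg_eq _ _ _ _ (fun x => w x * (g x * zeta x) + (phi x - g x * zeta x) * w x));
  last by move=> x _; ring.
rewrite (intgD mU i1 i2).
have h1 := dual_young t0 tg.
have h2 := intg_young s0 spz sw; rewrite -/W in h2.
have h3 : (2 * s)^-1 * I (fun x => (phi x - g x * zeta x) ^+ 2) <= s / 2.
  rewrite mulrC ler_pdivrMr ?mulr_gt0 //.
  by have -> : s / 2 * (2 * s) = s ^+ 2 by field.
have sgz : sqintV U (fun x => g x *: grad zeta x).
  move=> i; under eq_fun do rewrite !mxE.
  apply: bounded_mfun_sqint => //; apply: test_bounded_mfun => //.
  exact: (test_root oU sf f0 (test_partial i oU tz)).
have h4 : E (fun x => g x * zeta x) <= 1 + 3 * s.
  rewrite (energy_root oU bU sf f0 tz).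
  have iF := integrable_dot oU sF sF.
  have iD := integrable_dot oU (sqintVB oU sF sgz) (sqintVB oU sF sgz).
  have j1 := integrable_onZ mU (1 + s) iF; have j2 := integrable_onZ mU (1 + s^-1) iD.
  apply: (@le_trans _ _ ((1 + s) * I (fun x => sq (F x)) +
     (1 + s^-1) * I (fun x => sq (F x - g x *: grad zeta x)))).
    rewrite -(intgZ mU _ iF) -(intgZ mU _ iD) -(intgD mU j1 j2).
    apply: (intg_le mU _ (integrable_onD mU j1 j2)) => [|x Ux].
      apply: (integrable_on_eq mU _ (integrable_dot oU sgz sgz)) => x Ux.
      by rewrite !(dotrVZl, dotrVZr) mulrA (root_sq f0 Ux).
    have -> : f x * sq (grad zeta x) = sq (F x - (F x - g x *: grad zeta x)).
      have -> : F x - (F x - g x *: grad zeta x) = g x *: grad zeta x.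
        by apply/rowP => i; rewrite !mxE; ring.
      by rewrite !(dotrVZl, dotrVZr) mulrA (root_sq f0 Ux).
    move: (F x) (F x - g x *: grad zeta x) => y z.
    have := mulr_ge0 (ltW s0) (dotrV_ge0 (y + s^-1 *: z)).
    rewrite !dotrVE (dotrVC z y).
    have -> : s * (sq y + s^-1 * dotrV y z + (s^-1 * dotrV y z + s^-1 * (s^-1 * sq z))) =
      s * sq y + 2 * dotrV y z + s^-1 * sq z by field; rewrite gt_eqF.
    move: (s^-1) => si; rewrite !mulrDl; move: (si * _) => q; lra.
  rewrite F1 mulr1.
  have si0 : 0 <= 1 + s^-1 by rewrite addr_ge0 // invr_ge0 ltW.
  have := ler_wpM2l si0 Fz.
  have -> : (1 + s^-1) * s ^+ 2 = s ^+ 2 + s by field; rewrite gt_eqF.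
  have : s ^+ 2 <= s by rewrite expr2 ger_pMr.
  by move: (_ * I _) => q; lra.
have h5 : (2 * t)^-1 * E (fun x => g x * zeta x) <= (2 * t)^-1 + (2 * t)^-1 * 3 * s.
  apply: le_trans (ler_wpM2l ti0 h4) _; rewrite mulrDr mulr1 mulrA //.
have {sC} : (2 * t)^-1 * 3 * s + s / 2 * W + s / 2 <= e.
  have -> : (2 * t)^-1 * 3 * s + s / 2 * W + s / 2 =
    s * ((2 * t)^-1 * 3 + W / 2 + 1 / 2) by ring.
  by [].
move: h1 h2 h3 h5; clear pz Fz F1 h4 C0 W0.
move: (s / 2 * W) (t / 2 * A) ((2 * s)^-1 * _) ((2 * t)^-1 * E _).
move: ((2 * t)^-1 * 3 * s) ((2 * t)^-1) (intg U _) (intg U _) => *; lra.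
Qed.

End duality.

(** * Functions with positive integral *)

Section positivity.
Context {R : realType} {N : nat} (U : set 'rV[R]_N) (oU : open U) (bU : bounded_set U).
Local Notation leb := (lebesgue_rV (n := N)).

Let mU : measurable U := open_rV_measurable oU.

Lemma open_cube (x : 'rV[R]_N) (W : set 'rV[R]_N) : open W -> W x ->
  exists2 r, 0 < r & forall y : 'rV[R]_N,
    (forall i, y ord0 i \in `[x ord0 i - r, x ord0 i + r]) -> W y.
Proof.
move=> oW Wx; have /nbhs_ballP[e /= e0 eW] : nbhs x W by exact: open_nbhs_nbhs.
exists (e / 2); first by rewrite divr_gt0.
move=> y hy; apply: eW; split=> // i j; rewrite ord1 /ball /= distrC.
have := hy j; rewrite in_itv /= -ler_distl => h; apply: le_lt_trans h _.
by rewrite ltr_pdivrMr // ltr_pMr // ltr1n.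
Qed.

Lemma intg_gt0 (h : 'rV[R]_N -> R) x0 : (forall x, U x -> 0 <= h x) ->
  integrable_on U h -> U x0 -> {for x0, continuous h} -> 0 < h x0 -> 0 < intg U h.
Proof.
move=> h0 ih Ux0 ch hx0.
have : nbhs x0 (U `&` [set x | h x0 / 2 < h x]).
  apply: filterI; first exact: open_nbhs_nbhs.
  by apply: (cvgr_gt (h x0) ch); rewrite ltr_pdivrMr // ltr_pMr // ltr1n.
rewrite nbhsE => -[W [oW Wx0] WU].
have [r r0 hr] := open_cube oW Wx0.
pose B : set 'rV[R]_N := [set y | forall i, `[x0 ord0 i - r, x0 ord0 i + r]%classic (y ord0 i)].
have BW y : B y -> W y by move=> By; apply: hr => i; exact: By.
have mB : measurable B.
  apply: (@measurable_box _ _ (fun i => `[x0 ord0 i - r, x0 ord0 i + r]%classic)) => i.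
  exact: measurable_itv.
have mh := integrable_on_measurable ih.
have BU : B `<=` U by move=> y /BW /WU[].
have lB : leb B = ((r + r) ^+ N)%:E.
  rewrite (@lebesgue_rV_box _ _ (fun i => `[x0 ord0 i - r, x0 ord0 i + r]%classic)); last first.
    by move=> i; exact: measurable_itv.
  rewrite (eq_bigr (fun=> (r + r)%:E)) => [|i _].
    by rewrite -[in RHS](card_ord N) -prodr_const prodEFin.
  rewrite lebesgue_measure_itv /= lte_fin ifT; last by rewrite ltrD2l gtrN.
  by rewrite -EFinB; congr EFin; ring.
rewrite -lte_fin -intgE //.
apply: (@lt_le_trans _ _ (\int[leb]_(x in B) (h x0 / 2)%:E)%E).
  rewrite integral_cst //= [X in (_ * X)%E](lB : leb B = _) -EFinM lte_fin mulr_gt0 ?divr_gt0 //.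
  by rewrite exprn_gt0 // addr_gt0.
apply: (@le_trans _ _ (\int[leb]_(x in B) (h x)%:E)%E).
  apply: ge0_le_integral => //.
  - by move=> x _; rewrite lee_fin divr_ge0 // ltW.
  - by apply/measurable_EFinP; exact: measurable_funS mh.
  - by move=> x /BW /WU[_ /ltW]; rewrite lee_fin.
apply: ge0_subset_integral => //; first exact/measurable_EFinP.
Qed.

End positivity.

(** * From the weighted measure to Lebesgue measure *)

Section weighted.
Context {R : realType} {N : nat} (U : set 'rV[R]_N) (oU : open U) (bU : bounded_set U).
Context (mu : {measure set 'rV[R]_N -> \bar R}).
Context (f : 'rV[R]_N -> R) (sf : smooth_on U f) (f0 : forall x, U x -> 0 < f x).
Context (muf : has_density U mu f).
Implicit Types (eta zeta th phi : 'rV[R]_N -> R).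
Local Notation I := (intg U).
Local Notation leb := (lebesgue_rV (n := N)).
Local Notation sq G := (dotrV G G).
Local Notation sqint := (square_integrable U leb).
Local Notation g := (root f).

Let mU : measurable U := open_rV_measurable oU.

Let mf : measurable_fun U f.
Proof. by apply: continuous_rV_measurable => // x Ux; exact: smooth_on_continuous sf Ux. Qed.

Lemma measurable_root : measurable_fun U g.
Proof.
apply: continuous_rV_measurable => // x Ux.
exact: (smooth_on_continuous (smooth_root oU sf f0) Ux).
Qed.

Lemma integral_weighted (h k : 'rV[R]_N -> R) : measurable_fun U h ->
  (forall x, U x -> h x * f x = k x) ->
  (\int[mu]_(x in U) (h x)%:E = \int[leb]_(x in U) (k x)%:E)%E.
Proof.
move=> mh hk.
have mEh : measurable_fun U (EFin \o h) by exact/measurable_EFinP.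
have f0' x : U x -> 0 <= f x by move=> Ux; rewrite ltW // f0.
rewrite (integral_density mU mf f0' muf mEh).
by apply: eq_integral => x; rewrite inE => Ux; rewrite -EFinM hk.
Qed.

Lemma integral_weighted_sq phi : measurable_fun U phi ->
  (\int[mu]_(x in U) (phi x ^+ 2)%:E = \int[leb]_(x in U) ((g x * phi x) ^+ 2)%:E)%E.
Proof.
move=> mp; apply: integral_weighted; first exact: measurable_funX.
by move=> x Ux; rewrite exprMn [g x ^+ 2]expr2 (root_sq f0 Ux) mulrC.
Qed.

Lemma square_integrable_root phi : square_integrable U mu phi ->
  sqint (fun x => g x * phi x).
Proof.
move=> [mp pf]; split; first by apply: measurable_funM => //; exact: measurable_root.
by rewrite -integral_weighted_sq.
Qed.

Lemma root_square_integrable phi : measurable_fun U phi ->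
  sqint (fun x => g x * phi x) -> square_integrable U mu phi.
Proof. by move=> mp [_ pf]; split => //; rewrite integral_weighted_sq. Qed.

Lemma test_square_integrable zeta : test_function U zeta -> square_integrable U mu zeta.
Proof.
move=> tz; apply: root_square_integrable; first by have [] := test_bounded_mfun oU tz.
by apply: (sqint_test oU bU); exact: test_root.
Qed.

Lemma test_weak_gradient zeta : test_function U zeta -> weak_gradient U zeta (grad zeta).
Proof.
move=> tz eta te i.
have b1 := test_bounded_mfun oU tz; have b2 := test_bounded_mfun oU te.
have b3 := test_bounded_mfun oU (test_partial i oU tz).
have b4 := test_bounded_mfun oU (test_partial i oU te).
have i1 := bounded_mfun_integrable oU bU (bounded_mfunM b1 b4).
have i2 := bounded_mfun_integrable oU bU (bounded_mfunM b3 b2).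
have -> : (\int[leb]_(x in U) (grad zeta x ord0 i * eta x)%:E =
   \int[leb]_(x in U) (partial i zeta x * eta x)%:E)%E.
  by apply: eq_integral => x _; rewrite mxE.
rewrite (intgE mU i1) (intgE mU i2) -EFinN; congr EFin.
apply/eqP; rewrite -subr_eq0 opprK -(intgD mU i1 i2); apply/eqP.
have tp : test_function U (fun x => zeta x * eta x).
  exact: (testM oU tz (test_smooth_on te)).
rewrite -[RHS](intg_partial_test oU i tp).
apply: intg_eq => x _.
rewrite (partialM i (test_pderivable tz (x := x)) (test_pderivable te (x := x))).
by rewrite [partial i zeta x * _]mulrC.
Qed.

Lemma test_H10 zeta : test_function U zeta -> H10 U mu zeta (grad zeta).
Proof.
move=> tz; split.
- exact: test_square_integrable.
- move=> i; under eq_fun do rewrite mxE.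
  by apply: test_square_integrable; exact: test_partial.
- exact: test_weak_gradient.
exists (fun=> zeta); split=> //.
  rewrite (_ : (fun=> _) = cst 0%E); first exact: cvg_cst.
  apply/funext => k; apply: integral0_eq => x _.
  by rewrite subrr expr2 mulr0.
rewrite (_ : (fun=> _) = cst 0%E); first exact: cvg_cst.
apply/funext => k; apply: integral0_eq => x _; congr EFin.
by rewrite subrr /dotrV big1 // => i _; rewrite mxE mulr0.
Qed.

Lemma cvge0_fine_le (u : nat -> \bar R) : u k @[k --> \oo] --> 0%E ->
  forall e : R, 0 < e -> exists K, forall k, (K <= k)%N -> fine (u k) <= e.
Proof.
move=> /fine_cvgP[_ /cvgrPdist_le cu] e /cu [K _ hK].
exists K => k Kk; have := hK k Kk; rewrite sub0r normrN.
exact: le_trans (ler_norm _).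
Qed.

Lemma test_energy_root zeta : test_function U zeta ->
  dotH1_sqnorm U mu (grad zeta) =
  (energy U (witten_potential f) (fun x => g x * zeta x))%:E.
Proof.
move=> tz; have tsq := test_dot_grad oU tz (test_smooth_on (W := U) tz).
have tf := testM oU tsq sf.
rewrite (energy_root oU bU sf f0 tz) /dotH1_sqnorm.
rewrite (@integral_weighted _ (fun x => sq (grad zeta x) * f x)) //.
  rewrite (intgE mU (bounded_mfun_integrable oU bU (test_bounded_mfun oU tf))); congr EFin.
  by apply: intg_eq => x _; rewrite mulrC.
by have [] := test_bounded_mfun oU tsq.
Qed.

Context (N0 : (0 < N)%N) (Une : U !=set0).

(** There is at least one normalised competitor, so the supremum defining the
    dual norm is not that of the empty set. *)
Lemma exists_energy_gt0 : exists2 zeta, test_function U zeta &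
  0 < energy U (witten_potential f) (fun x => g x * zeta x).
Proof.
have [c Uc] := Une; have [r r0 hr] := open_cube oU Uc.
have tb : test_function U (bump c r) by apply: bump_test => //; exact: ltW.
exists (bump c r) => //; rewrite (energy_root oU bU sf f0 tb).
pose i : 'I_N := Ordinal N0.
have tsq := test_dot_grad oU tb (test_smooth_on (W := U) tb).
have tf := testM oU tsq sf.
set x0 := c + (r / 2) *: delta_mx ord0 i.
have Ux0 : U x0.
  apply: hr => j; rewrite !mxE eqxx /= in_itv /= -ler_distl.
  rewrite [c ord0 j + _]addrC addrK.
  have [_|_] := eqVneq j i; last by rewrite mulr0 normr0 ltW.
  by rewrite mulr1 gtr0_norm ?divr_gt0 // ler_pdivrMr // ler_pMr // ler1n.
have -> : I (fun x => f x * sq (grad (bump c r) x)) =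
   I (fun x => sq (grad (bump c r) x) * f x) by apply: intg_eq => x _; rewrite mulrC.
apply: (intg_gt0 oU (x0 := x0)) => //.
- by move=> x Ux; rewrite mulr_ge0 ?dotrV_ge0 // ltW // f0.
- by apply: (bounded_mfun_integrable oU bU); exact: test_bounded_mfun.
- exact: (test_continuous tf).
rewrite mulr_gt0 ?f0 //.
have p0 : partial i (bump c r) x0 != 0.
  rewrite partial_bump mulf_neq0 ?oppr_eq0 ?gt_eqF //.
  have q0 : 0 < r ^+ 2 - (r / 2) ^+ 2.
    have -> : r ^+ 2 - (r / 2) ^+ 2 = 3 / 4 * r ^+ 2 by field.
    by rewrite mulr_gt0 ?divr_gt0 // exprn_gt0.
  by rewrite /flat_exp q0 mulr_gt0 ?expR_gt0 // exprn_gt0 // invr_gt0.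
rewrite /dotrV (bigD1 i) //= ltr_wpDr //.
  by apply: sumr_ge0 => j _; rewrite -expr2 sqr_ge0.
by rewrite !mxE -expr2 exprn_even_gt0.
Qed.

End weighted.

(** * The dual norm *)

Section dual_norm.
Context {R : realType} {N : nat} (U : set 'rV[R]_N) (oU : open U) (bU : bounded_set U).
Context (mu : {measure set 'rV[R]_N -> \bar R}).
Context (f : 'rV[R]_N -> R) (sf : smooth_on U f) (f0 : forall x, U x -> 0 < f x).
Context (muf : has_density U mu f).
Implicit Types (eta zeta th phi : 'rV[R]_N -> R).
Local Notation I := (intg U).
Local Notation leb := (lebesgue_rV (n := N)).
Local Notation sq G := (dotrV G G).
Local Notation sqint := (square_integrable U leb).
Local Notation E := (energy U (witten_potential f)).
Local Notation g := (root f).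

Let mU : measurable U := open_rV_measurable oU.

Lemma energyZ (c : R) eta : test_function U eta -> E (fun x => c * eta x) = c ^+ 2 * E eta.
Proof.
move=> te; rewrite (energyE f te) (energyE f (testZ c oU te)).
rewrite -(intgZ mU _ (integrable_witten_form oU bU sf f0 te te)).
apply: intg_eq => x _; rewrite /witten_form.
have dte := test_pderivable te (x := x).
rewrite (gradM (pderivable_cst c x) dte).
have -> : grad (fun=> c) x = 0 by apply/rowP => i; rewrite !mxE partial_cst.
by rewrite scaler0 addr0 !(dotrVZl, dotrVZr); ring.
Qed.

Context (u : 'rV[R]_N -> R) (su : square_integrable U mu u).
Local Notation w := (fun x => g x * u x).

Let sw : sqint w := square_integrable_root oU sf f0 muf su.

Lemma dual_pairing phi : square_integrable U mu phi ->
  (\int[mu]_(x in U) (u x * phi x)%:E = (I (fun x => w x * (g x * phi x)))%:E)%E.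
Proof.
move=> sp; have sgp := square_integrable_root oU sf f0 muf sp.
rewrite -(intgE mU (sqintM_integrable mU sw sgp)).
apply: (integral_weighted oU sf f0 muf).
  by apply: measurable_funM; [case: su|case: sp].
by move=> x Ux; rewrite -(root_sq f0 Ux); ring.
Qed.

Lemma dual_norm_ge zeta : test_function U zeta ->
  0 < E (fun x => g x * zeta x) ->
  ((I (fun x => w x * (g x * zeta x)) / Num.sqrt (E (fun x => g x * zeta x)))%:E
    <= dotHm1_norm U mu u)%E.
Proof.
move=> tz; set q := E _ => q0.
have r0 : 0 < Num.sqrt q by rewrite sqrtr_gt0.
have tc := testZ (Num.sqrt q)^-1 oU tz.
apply: ereal_sup_ubound; exists (fun x => (Num.sqrt q)^-1 * zeta x).
exists (grad (fun x => (Num.sqrt q)^-1 * zeta x)).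
split.
- exact: (test_H10 oU bU sf f0 muf tc).
- rewrite (test_energy_root oU bU sf f0 muf tc).
  have -> : (fun x => g x * ((Num.sqrt q)^-1 * zeta x)) =
      (fun x => (Num.sqrt q)^-1 * (g x * zeta x)) by apply/funext => x; ring.
  rewrite (energyZ _ (test_root oU sf f0 tz)) -/q exprVn sqr_sqrtr ?ltW //.
  by rewrite mulVf // gt_eqF.
rewrite (dual_pairing (test_square_integrable oU bU sf f0 muf tc)); congr EFin.
have sgz := sqint_test oU bU (test_root oU sf f0 tz).
rewrite mulrC -(intgZ mU _ (sqintM_integrable mU sw sgz)).
by apply: intg_eq => x _; ring.
Qed.

Context (v : 'rV[R]_N -> R) (sv : sqint v).
Context (weq : forall eta, test_function U eta ->
  I (fun x => v x * witten f eta x) = I (fun x => w x * eta x)).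
Local Notation A := (I (fun x => w x * v x)).
Context (approx : forall ep, 0 < ep -> exists eta, [/\ test_function U eta,
    I (fun x => (v x - eta x) ^+ 2) <= ep & E eta <= A + ep]).

Lemma measurable_sq (F : 'rV[R]_N -> 'rV[R]_N) :
  (forall i, measurable_fun U (fun x => F x ord0 i)) -> measurable_fun U (fun x => sq (F x)).
Proof. by move=> mF; apply: measurable_sum => i; exact: measurable_funM. Qed.

Lemma dual_norm_le : (dotHm1_norm U mu u <= (Num.sqrt A)%:E)%E.
Proof.
apply: ge_ereal_sup => _ [phi [G [[sp sG _ [eta [te c1 c2]]] G1 ->]]].
rewrite (dual_pairing sp) lee_fin.
have sgp := square_integrable_root oU sf f0 muf sp.
have sgG : sqintV U (fun x => g x *: G x).
  move=> i; under eq_fun do rewrite mxE.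
  exact: (square_integrable_root oU sf f0 muf (sG i)).
have mG i : measurable_fun U (fun x => G x ord0 i) by case: (sG i).
apply: (competitor_le oU bU sf f0 sv sw weq approx sgp sgG).
  have := G1; rewrite /dotH1_sqnorm.
  rewrite (integral_weighted oU sf f0 muf (k := fun x => sq (g x *: G x))).
  - by move=> h; rewrite /intg /Rintegral h.
  - exact: measurable_sq.
  - by move=> x Ux; rewrite !(dotrVZl, dotrVZr) mulrA (root_sq f0 Ux) mulrC.
move=> e e0; have [K1 h1] := cvge0_fine_le c1 e0; have [K2 h2] := cvge0_fine_le c2 e0.
have {}h1 := h1 _ (leq_maxl K1 K2); have {}h2 := h2 _ (leq_maxr K1 K2).
move: (maxn K1 K2) h1 h2 => k h1 h2.
have tk := te k; exists (eta k); split=> //.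
- have mz : measurable_fun U (fun x => phi x - eta k x).
    by apply: measurable_funB; [case: sp|case: (test_bounded_mfun oU tk)].
  move: h1; rewrite (integral_weighted_sq oU sf f0 muf mz); apply: le_trans.
  rewrite -/(Rintegral _ _ _) -/(I _) le_eqVlt; apply/orP; left; apply/eqP.
  by apply: intg_eq => x _; rewrite mulrBr.
- move: h2.
  rewrite (integral_weighted oU sf f0 muf (k := fun x => sq (g x *: G x - g x *: grad (eta k) x))).
  - exact.
  - apply: measurable_sq => i; under eq_fun do rewrite !mxE.
    apply: measurable_funB => //.
    by case: (test_bounded_mfun oU (test_partial i oU tk)).
  - by move=> x Ux; rewrite -scalerBr !(dotrVZl, dotrVZr) mulrA (root_sq f0 Ux) mulrC.
Qed.

Context (N0 : (0 < N)%N) (Une : U !=set0).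

(** Opposite competitors have opposite pairings with u. *)
Lemma dual_norm_ge0 : (0 <= dotHm1_norm U mu u)%E.
Proof.
have [zeta tz q0] := exists_energy_gt0 oU bU sf f0 N0 Une.
have tn := testZ (-1) oU tz.
have En : E (fun x => g x * (-1 * zeta x)) = E (fun x => g x * zeta x).
  have -> : (fun x => g x * (-1 * zeta x)) = (fun x => -1 * (g x * zeta x)).
    by apply/funext => x; ring.
  by rewrite (energyZ _ (test_root oU sf f0 tz)) sqrrN expr1n mul1r.
have qn0 : 0 < E (fun x => g x * (-1 * zeta x)) by rewrite En.
have sgz := sqint_test oU bU (test_root oU sf f0 tz).
have h1 := dual_norm_ge tz q0; have h2 := dual_norm_ge tn qn0.
have In : I (fun x => w x * (g x * (-1 * zeta x))) = - I (fun x => w x * (g x * zeta x)).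
  rewrite -[RHS]mulN1r -(intgZ mU _ (sqintM_integrable mU sw sgz)).
  by apply: intg_eq => x _; ring.
have [h|h] := leP 0 (I (fun x => w x * (g x * zeta x))).
  by apply: le_trans h1; rewrite lee_fin divr_ge0 // sqrtr_ge0.
apply: le_trans h2; rewrite lee_fin In divr_ge0 ?sqrtr_ge0 // oppr_ge0 ltW //.
Qed.

(** It remains to bound the supremum S from below. Since S >= 0, every test
    function satisfies: integral of w eta <= S sqrt (E eta). Along approximants
    of v the left side tends to A and the energy is asymptotically at most A,
    whence A <= S sqrt A. *)
Lemma dual_normE : dotHm1_norm U mu u = (Num.sqrt A)%:E.
Proof.
have s0 := dual_norm_ge0; have sA := dual_norm_le; have ge := dual_norm_ge.
have A0 := pairing_ge0 oU bU sf f0 approx.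
case: (dotHm1_norm U mu u) s0 sA ge => [S S0 SA ge|//|//].
apply/eqP; rewrite eq_le SA /= lee_fin; rewrite !lee_fin in S0 SA.
have bound eta : test_function U eta -> I (fun x => w x * eta x) <= S * Num.sqrt (E eta).
  move=> te; have [q0|q0] := leP (E eta) 0.
    (* Such an eta cannot be normalised; [dual_young] with small t bounds its
       pairing with w by 0. *)
    rewrite (ler0_sqrtr q0) mulr0; apply/ler_addgt0Pr => e e0.
    have [s [sp _ sC]] := small_scale (divr_ge0 A0 (ler0n _ 2)) e0.
    apply: le_trans (dual_young oU bU sf f0 sv weq approx sp te) _.
    have : (2 * s)^-1 * E eta <= 0.
      by rewrite mulr_ge0_le0 // invr_ge0 mulr_ge0 // ltW.
    move: sC; have -> : s / 2 * A = s * (A / 2) by ring.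
    by move: (s * _) ((2 * s)^-1 * _) => y z; rewrite add0r => h1 h2; lra.
  have := ge _ (test_unroot oU sf f0 te); rewrite (unrootK f0 te) => /(_ q0).
  rewrite lee_fin ler_pdivrMr ?sqrtr_gt0 //.
  have -> : (fun x => g x * u x * (g x * unroot f eta x)) = (fun x => w x * eta x).
    by apply/funext => x; rewrite -[in RHS](unrootK f0 te).
  by [].
have [A00|A00] := leP A 0; first by rewrite (ler0_sqrtr A00).
have r0 : 0 < Num.sqrt A by rewrite sqrtr_gt0.
suff h : A <= S * Num.sqrt A.
  by rewrite -(ler_pM2r r0) -expr2 sqr_sqrtr.
apply/ler_addgt0Pr => e e0.
set W := I (fun x => w x ^+ 2); have W0 : 0 <= W by apply: intg_ge0 => x _; exact: sqr_ge0.
have C0 : 0 <= W / 2 + 1 / 2 + S / (2 * Num.sqrt A).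
  by rewrite !addr_ge0 ?divr_ge0 // mulr_ge0 // ltW.
have [s [sp s1 sC]] := small_scale C0 e0.
have s20 : 0 < s ^+ 2 by rewrite exprn_gt0.
have [eta [te vt Et]] := approx s20.
have st := sqint_test oU bU te; have svt := sqintB mU sv st.
have AE : A = I (fun x => (v x - eta x) * w x) + I (fun x => w x * eta x).
  rewrite -(intgD mU (sqintM_integrable mU svt sw) (sqintM_integrable mU sw st)).
  by apply: intg_eq => x _; ring.
have h1 := intg_young oU sp svt sw; rewrite -/W in h1.
have h2 : (2 * s)^-1 * I (fun x => (v x - eta x) ^+ 2) <= s / 2.
  rewrite mulrC ler_pdivrMr ?mulr_gt0 //.
  by have -> : s / 2 * (2 * s) = s ^+ 2 by field.
have h3 : Num.sqrt (E eta) <= Num.sqrt A + s / (2 * Num.sqrt A).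
  have E0 := energy_ge0 oU bU sf f0 te.
  have EA : E eta <= A + s by apply: le_trans Et _; rewrite lerD2l expr2 ger_pMr.
  have h := sqr_ge0 (Num.sqrt (E eta) - Num.sqrt A).
  rewrite -(ler_pM2l (_ : 0 < 2 * Num.sqrt A)) ?mulr_gt0 //.
  have -> : 2 * Num.sqrt A * (Num.sqrt A + s / (2 * Num.sqrt A)) = 2 * Num.sqrt A ^+ 2 + s.
    by field; rewrite gt_eqF.
  move: h EA; rewrite sqrrB !sqr_sqrtr //; clear vt Et h1 h2 AE C0 W0.
  move: (Num.sqrt (E eta)) (Num.sqrt A) (E eta) (A) => a b y z; rewrite -mulr_natl => h h'.
  lra.
have h4 := ler_wpM2l S0 h3.
have h5 := bound _ te.
apply: (@le_trans _ _ (s / 2 * W + s / 2 + S * (Num.sqrt A + s / (2 * Num.sqrt A)))).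
  rewrite [X in X <= _]AE; apply: lerD; last exact: le_trans h5 h4.
  by apply: le_trans h1 _; rewrite lerD2l.
have -> : s / 2 * W + s / 2 + S * (Num.sqrt A + s / (2 * Num.sqrt A)) =
  S * Num.sqrt A + s * (W / 2 + 1 / 2 + S / (2 * Num.sqrt A)) by field; rewrite gt_eqF.
by rewrite lerD2l.
Qed.

End dual_norm.

(** Once v has a weak gradient, one integration by parts takes the
    distributional equation to the variational one. *)
Lemma dirichlet_weak {R : realType} {N : nat} (U : set 'rV[R]_N) (oU : open U)
    (bU : bounded_set U) (f v w : 'rV[R]_N -> R) (G : 'rV[R]_N -> 'rV[R]_N) :
  smooth_on U f -> (forall x, U x -> 0 < f x) ->
  square_integrable U (lebesgue_rV (n := N)) v -> sqintV U G ->
  weak_gradient U v G ->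
  (forall eta, test_function U eta ->
    intg U (fun x => v x * witten f eta x) = intg U (fun x => w x * eta x)) ->
  forall eta, test_function U eta ->
  intg U (fun x => dotrV (G x) (grad eta x) + witten_potential f x * v x * eta x) =
  intg U (fun x => w x * eta x).
Proof.
move=> sf f0 sv sG wG weq eta te; rewrite -(weq _ te).
have mU := open_rV_measurable oU.
have sV := smooth_potential oU sf f0.
have s1 i := sqint_test oU bU (test_partial i oU te).
have s2 i := sqint_test oU bU (test_partial i oU (test_partial i oU te)).
have sVe := sqint_test oU bU (testM oU te sV).
have sWe := sqint_test oU bU (test_witten oU sf f0 te).
have i1 := integrable_dot oU sG (sqintV_grad oU bU te).
have i2 := sqintM_integrable mU sv sVe; have i3 := sqintM_integrable mU sv sWe.
have j i : integrable_on U (fun x => G x ord0 i * partial i eta x +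
    v x * partial i (partial i eta) x).
  by apply: (integrable_onD mU); exact: sqintM_integrable.
apply/eqP; rewrite -subr_eq0; apply/eqP.
have i12 : integrable_on U (fun x => dotrV (G x) (grad eta x) +
    witten_potential f x * v x * eta x).
  apply: (integrable_onD mU i1); apply: (integrable_on_eq mU _ i2).
  by move=> x _; ring.
rewrite -(intgB mU i12 i3).
rewrite (@intg_eq _ _ _ _ (fun x => \sum_(i < N) (G x ord0 i * partial i eta x +
    v x * partial i (partial i eta) x))); last first.
  move=> x _; rewrite /witten big_split /= /laplacian -mulr_sumr.
  have -> : dotrV (G x) (grad eta x) = \sum_(i < N) G x ord0 i * partial i eta x.
    by apply: eq_bigr => i _; rewrite mxE.
  by ring.
rewrite intg_sum //; apply: big1 => i _.
rewrite (intgD mU (sqintM_integrable mU (sG i) (s1 i)) (sqintM_integrable mU sv (s2 i))).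
have -> : intg U (fun x => v x * partial i (partial i eta) x) =
    - intg U (fun x => G x ord0 i * partial i eta x).
  by rewrite /intg /Rintegral -fineN; congr fine; exact: wG (test_partial i oU te) i.
by rewrite subrr.
Qed.

Theorem proposition3p4 (R : realType) (N : nat) (Omega : set 'rV[R]_N)
    (mu : {measure set 'rV[R]_N -> \bar R}) (f u psi : 'rV[R]_N -> R) :
  (0 < N)%N ->
  Omega !=set0 -> open Omega -> bounded_set Omega -> convex_set Omega ->
  smooth_on Omega f -> (forall x, Omega x -> 0 < f x) ->
  has_density Omega mu f ->
  square_integrable Omega mu u ->
  mu.-integrable Omega (EFin \o u) ->
  (\int[mu]_(x in Omega) (u x)%:E = 0)%E ->
  dirichlet_solution Omega f (tilde f psi) (tilde f u) ->
  (forall x, Omega x -> witten_potential f x =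
     (Num.sqrt (f x))^-1 * laplacian (fun y => Num.sqrt (f y)) x) /\
  0 <= \int[lebesgue_rV (n := N)]_(x in Omega) (tilde f u x * tilde f psi x) /\
  dotHm1_norm Omega mu u =
    (Num.sqrt (\int[lebesgue_rV (n := N)]_(x in Omega)
                 (tilde f u x * tilde f psi x)))%:E.
Proof.
move=> N0 Une oU bU _ sf f0 muf su _ _ [[G [sv sG wG [xi [txi c1 c2]]]] deq].
split; first by move=> x Ux; exact: (witten_potentialE oU sf f0 Ux).
have weq eta : test_function Omega eta ->
    intg Omega (fun x => tilde f psi x * witten f eta x) =
    intg Omega (fun x => tilde f u x * eta x).
  by move=> te; congr fine; exact: deq.
have sw := square_integrable_root oU sf f0 muf su.
have sV := smooth_potential oU sf f0.
have eqn := dirichlet_weak oU bU sf f0 sv sG wG weq.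
have approx := energy_approx oU bU sV sv sw sG eqn txi (cvge0_fine_le c1) (cvge0_fine_le c2).
split; first exact: (pairing_ge0 oU bU sf f0 approx).
exact: (dual_normE oU bU sf f0 muf su sv weq approx N0 Une).
Qed.
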